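(* Let $d\ge1$, $N\ge1$ and $l=d(N+1)$. Suppose $A,B$ are analytic $d\times d$ matrix-valued functions on $I=[-1,1]$ with common regularity ellipse $E\supset I$. Let $e^\eta=S+s>1$ be the sum of the semiaxes $S,s$ of $E$. Let $\delta>0$. Suppose $\hat{\mathbf{U}}\mathbf{x}=\mu\mathbf{x}$ for some $\mathbf{x}\in\mathbf{H}^1$ with $\|\mathbf{x}\|_{\mathbf{H}^1}=1$, and $|\mu|\ge\delta$. Let $\Phi_\mu(t)$ be the fundamental solution of $\dot{\mathbf{x}}=(A(t)+B(t)/\mu)\mathbf{x}$ with $\Phi_\mu(-1)=I_d$, let $\Phi_\mu(z)$ be its analytic continuation to $z\in E$, and suppose $C_\mu$ is an upper bound for $|\Phi_\mu(z)|$, $z\in E$. Let $$\epsilon_k=8\sqrt d\,C_\mu(\sinh\eta)^{-1}k\,e^{-k\eta},\qquad k=1,\dots,N.$$ Assume $\mathbf{U}_N=\mathbf{V}\mathbf{\Lambda}\mathbf{V}^{-1}$ with $\mathbf{\Lambda}=\operatorname{diag}(\lambda_1,\dots,\lambda_l)$ and eigenvalues ordered $|\lambda_1|\ge|\lambda_2|\ge\cdots$. Let $\hat{\mathbf{V}}:\mathbf{l}^2\to\mathbf{H}^1$ be the bounded invertible operator associated to $\mathbf{V}$ as described in the context, for which $\hat{\mathbf{U}}_N=\hat{\mathbf{V}}\hat{\mathbf{\Lambda}}\hat{\mathbf{V}}^{-1}$, and let $\operatorname{cond}(\hat{\mathbf{V}})=\|\hat{\mathbf{V}}\|\,\|\hat{\mathbf{V}}^{-1}\|$.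 Suppose $\|\hat{\mathbf{U}}(\tilde T_j\otimes\mathbf{e}_s)-\hat{\mathbf{U}}_N(\tilde T_j\otimes\mathbf{e}_s)\|_{\mathbf{H}^1}\le\nu_j^s$ for $j=0,\dots,N$ and $s=1,\dots,d$. Let $\xi_k=\left(\sum_{j=0}^k\sum_{s=1}^d(\nu_j^s)^2\right)^{1/2}$ and $$\omega_k=\epsilon_k\left(\|\hat{\mathbf{U}}\|+|\lambda_1|\operatorname{cond}(\hat{\mathbf{V}})\right)+(1+\epsilon_k)\xi_k,\qquad k=1,\dots,N.$$ Then $$\min_{i=1,\dots,d(N+1)}|\mu-\lambda_i|\le\min\{\omega_1,\dots,\omega_N\}\operatorname{cond}(\hat{\mathbf{V}}).$$
   Context: $I=[-1,1]$; $|\cdot|$ is the Euclidean norm on $\mathbb{C}^d$ and the induced norm on $d\times d$ matrices; $\mathbf{e}_1,\dots,\mathbf{e}_d$ is the standard basis of $\mathbb{C}^d$; $I_d,0_d$ are the $d\times d$ identity and zero matrices. A regularity ellipse $E\subset\mathbb{C}$ for given functions is a closed (filled) elliptical region with foci $\pm1$, semimajor and semiminor axes $S,s$, contained in an open set on which the functions are analytic. The delay system considered is $\dot{\mathbf{y}}(t)=A(t)\mathbf{y}(t)+B(t)\mathbf{y}(t-2)$, where $A,B$ are given on $I$ and extended with period $2$. $\Phi_A(t)$ solves $\dot\Phi_A=A\Phi_A$, $\Phi_A(-1)=I_d$. Hilbert space: $L^2$ is the space of measurable $f:I\to\mathbb{C}$ with $\int_{-1}^1|f|^2(1-t^2)^{-1/2}dt<\infty$,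 $\langle f,g\rangle_{L^2}=\int_{-1}^1\overline fg(1-t^2)^{-1/2}dt$. With $T_k(t)=\cos(k\arccos t)$ let $\hat T_0=\sqrt{1/\pi}\,T_0$, $\hat T_k=\sqrt{2/\pi}\,T_k$ ($k\ge1$), $\hat f_k=\langle\hat T_k,f\rangle_{L^2}$. $H^1=\{f\in L^2:\|f\|_{H^1}^2=\sum_{k\ge0}(1+k)^2|\hat f_k|^2<\infty\}$, with orthonormal basis $\tilde T_k=(1+k)^{-1}\hat T_k$, $k\ge 0$. Elements of $H^1$ have continuous representatives. $\mathbf{H}^1=H^1\otimes\mathbb{C}^d$ consists of $\mathbf{f}=(f_1,\dots,f_d)^\top$ with $f_s\in H^1$, $\|\mathbf{f}\|_{\mathbf{H}^1}^2=\sum_s\|f_s\|_{H^1}^2$. The monodromy operator $\hat{\mathbf{U}}\in\mathcal{L}(\mathbf{H}^1)$ (bounded operators) is $$(\hat{\mathbf{U}}\mathbf{f})(t)=\Phi_A(t)\left[\mathbf{f}(1)+\int_{-1}^t\Phi_A(s)^{-1}B(s)\mathbf{f}(s)\,ds\right].$$ Collocation: $t_j=\cos(\pi j/N)$, $j=0,\dots,N$; $\mathbf{P}\text{-space}$: $\boldsymbol{\mathcal{P}}_N$ is the space of $\mathbb{C}^d$-valued polynomials of degree $\le N$. $\mathbf{E}_N:\boldsymbol{\mathcal{P}}_N\to\mathbb{C}^l$ is evaluation, $\mathbf{E}_N\mathbf{f}=(\mathbf{f}(t_0)^\top,\dots,\mathbf{f}(t_N)^\top)^\top$; $\mathbf{P}_N=\mathbf{E}_N^{-1}$.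 $D_N$ is the $(N+1)\times(N+1)$ matrix sending the values at $t_0,\dots,t_N$ of a scalar polynomial of degree $\le N$ to the values of its derivative at those points; $\hat D_N$ is $D_N$ with last row replaced by $(0,\dots,0,1)$; $\hat{\mathbf{D}}_N=\hat D_N\otimes I_d$. $\hat M_A$ is block diagonal with blocks $A(t_0),\dots,A(t_{N-1}),0_d$. $\hat M_B$ is the block matrix with diagonal blocks $B(t_0),\dots,B(t_{N-1}),0_d$, with $I_d$ as the first block of its last block row, and zeros elsewhere. $\mathbf{U}_N=(\hat{\mathbf{D}}_N-\hat M_A)^{-1}\hat M_B\in\mathbb{C}^{l\times l}$ (the inverse is assumed to exist). $\mathbf{\Pi}_N$ is the orthogonal projection of $\mathbf{H}^1$ onto $\boldsymbol{\mathcal{P}}_N$ and $\hat{\mathbf{U}}_N=\mathbf{P}_N\mathbf{U}_N\mathbf{E}_N\mathbf{\Pi}_N\in\mathcal{L}(\mathbf{H}^1)$. Operator $\hat{\mathbf{V}}$: given $\mathbf{U}_N=\mathbf{V}\mathbf{\Lambda}\mathbf{V}^{-1}$, let $\mathbf{v}_k$ be the $k$th column of $\mathbf{V}$ and $\mathbf{p}_k=\mathbf{P}_N\mathbf{v}_k$. Let $\mathbf{l}^2=l^2\otimes\mathbb{C}^d$ with elements $\mathbf{a}=(a_1^1,\dots,a_1^d,a_2^1,\dots,a_2^d,\dots)$. Define $\hat{\mathbf{V}}\mathbf{a}=\sum_{j=1}^{N+1}\sum_{s=1}^da_j^s\mathbf{p}_{(j-1)d+s}+\sum_{j>N+1}\sum_{s=1}^da_j^s\tilde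 T_{j-1}\otimes\mathbf{e}_s$; $\hat{\mathbf{\Lambda}}\in\mathcal{L}(\mathbf{l}^2)$ is diagonal, multiplying the $k$th entry by $\lambda_k$ for $k\le l$ and by $0$ for $k>l$. *)

(* Defs.v *)
From HB Require Import structures.
From mathcomp Require Import all_boot all_order all_algebra.
From mathcomp Require Import complex.
From mathcomp Require Import all_classical all_reals all_analysis.

Set Implicit Arguments.
Unset Strict Implicit.
Unset Printing Implicit Defensive.

Import Order.TTheory GRing.Theory Num.Theory.
Import numFieldNormedType.Exports.
Import Normc.
Local Open Scope classical_set_scope.
Local Open Scope ring_scope.
Local Open Scope complex_scope.

(* The complex numbers are R[i]; their topology is the one carried by R[i]^o, *)
(* and normc is the R-valued modulus (`|z| being R[i]-valued).                *)

Section Norms.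
Context {R : realType}.
Implicit Type d : nat.
Local Notation C := R[i].

Definition vnorm d (v : 'cV[C]_d) : R :=
  Num.sqrt (\sum_(s < d) normc (v s 0) ^+ 2).

Definition mnorm d (M : 'M[C]_d) : R :=
  sup [set vnorm (M *m v) | v in [set v : 'cV[C]_d | vnorm v <= 1]].

Definition sinh (x : R) : R := (expR x - expR (- x)) / 2.

End Norms.

Section Analyticity.
Context {R : realType}.
Local Notation C := R[i].

Definition analytic_at (f : C -> C) (z0 : C) : Prop :=
  exists a : nat -> C, exists2 r : R, 0 < r &
    forall z : C, normc (z - z0) < r ->
      (series (fun k => a k * (z - z0) ^+ k) : nat -> C^o) @ \oo
        --> (f z : C^o).

Definition analytic_mx_on d (O : set C) (F : C -> 'M[C]_d) : Prop :=
  forall z, O z -> forall i j, analytic_at (fun w => F w i j) z.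

(* S and s are the semiaxes of an ellipse with foci -1 and 1. *)
Definition ellipse_axes (S s : R) : Prop :=
  [/\ 0 < s, s <= S & S ^+ 2 - s ^+ 2 = 1].

Definition ellipse (S s : R) : set C :=
  [set z | (complex.Re z / S) ^+ 2 + (complex.Im z / s) ^+ 2 <= 1].

End Analyticity.

Section FundamentalSolution.
Context {R : realType}.
Local Notation C := R[i].

Definition I11 : set R := `[-1, 1]%classic.

(* The derivative is taken within [-1,1], hence is one-sided at -1 and 1. *)
Definition has_deriv_within (f : R -> C) (t : R) (l : C) : Prop :=
  (fun u => (f u - f t) / (u - t)%:C : C^o) @ within I11 (t^')
    --> (l : C^o).

Definition fundamental_solution d (M Phi : R -> 'M[C]_d) : Prop :=
  Phi (-1) = 1%:M /\
  forall t, I11 t -> forall i j,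
    has_deriv_within (fun u => Phi u i j) t ((M t *m Phi t) i j).

End FundamentalSolution.

Section H1.
Context {R : realType}.
Local Notation C := R[i].
Local Notation leb := (@lebesgue_measure R).

Definition Cint (D : set R) (g : R -> C) : C :=
  (\int[leb]_(t in D) complex.Re (g t)) +i*
  (\int[leb]_(t in D) complex.Im (g t)).

Definition cheb_weight (t : R) : R := (Num.sqrt (1 - t ^+ 2))^-1.

Definition L2 (f : R -> C) : Prop :=
  [/\ measurable_fun I11 (fun t => complex.Re (f t)),
      measurable_fun I11 (fun t => complex.Im (f t)) &
      (\int[leb]_(t in I11) (normc (f t) ^+ 2 * cheb_weight t)%:E < +oo)%E].

Definition L2dot (f g : R -> C) : C :=
  Cint I11 (fun t => conjc (f t) * g t * (cheb_weight t)%:C).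

Definition cheb (k : nat) (t : R) : R := cos (k%:R * acos t).

Definition chebL2 (k : nat) (t : R) : R :=
  Num.sqrt ((if k == 0%N then 1 else 2) / pi) * cheb k t.

Definition chebH1 (k : nat) (t : R) : R := (k.+1%:R)^-1 * chebL2 k t.

Definition cheb_coef (f : R -> C) (k : nat) : C :=
  L2dot (fun t => (chebL2 k t)%:C) f.

Definition H1sqnorm (f : R -> C) : \bar R :=
  (\sum_(0 <= k <oo) (k.+1%:R ^+ 2 * normc (cheb_coef f k) ^+ 2)%:E)%E.

(* An element of H^1 is represented by its continuous representative.  It is  *)
(* a total function on R whose values outside [-1,1] are irrelevant: equality *)
(* in H^1 is equality on [-1,1].                                              *)
Definition H1 (f : R -> C) : Prop :=
  [/\ {within I11, continuous (f : R -> C^o)}, L2 f & (H1sqnorm f < +oo)%E].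

Definition component d (f : R -> 'cV[C]_d) (s : 'I_d) : R -> C := fun t => f t s 0.

Definition H1v d : set (R -> 'cV[C]_d) := [set f | forall s, H1 (component f s)].

Definition H1norm d (f : R -> 'cV[C]_d) : \bar R :=
  sqrte (\sum_(s < d) H1sqnorm (component f s))%E.

Definition H1dot d (f g : R -> 'cV[C]_d) : C :=
  \sum_(s < d) limn (series (fun k => k.+1%:R ^+ 2 *
    (conjc (cheb_coef (component f s) k) * cheb_coef (component g s) k)) : nat -> C^o).

Definition chebH1v d (k : nat) (s : 'I_d) : R -> 'cV[C]_d :=
  fun t => (chebH1 k t)%:C *: delta_mx s 0.

(* l^2 (x) C^d : a j is the j-th block, blocks being counted from 0. *)
Definition l2norm d (a : nat -> 'cV[C]_d) : \bar R :=
  sqrte (\sum_(0 <= j <oo) (vnorm (a j) ^+ 2)%:E)%E.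

Definition l2 d : set (nat -> 'cV[C]_d) := [set a | (l2norm a < +oo)%E].

(* Norm of T : (X, nX) -> (Y, nY), where X is a subset of the carrier type. *)
Definition opnorm (U W : Type) (X : set U) (nX : U -> \bar R)
    (nY : W -> \bar R) (T : U -> W) : \bar R :=
  ereal_sup [set nY (T f) | f in [set f | X f /\ (nX f <= 1)%E]].

Definition monodromy d (B : C -> 'M[C]_d) (PhiA : R -> 'M[C]_d)
    (f : R -> 'cV[C]_d) : R -> 'cV[C]_d :=
  fun t => PhiA t *m (f 1 + \col_i Cint `[-1, t]%classic
    (fun u => (invmx (PhiA u) *m B u%:C *m f u) i 0)).

End H1.

Section Collocation.
Context {R : realType}.
Variables (d N : nat).
Local Notation C := R[i].

(* l = d (N + 1), written so as to match the block operations of matrix.v;    *)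
(* tagnat.Rank j s is the index j d + s (see [sizeE] and [RankE]).            *)
Definition colloc_size : nat := \sum_(j < N.+1) d.
Local Notation l := colloc_size.

Definition node (j : 'I_N.+1) : R := cos (pi * j%:R / N%:R).

Definition nodeC (j : 'I_N.+1) : C := (node j)%:C.

Lemma sizeE : l = (d * N.+1)%N.
Proof. by rewrite /colloc_size sum_nat_const card_ord mulnC. Qed.

Lemma RankE (j : 'I_N.+1) (s : 'I_d) :
  tagnat.Rank j s = (j * d + s)%N :> nat.
Proof.
rewrite tagnat.RankEsum; congr (_ + _)%N.
by rewrite -(big_ord_widen N.+1 (fun=> d)) ?sum_nat_const ?card_ord // ltnW.
Qed.

Lemma nodeC_inj : injective nodeC.
Proof.
have nodeB (k : 'I_N.+1) : pi * k%:R / N%:R \in `[0 : R, pi].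
  rewrite in_itv /= !mulr_ge0 ?pi_ge0 ?ler0n ?invr_ge0 ?ler0n //=.
  have [N0|N0] := posnP N; first by
    rewrite (_ : N%:R = 0 :> R) ?invr0 ?mulr0 ?pi_ge0 // N0.
  by rewrite -mulrA ler_piMr ?pi_ge0 // ler_pdivrMr ?ltr0n // mul1r ler_nat
             -ltnS.
move=> i j [] /(cos_inj (nodeB i) (nodeB j)) eqij; apply: val_inj => /=.
have [N0|N0] := posnP N.
  have k0 (k : 'I_N.+1) : k = 0%N :> nat.
    by apply/eqP; rewrite -leqn0 -[X in (_ <= X)%N]N0 -ltnS.
  by rewrite !k0.
have Nn0 : N%:R^-1 != 0 :> R by rewrite invr_eq0 pnatr_eq0 -lt0n.
have pin0 : pi != 0 :> R by rewrite gt_eqF ?pi_gt0.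
by have /(mulfI pin0)/eqP := mulIf Nn0 eqij; rewrite eqr_nat => /eqP.
Qed.

Definition poly_space : set 'cV[{poly C}]_d :=
  [set p : 'cV[{poly C}]_d | forall s, (size (p s 0%R) <= N.+1)%N].

Definition poly_fun (p : 'cV[{poly C}]_d) : R -> 'cV[C]_d :=
  fun t => \col_s (p s 0).[t%:C].

Definition evalN (p : 'cV[{poly C}]_d) : 'cV[C]_l :=
  \mxcol_(j < N.+1) poly_fun p (node j).

Definition lagr (j : 'I_N.+1) : {poly C} :=
  \prod_(k < N.+1 | k != j) ((nodeC j - nodeC k)^-1 *: ('X - (nodeC k)%:P)).

Lemma lagr_node (j k : 'I_N.+1) : (lagr j).[nodeC k] = (j == k)%:R.
Proof.
rewrite horner_prod; case: (eqVneq j k) => [<-|jk].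
  apply: big1 => i ij; rewrite hornerZ hornerXsubC mulVf // subr_eq0.
  by rewrite (inj_eq nodeC_inj) eq_sym.
by rewrite (bigD1 k) 1?eq_sym //= hornerZ hornerXsubC subrr mulr0 mul0r.
Qed.

Lemma size_lagr (j : 'I_N.+1) : (size (lagr j) <= N.+1)%N.
Proof.
apply: leq_trans (size_poly_prod_leq _ _) _.
have -> : (\sum_(k < N.+1 | k != j)
    size ((nodeC j - nodeC k)^-1 *: ('X - (nodeC k)%:P)) =
    \sum_(k < N.+1 | k != j) 2)%N.
  apply: eq_bigr => k kj; rewrite size_scale ?size_XsubC // invr_eq0 subr_eq0.
  by rewrite (inj_eq nodeC_inj) eq_sym.
rewrite sum_nat_const cardC1 card_ord leq_subLR muln2 -addnn.
by rewrite addnS.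
Qed.

Lemma lagr_gen (p : {poly C}) : (size p <= N.+1)%N ->
  p = \sum_(j < N.+1) p.[nodeC j] *: lagr j.
Proof.
move=> sp; apply/eqP; rewrite -subr_eq0; apply/eqP.
set q := _ - _; apply: (@roots_geq_poly_eq0 _ q (codom nodeC)).
- apply/allP => _ /codomP[k ->]; rewrite rootE /q hornerD hornerN horner_sum.
  rewrite (bigD1 k) //= big1 => [|i ik]; rewrite hornerZ lagr_node.
    by rewrite eqxx mulr1 addr0 subrr.
  by rewrite (negPf ik) mulr0.
- by apply/injectiveP; exact: nodeC_inj.
- rewrite size_codom card_ord (leq_trans (size_polyD _ _)) // geq_max sp.
  rewrite size_polyN (leq_trans (size_sum _ _ _)) //.
  by apply/bigmax_leqP => i _; rewrite (leq_trans (size_scale_leq _ _))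
    // size_lagr.
Qed.

(* Inverse of evalN on poly_space: see [evalNK] and [interpNK]. *)
Definition interpN (v : 'cV[C]_l) : 'cV[{poly C}]_d :=
  \col_s \sum_(j < N.+1) submxcol v j s 0 *: lagr j.

Lemma interp_poly_space (v : 'cV[C]_l) : poly_space (interpN v).
Proof.
move=> s; rewrite mxE (leq_trans (size_sum _ _ _)) //.
by apply/bigmax_leqP => i _; rewrite (leq_trans (size_scale_leq _ _))
  // size_lagr.
Qed.

Lemma interpNK (v : 'cV[C]_l) : evalN (interpN v) = v.
Proof.
apply/mxcolP => k; rewrite mxcolK; apply/colP => s; rewrite !mxE horner_sum.
rewrite (bigD1 k) //= big1 => [|i ik]; rewrite hornerZ lagr_node.
  by rewrite eqxx mulr1 addr0 mxE.
by rewrite (negPf ik) mulr0.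
Qed.

Lemma evalNK (p : 'cV[{poly C}]_d) : poly_space p -> interpN (evalN p) = p.
Proof.
move=> pP; apply/colP => s; rewrite mxE [RHS](lagr_gen (pP s)).
by apply: eq_bigr => j _; rewrite mxcolK mxE.
Qed.

(* See [diffmxE]. *)
Definition diffmx : 'M[C]_N.+1 := \matrix_(i, j) (lagr j)^`().[nodeC i].

Lemma diffmxE (p : {poly C}) : (size p <= N.+1)%N ->
  diffmx *m (\col_j p.[nodeC j]) = \col_j p^`().[nodeC j].
Proof.
move=> sp; apply/colP => i; rewrite !mxE {2}(lagr_gen sp) raddf_sum horner_sum.
by apply: eq_bigr => j _; rewrite !mxE /= derivZ hornerZ mulrC.
Qed.

Definition diffmx_hat : 'M[C]_N.+1 :=
  \matrix_(i, j) if i == ord_max then (j == ord_max)%:R else diffmx i j.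

Definition diffmx_hatI : 'M[C]_l :=
  \mxblock_(i < N.+1, j < N.+1) ((diffmx_hat i j)%:M : 'M[C]_d).

Definition mxA (A : C -> 'M[C]_d) : 'M[C]_l :=
  \mxblock_(i < N.+1, j < N.+1)
    (if (i == j) && (i != ord_max) then A (nodeC i) else 0).

Definition mxB (B : C -> 'M[C]_d) : 'M[C]_l :=
  \mxblock_(i < N.+1, j < N.+1)
    (if i == ord_max then (if j == ord0 then 1%:M : 'M[C]_d else 0)
     else if i == j then B (nodeC i) else 0).

Definition monodromy_mx (A B : C -> 'M[C]_d) : 'M[C]_l :=
  invmx (diffmx_hatI - mxA A) *m mxB B.

Definition orth_proj (P : (R -> 'cV[C]_d) -> 'cV[{poly C}]_d) : Prop :=
  forall f, H1v f -> poly_space (P f) /\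
    forall q, poly_space q ->
      H1dot (poly_fun q) (fun t => f t - poly_fun (P f) t) = 0.

Definition monodromyN (A B : C -> 'M[C]_d)
    (P : (R -> 'cV[C]_d) -> 'cV[{poly C}]_d)
    (f : R -> 'cV[C]_d) : R -> 'cV[C]_d :=
  poly_fun (interpN (monodromy_mx A B *m evalN (P f))).

Definition Vhat_partial (V : 'M[C]_l) (a : nat -> 'cV[C]_d) (n : nat) :
    R -> 'cV[C]_d :=
  fun t =>
    \sum_(j < N.+1) \sum_(s < d)
      a j s 0 *: poly_fun (interpN (col (tagnat.Rank j s) V)) t +
    \sum_(N.+1 <= j < n) \sum_(s < d) a j s 0 *: chebH1v j s t.

(* The series defining the operator converges in the norm of H^1. *)
Definition is_Vhat (V : 'M[C]_l)
    (Vh : (nat -> 'cV[C]_d) -> (R -> 'cV[C]_d)) : Prop :=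
  forall a, l2 a -> H1v (Vh a) /\
    H1norm (fun t => Vh a t - Vhat_partial V a n t) @[n --> \oo] --> 0%E.

Definition is_inverse (Vh : (nat -> 'cV[C]_d) -> (R -> 'cV[C]_d))
    (Vi : (R -> 'cV[C]_d) -> (nat -> 'cV[C]_d)) : Prop :=
  (forall f, H1v f -> l2 (Vi f) /\ {in I11, Vh (Vi f) =1 f}) /\
  (forall a, l2 a -> Vi (Vh a) = a).

End Collocation.

(* Main.v *)
Require Import Defs.
From HB Require Import structures.
From mathcomp Require Import all_boot all_order all_algebra.
From mathcomp Require Import complex.
From mathcomp Require Import zify ring lra.
From mathcomp Require Import all_classical all_reals all_analysis.
From mathcomp Require Import measurable_realfun.

Set Implicit Arguments.
Unset Strict Implicit.
Unset Printing Implicit Defensive.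

Import Order.TTheory GRing.Theory Num.Theory.
Import numFieldNormedType.Exports.
Import Normc.
Local Open Scope classical_set_scope.
Local Open Scope ring_scope.
Local Open Scope complex_scope.

(** The proof is a Bauer-Fike argument on coefficient sequences.  A function f is
    represented by its coordinates [hcoef f] in the orthonormal basis of the
    Sobolev space, so that its norm is an l2 norm ([H1normE]), and the operator
    formed with the eigenvectors acts on sequences by the explicit formula
    [synth V] ([hcoef_Vhat]).

    Let a be the sequence that V maps to the eigenfunction x, and let L be the
    diagonal operator with the eigenvalues lam_i on the first d (N + 1) entries
    and with lam_1 on all the others.  Every diagonal entry of L - mu has modulus
    at least m, the minimum of the |mu - lam_i|; therefore m |a| is at most
    |(L - mu) a|, while |a| is at least 1 / |V|.  There remains the sequence
    V (L - mu) a = V L a - U x, which is estimated after cutting x at degree k.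
    The head is a polynomial of degree at most N, on which V L V^-1 is the
    collocation operator; the errors nu and the Cauchy-Schwarz inequality give
    xi_k.  The tail has norm at most eps_k and is estimated by the norms of U and
    of V L V^-1, the latter being at most |lam_1| cond V.  This yields
    m <= cond V (xi_k + eps_k (|U| + |lam_1| cond V)) ([bauer_fike],
    [eigenvalue_bound]).  If eps_k >= 1, the estimate of the tail fails, but then
    |mu - lam_1| <= |mu| + |lam_1| <= |U| + |lam_1| cond V already gives the claim.

    The tail is small because x is analytic.  On an eigenfunction the delay
    equation is an ordinary one, so x = Phi_mu x(-1) ([eigenfunction_ode]); hence x
    continues to the ellipse and is bounded there by C_mu |x(-1)|, where
    |x(-1)|^2 <= 3 / pi because evaluation at -1 is bounded on the Sobolev space
    ([endpoint_bound], [vector_endpoint_bound]).  A function bounded by M on the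
    ellipse has Chebyshev coefficients of order M exp (- j eta) ([ccoef_decay]), and
    a geometric sum turns this into eps_k ([tail_constant],
    [eigenfunction_tail]).

    The decay itself comes from the substitution z = cosh (s + i t), under which
    the j-th coefficient is an integral over a period in t, at s = 0, of
    f (cosh (s + i t)) exp (j (s + i t)).  The integral does not depend on s
    ([contour_integral_constant]), and at s = - eta the exponential is small.
    Analyticity enters through first-order expansions with a locally uniform
    quadratic remainder ([holo_at], [analytic_holo]). *)

(** * Integrals against the Chebyshev weight *)

Section Substitution.
Context {R : realType}.
Local Notation leb := (@lebesgue_measure R).

Lemma integrable_cc (a b : R) (g : R -> R) :
  {within `[a, b], continuous g} -> leb.-integrable `[a, b] (EFin \o g).
Proof. by move=> cg; apply: continuous_compact_integrable => //; exact: segment_compact. Qed.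

Lemma I11_cos (t : R) : I11 (cos t).
Proof. by rewrite /I11 /= in_itv /= cos_geN1 cos_le1. Qed.

Lemma I11_N1 : I11 (-1 : R).
Proof. by rewrite /I11 /= in_itv /= lexx; lra. Qed.

Lemma I11_interior (t : R) : -1 < t < 1 -> I11 t.
Proof. by move=> /andP[a b]; rewrite /I11 /= in_itv /= !ltW. Qed.

Lemma continuous_compose_cos (T : topologicalType) (g : R -> T) :
  {within I11, continuous g} -> continuous (g \o cos).
Proof.
move=> /subspace_continuousP cg t.
apply: cvg_trans (cg _ (I11_cos t)) => A /= [e e0 He].
have /= := @continuous_cos R t _ (nbhsx_ballx _ _ e0).
apply: (@filterS _ (nbhs t)) => u Hu; apply: He => //; exact: I11_cos.
Qed.

Lemma measurable_cheb_weight : measurable_fun setT (@cheb_weight R).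
Proof.
have -> : @cheb_weight R = (fun t => (Num.sqrt (1 - t ^+ 2)) `^ (-1)).
  apply/funext => t; rewrite /cheb_weight.
  by rewrite -powR_inv1 ?sqrtr_ge0.
apply: (measurableT_comp (@measurable_powR R (-1))).
apply: measurableT_comp; first by apply: continuous_measurable_fun; exact: sqrt_continuous.
by apply: measurable_funB => //; exact: exprn_measurable.
Qed.

Lemma measurable_weighted (g : R -> R) :
  {within I11, continuous g} -> measurable_fun I11 (fun t => g t * cheb_weight t).
Proof.
move=> cg; apply: measurable_funM; last exact: measurable_funS measurable_cheb_weight.
by apply: subspace_continuous_measurable_fun => //; exact: measurable_itv.
Qed.

Lemma cheb_weight_cos (t : R) : 0 < t < pi -> cheb_weight (cos t) = (sin t)^-1.
Proof.
move=> t0; rewrite /cheb_weight -sin2cos2 sqrtr_sqr ger0_norm //.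
by rewrite ltW // sin_gt0_pi.
Qed.

(** The substitution is regular away from the zeros 0 and pi of the sine, which
    the segments from cut n to pi - cut n avoid. *)
Let cut (n : nat) : R := n.+1%:R^-1.

Let cut_gt0 n : 0 < cut n. Proof. by rewrite invr_gt0. Qed.

Let cut_le1 n : cut n <= 1.
Proof. by rewrite invf_le1 // ler1n. Qed.

Let cut_lt n : cut n < pi - cut n.
Proof.
have := cut_le1 n; have := @pi_ge2 R; rewrite le_eqVlt => /orP[/eqP h|]; last by lra.
by have := cos_pihalf R; have := @cos1_gt0 R; rewrite -h divff // => /[swap] ->; rewrite ltxx.
Qed.

Let cut_noninc m n : (m <= n)%N -> cut n <= cut m.
Proof. by move=> mn; rewrite lef_pV2 ?posrE // ler_nat. Qed.

Let cut_lim (e : R) : 0 < e -> exists n, cut n < e.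
Proof.
move=> e0; exists (Num.trunc e^-1); rewrite /cut invf_plt ?posrE //.
exact: truncnS_gt.
Qed.

Let weighted_cut (g : R -> R) n : {within I11, continuous g} ->
  (\int[leb]_(t in `[cos (pi - cut n)%R, cos (cut n)]) (g t * cheb_weight t)%:E =
   \int[leb]_(t in `[cut n, (pi - cut n)%R]) (g (cos t))%:E)%E.
Proof.
move=> cg.
have c0 := cut_gt0 n; have cl := cut_lt n.
have din (t : R) : cut n <= t <= pi - cut n -> 0 < t < pi by lra.
have dcos : derive1 (@cos R) = (fun t => - sin t).
  by apply/funext => t; rewrite derive1E derive_val.
rewrite (@integration_by_substitution_decreasing R (@cos R)) //.
- apply: eq_integral => t; rewrite inE /= in_itv /= => /din t0; congr EFin.
  rewrite !fctE /= dcos opprK cheb_weight_cos //.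
  by rewrite -mulrA mulVf ?mulr1 // gt_eqF // sin_gt0_pi.
- exact: ltW.
- move=> x y; rewrite !in_itv /= => /din /andP[x0 xp] /din /andP[y0 yp] xy.
  by rewrite ltr_cos // in_itv /= !ltW.
- by rewrite dcos => t _; apply: continuousN; exact: continuous_sin.
- rewrite dcos; apply: is_cvgN; apply/cvg_ex; exists (sin (cut n)).
  by apply: cvg_at_right_filter; exact: continuous_sin.
- rewrite dcos; apply: is_cvgN; apply/cvg_ex; exists (sin (pi - cut n)).
  by apply: cvg_at_left_filter; exact: continuous_sin.
- split.
  + by move=> t _; exact: derivable_cos.
  + by apply: cvg_at_right_filter; exact: continuous_cos.
  + by apply: cvg_at_left_filter; exact: continuous_cos.
- have sub : `[cos (pi - cut n), cos (cut n)] `<=` I11.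
    move=> t; rewrite /I11 /= !in_itv /= => /andP[h1 h2].
    by rewrite (le_trans _ h1) ?cos_geN1 //= (le_trans h2) ?cos_le1.
  apply/subspace_continuousP => t tin.
  apply: cvgM.
    have /subspace_continuousP := continuous_subspaceW sub cg.
    exact.
  have t1 : -1 < t < 1.
    move: tin; rewrite /= in_itv /= => /andP[h1 h2].
    rewrite (lt_le_trans _ h1) /=; last first.
      rewrite -cospi ltr_cos ?in_itv /= ?pi_ge0 ?lexx //; lra.
    rewrite (le_lt_trans h2) //.
    by rewrite -[ltRHS]cos0 ltr_cos ?in_itv /= ?pi_ge0 ?lexx //; lra.
  apply: cvg_within_filter; apply: cvgV.
    rewrite sqrtr_eq0 -ltNge; nra.
  apply: continuous_comp; last exact: sqrt_continuous.
  apply: cvgB; first exact: cvg_cst.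
  exact: exprn_continuous.
Qed.

Let bigcup_cos_cut :
  \bigcup_n `[cos (pi - cut n), cos (cut n)]%classic = `](-1), 1[%classic :> set R.
Proof.
apply/seteqP; split => t.
  move=> [n _]; rewrite /= !in_itv /=.
  have c0 := cut_gt0 n; have cl := cut_lt n.
  move=> /andP[h1 h2]; rewrite (lt_le_trans _ h1) /=; last first.
    by rewrite -cospi ltr_cos ?in_itv /= ?pi_ge0 ?lexx //; lra.
  rewrite (le_lt_trans h2) //.
  by rewrite -[ltRHS]cos0 ltr_cos ?in_itv /= ?pi_ge0 ?lexx //; lra.
rewrite /= in_itv /= => /andP[h1 h2].
have a0 : 0 < acos t by apply: acos_gt0; rewrite h2 ltW.
have ap : acos t < pi by apply: acos_ltpi; rewrite h1 ltW.
have tE : cos (acos t) = t by rewrite acosK // in_itv /= !ltW.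
have [n hn] : exists n, cut n < Num.min (acos t) (pi - acos t).
  by apply: cut_lim; rewrite lt_min a0 subr_gt0.
move: hn; rewrite lt_min => /andP[n1 n2].
have c0 := cut_gt0 n; have cl := cut_lt n.
exists n => //=; rewrite in_itv /= -tE.
by rewrite !leNgt !ltr_cos ?in_itv /= -?leNgt; lra.
Qed.

Let bigcup_cut :
  \bigcup_n `[cut n, (pi - cut n)]%classic = `]0, pi[%classic :> set R.
Proof.
apply/seteqP; split => t.
  by move=> [n _]; rewrite /= !in_itv /=; have := cut_gt0 n; lra.
rewrite /= in_itv /= => /andP[h1 h2].
have [n] : exists n, cut n < Num.min t (pi - t).
  by apply: cut_lim; rewrite lt_min h1 subr_gt0.
rewrite lt_min => hn; exists n => //=; rewrite in_itv /=; lra.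
Qed.

Let ge0_weighted_change (g : R -> R) : {within I11, continuous g} ->
  (forall t, I11 t -> 0 <= g t) ->
  (\int[leb]_(t in I11) (g t * cheb_weight t)%:E =
   \int[leb]_(t in `[0%R, pi]) (g (cos t))%:E)%E.
Proof.
move=> cg g0.
have mw := measurable_weighted cg.
have cgc := continuous_compose_cos cg.
have mc : measurable_fun setT (g \o cos) by exact: continuous_measurable_fun.
have w0 (t : R) : 0 <= cheb_weight t by rewrite invr_ge0 sqrtr_ge0.
rewrite /I11 [LHS](integral_itv_bndoo true false); last first.
  apply/measurable_EFinP; apply: (measurable_funS _ _ mw).
    exact: measurable_itv.
  exact: subset_itv_oo_cc.
rewrite [RHS](integral_itv_bndoo true false); last first.
  by apply/measurable_EFinP; apply: measurable_funS mc.
rewrite -bigcup_cos_cut -bigcup_cut.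
have sub n : `[cos (pi - cut n), cos (cut n)] `<=` I11.
  move=> t; rewrite /I11 /= !in_itv /= => /andP[h1 h2].
  by rewrite (le_trans _ h1) ?cos_geN1 //= (le_trans h2) ?cos_le1.
have H1 : (\int[leb]_(t in `[cos (pi - cut n)%R, cos (cut n)])
    (g t * cheb_weight t)%:E @[n --> \oo] -->
    \int[leb]_(t in \bigcup_n `[cos (pi - cut n)%R, cos (cut n)]%classic)
    (g t * cheb_weight t)%:E)%E.
  apply: ge0_nondecreasing_set_cvg_integral.
  - move=> m n mn; rewrite subsetEset => t; rewrite /= !in_itv /= => /andP[h1 h2].
    have := cut_noninc mn; have := cut_gt0 n; have := cut_lt m; have := cut_lt n.
    move=> q1 q2 q3 q4.
    rewrite (le_trans _ h1) ?(le_trans h2) //.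
      by rewrite leNgt ltr_cos ?in_itv /= -?leNgt; lra.
    by rewrite leNgt ltr_cos ?in_itv /= -?leNgt; lra.
  - by move=> n; exact: measurable_itv.
  - move=> n; apply/measurable_EFinP; apply: measurable_funS mw => //.
    exact: measurable_itv.
  - by move=> n t /sub tI; rewrite lee_fin mulr_ge0 // g0.
have H2 : (\int[leb]_(t in `[cut n, (pi - cut n)%R]) (g (cos t))%:E @[n --> \oo] -->
    \int[leb]_(t in \bigcup_n `[cut n, (pi - cut n)%R]%classic) (g (cos t))%:E)%E.
  apply: ge0_nondecreasing_set_cvg_integral.
  - move=> m n mn; rewrite subsetEset => t; rewrite /= !in_itv /= => h.
    by have := cut_noninc mn; lra.
  - by move=> n; exact: measurable_itv.
  - move=> n; apply/measurable_EFinP; apply: measurable_funS mc => //.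
  - by move=> n t _; rewrite lee_fin g0 //; exact: I11_cos.
rewrite (_ : (fun n => _) = (fun n => \int[leb]_(t in `[cut n, (pi - cut n)%R])
    (g (cos t))%:E)%E) in H1; last first.
  by apply/funext => n; exact: weighted_cut.
exact: (cvg_unique _ H1 H2).
Qed.

(** The weight is the image of the constant density on [0, pi], whence a finite
    integral in spite of its poles at both ends. *)
Lemma integrable_cheb_weight : leb.-integrable I11 (EFin \o @cheb_weight R).
Proof.
have w0 (t : R) : 0 <= cheb_weight t by rewrite invr_ge0 sqrtr_ge0.
apply/integrableP; split.
  by apply/measurable_EFinP; apply: measurable_funS measurable_cheb_weight.
have c1 : {within I11, continuous (fun _ : R => 1 : R)}.
  by apply: continuous_subspaceT => t; exact: cvg_cst.
have := ge0_weighted_change c1 (fun _ _ => ler01).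
under eq_integral do rewrite mul1r.
under [X in (X < _)%E]eq_integral do rewrite /= ger0_norm //.
move=> ->; rewrite integral_cst //= mul1e lebesgue_measure_itv /= lte_fin pi_gt0.
by rewrite ltry.
Qed.

Lemma within_bounded (g : R -> R) : {within I11, continuous g} ->
  exists2 M : R, 0 <= M & forall t, I11 t -> `|g t| <= M.
Proof.
move=> cg.
have /compact_bounded[M [_ hM]] := continuous_compact cg (@segment_compact R (-1) 1).
exists (`|M| + 1) => [|t It]; first by rewrite addr_ge0.
by apply: hM; [rewrite (le_lt_trans (ler_norm _)) // ltrDl|exists t].
Qed.

Lemma integrable_weighted (g : R -> R) : {within I11, continuous g} ->
  leb.-integrable I11 (fun t => (g t * cheb_weight t)%:E).
Proof.
move=> cg; have [M M0 hM] := within_bounded cg.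
have mI : measurable (@I11 R : set (measurableTypeR R)) by exact: measurable_itv.
have iM := integrableZl mI M integrable_cheb_weight.
apply: le_integrable iM => //.
  by apply/measurable_EFinP; exact: measurable_weighted.
move=> t It; rewrite lee_fin /= normrM normrM ler_wpM2r //.
by rewrite (le_trans (hM _ It)) // ler_norm.
Qed.

(** The substitution t = cos u.  The weight is singular at both ends, so the
    formula is proved for nonnegative functions on segments that exhaust the
    open interval, and a shift by a constant removes the sign hypothesis. *)
Lemma weighted_change (g : R -> R) : {within I11, continuous g} ->
  \int[leb]_(t in I11) (g t * cheb_weight t) = \int[leb]_(t in `[0, pi]) g (cos t).
Proof.
move=> cg; have [M M0 hM] := within_bounded cg.
have mI : measurable (@I11 R : set (measurableTypeR R)) by exact: measurable_itv.
have cM : {within I11, continuous (fun _ : R => M : R)}.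
  by apply: continuous_subspaceT => t; exact: cvg_cst.
have cgM : {within I11, continuous (fun t => g t + M)}.
  by move=> t; apply: cvgD; [exact: cg|exact: cM].
have iM := integrable_weighted cM; have ig := integrable_weighted cg.
have E1 : \int[leb]_(t in I11) ((g t + M) * cheb_weight t) =
    \int[leb]_(t in `[0, pi]) (g (cos t) + M).
  rewrite /Rintegral (ge0_weighted_change cgM) // => t It.
  have := hM _ It; rewrite ler_norml => /andP[+ _]; lra.
have E2 : \int[leb]_(t in I11) (M * cheb_weight t) = \int[leb]_(t in `[0, pi]) M.
  by rewrite /Rintegral (ge0_weighted_change cM).
have D1 : \int[leb]_(t in I11) ((g t + M) * cheb_weight t) =
    \int[leb]_(t in I11) (g t * cheb_weight t) + \int[leb]_(t in I11) (M * cheb_weight t).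
  rewrite -(RintegralD mI ig iM).
  by apply: eq_Rintegral => t _; rewrite mulrDl.
move: E1; rewrite D1 E2 RintegralD //; first by move/addIr.
- by apply: integrable_cc; apply: continuous_subspaceT; exact: continuous_compose_cos.
- by apply: integrable_cc; apply: continuous_subspaceT => t; exact: cvg_cst.
Qed.

End Substitution.

(** * Complex numbers and Chebyshev polynomials *)

Section ComplexTopology.
Context {R : realType}.
Local Notation C := R[i].
Implicit Types z w : C.

Lemma sqr_normcE z : normc z ^+ 2 = complex.Re z ^+ 2 + complex.Im z ^+ 2.
Proof. by case: z => a b /=; rewrite sqr_sqrtr // addr_ge0 ?sqr_ge0. Qed.

Lemma normc_ge0 z : 0 <= normc z.
Proof. by case: z => a b /=; exact: sqrtr_ge0. Qed.

Lemma normcZ (a : R) z : normc (a%:C * z) = `|a| * normc z.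
Proof. by rewrite normcM /= expr0n /= addr0 sqrtr_sqr. Qed.

Lemma normcR (a : R) : normc a%:C = `|a|.
Proof. by rewrite /= expr0n /= addr0 sqrtr_sqr. Qed.

Lemma normc_oppB z w : normc (z - w) = normc (w - z).
Proof. by rewrite -normcN opprB. Qed.

Lemma ler_normcB z w : normc (z - w) <= normc z + normc w.
Proof. by rewrite (le_trans (le_normcD _ _)) // normcN. Qed.

Lemma normc_sum (I : Type) (r : seq I) (P : pred I) (F : I -> C) :
  normc (\sum_(i <- r | P i) F i) <= \sum_(i <- r | P i) normc (F i).
Proof.
elim/big_rec2 : _ => [|i y x _ h]; first by rewrite normc0.
by rewrite (le_trans (le_normcD _ _)) // lerD2l.
Qed.

Lemma normc_exp z n : normc (z ^+ n) = normc z ^+ n.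
Proof. by elim: n => [|n IH]; rewrite ?expr0 ?normc1 // !exprS normcM IH. Qed.

Lemma abs_Re_le z : `|complex.Re z| <= normc z.
Proof.
rewrite -(@ler_pXn2r _ 2) ?nnegrE ?normc_ge0 // real_normK ?num_real //.
by rewrite sqr_normcE lerDl sqr_ge0.
Qed.

Lemma abs_Im_le z : `|complex.Im z| <= normc z.
Proof.
rewrite -(@ler_pXn2r _ 2) ?nnegrE ?normc_ge0 // real_normK ?num_real //.
by rewrite sqr_normcE lerDr sqr_ge0.
Qed.

Lemma normc_le_ReIm z : normc z <= `|complex.Re z| + `|complex.Im z|.
Proof.
rewrite -(@ler_pXn2r _ 2) ?nnegrE ?normc_ge0 ?addr_ge0 // sqr_normcE.
rewrite sqrrD !real_normK ?num_real // -addrA lerD2l lerDr.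
by rewrite mulrn_wge0 // mulr_ge0.
Qed.

Lemma cReD z w : complex.Re (z + w) = complex.Re z + complex.Re w.
Proof. by case: z; case: w. Qed.
Lemma cImD z w : complex.Im (z + w) = complex.Im z + complex.Im w.
Proof. by case: z; case: w. Qed.
Lemma cReN z : complex.Re (- z) = - complex.Re z. Proof. by case: z. Qed.
Lemma cImN z : complex.Im (- z) = - complex.Im z. Proof. by case: z. Qed.
Lemma cReM z w : complex.Re (z * w) =
  complex.Re z * complex.Re w - complex.Im z * complex.Im w.
Proof. by case: z; case: w. Qed.
Lemma cImM z w : complex.Im (z * w) =
  complex.Re z * complex.Im w + complex.Im z * complex.Re w.
Proof. by case: z; case: w. Qed.

Definition cE := (cReD, cImD, cReN, cImN, cReM, cImM).

Lemma complex_ext z w : complex.Re z = complex.Re w ->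
  complex.Im z = complex.Im w -> z = w.
Proof. by case: z => a b; case: w => c e /= -> ->. Qed.

Lemma ltc0P (e : C) : 0 < e -> exists2 r : R, 0 < r & e = r%:C.
Proof. by case: e => a b; rewrite ltcE /= => /andP[/eqP -> a0]; exists a. Qed.

Lemma norm_normcE (z : C) : `|z| = (normc z)%:C.
Proof. by []. Qed.

(** The norm that defines the topology takes its values in R[i]; this is the
    passage to estimates of the real-valued modulus. *)
Lemma cvgCP (T : Type) (F : set_system T) (FF : Filter F) (f : T -> C) (l : C) :
  (f x @[x --> F] --> (l : C^o)) <->
  (forall e : R, 0 < e -> \forall x \near F, normc (f x - l) < e).
Proof.
have H := @cvgrPdist_lt C C^o T F FF f l.
split=> [/H h e e0|h].
  have e0' : 0 < (e%:C : C) by rewrite ltcR.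
  apply: filterS (h _ e0') => x /=.
  by rewrite norm_normcE ltcR normc_oppB.
apply/H => e /ltc0P[r r0 ->]; apply: filterS (h _ r0) => x.
by rewrite norm_normcE ltcR normc_oppB.
Qed.

Lemma cvgC_Re (T : Type) (F : set_system T) (FF : Filter F) (f : T -> C) (l : C) :
  (f x @[x --> F] --> (l : C^o)) ->
  complex.Re (f x) @[x --> F] --> (complex.Re l : R).
Proof.
move=> /cvgCP h; apply/cvgrPdist_lt => e e0; apply: filterS (h _ e0) => x.
by apply: le_lt_trans; rewrite distrC -cReN -cReD abs_Re_le.
Qed.

Lemma cvgC_Im (T : Type) (F : set_system T) (FF : Filter F) (f : T -> C) (l : C) :
  (f x @[x --> F] --> (l : C^o)) ->
  complex.Im (f x) @[x --> F] --> (complex.Im l : R).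
Proof.
move=> /cvgCP h; apply/cvgrPdist_lt => e e0; apply: filterS (h _ e0) => x.
by apply: le_lt_trans; rewrite distrC -cImN -cImD abs_Im_le.
Qed.

Lemma cvgC_ReIm (T : Type) (F : set_system T) (FF : Filter F) (f : T -> C) (l : C) :
  complex.Re (f x) @[x --> F] --> (complex.Re l : R) ->
  complex.Im (f x) @[x --> F] --> (complex.Im l : R) ->
  f x @[x --> F] --> (l : C^o).
Proof.
move=> /cvgrPdist_lt h1 /cvgrPdist_lt h2; apply/cvgCP => e e0.
have e2 : 0 < e / 2 by rewrite divr_gt0.
near=> x.
rewrite (le_lt_trans (normc_le_ReIm _)) // (splitr e) cReD cImD cReN cImN.
by rewrite ltrD // distrC; near: x; [exact: h1|exact: h2].
Unshelve. all: by end_near. Qed.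

(** The prefixes r, w, v and m distinguish continuity on [-1, 1] of functions with
    values in R, in C, in column vectors and in matrices. *)
Definition wcont (f : R -> C) : Prop := {within I11, continuous (f : R -> C^o)}.

Lemma wcontP (f : R -> C) : wcont f <->
  {within I11, continuous (fun t => complex.Re (f t))} /\
  {within I11, continuous (fun t => complex.Im (f t))}.
Proof.
split=> [/subspace_continuousP cf|[/subspace_continuousP h1 /subspace_continuousP h2]].
  by split; apply/subspace_continuousP => t It; [apply: cvgC_Re|apply: cvgC_Im]; exact: cf.
by apply/subspace_continuousP => t It; apply: cvgC_ReIm; [exact: h1|exact: h2].
Qed.

End ComplexTopology.

Section ChebyshevPolynomials.

(** The recursion carries two consecutive polynomials. *)
Fixpoint chebpp (K : numFieldType) (n : nat) : {poly K} * {poly K} :=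
  if n is n'.+1 then
    let: (p, q) := chebpp K n' in (q, 2%:P * 'X * q - p)
  else (1, 'X).

Definition chebp (K : numFieldType) (n : nat) : {poly K} := (chebpp K n).1.

Lemma chebp0 K : chebp K 0 = 1. Proof. by []. Qed.
Lemma chebp1 K : chebp K 1 = 'X. Proof. by []. Qed.
Lemma chebpSS K n : chebp K n.+2 = 2%:P * 'X * chebp K n.+1 - chebp K n.
Proof. by rewrite /chebp /=; case: (chebpp K n). Qed.

Lemma chebp_ind2 (P : nat -> Prop) : P 0 -> P 1 ->
  (forall n, P n -> P n.+1 -> P n.+2) -> forall n, P n.
Proof.
move=> P0 P1 PS n; suff [] : P n /\ P n.+1 by [].
by elim: n => [|n [h1 h2]]; split => //; exact: PS.
Qed.

Lemma size_chebp (K : numFieldType) n : size (chebp K n) = n.+1.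
Proof.
elim/chebp_ind2 : n => [||n h1 h2].
- by rewrite chebp0 size_poly1.
- by rewrite chebp1 size_polyX.
- have n0 : chebp K n.+1 != 0 by rewrite -size_poly_eq0 h2.
  have e : size (2%:P * 'X * chebp K n.+1) = n.+3.
    rewrite -mulrA size_Cmul ?pnatr_eq0 // mulrC size_mulX // h2 //.
  by rewrite chebpSS size_polyDl e // size_polyN h1.
Qed.

Lemma chebp_horner_cos (R : realType) n (u : R) : (chebp R n).[cos u] = cos (n%:R * u).
Proof.
elim/chebp_ind2 : n => [||n h1 h2].
- by rewrite chebp0 hornerC mul0r cos0.
- by rewrite chebp1 hornerX mul1r.
- rewrite chebpSS !hornerE h1 h2.
  have -> : n.+2%:R * u = n.+1%:R * u + u by rewrite -[n.+2]addn1 natrD; ring.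
  have -> : n%:R * u = n.+1%:R * u - u by rewrite -[n.+1]addn1 natrD; ring.
  by rewrite cosB cosD; ring.
Qed.

Lemma chebp_horner_complex (R : realType) n (t : R) :
  (chebp R[i] n).[t%:C] = ((chebp R n).[t])%:C.
Proof.
elim/chebp_ind2 : n => [||n h1 h2].
- by rewrite !chebp0 !hornerC.
- by rewrite !chebp1 !hornerX.
- by rewrite !chebpSS !hornerE h1 h2 !rmorphB !rmorphM /= rmorphMn.
Qed.

(** The Chebyshev polynomials have distinct degrees, hence span. *)
Lemma chebp_span (K : numFieldType) n (p : {poly K}) : (size p <= n)%N ->
  exists c : nat -> K, p = \sum_(k < n) c k *: chebp K k.
Proof.
elim: n p => [|n IH] p.
  by rewrite leqn0 size_poly_eq0 => /eqP ->; exists (fun=> 0); rewrite big_ord0.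
move=> sp.
have l0 : (chebp K n)`_n != 0.
  have := lead_coef_eq0 (chebp K n); rewrite lead_coefE size_chebp /= => ->.
  by rewrite -size_poly_eq0 size_chebp.
pose a := p`_n / (chebp K n)`_n.
have [|c hc] := IH (p - a *: chebp K n).
  apply/leq_sizeP => j; rewrite leq_eqVlt => /orP[/eqP <-|nj].
    by rewrite coefB coefZ /a divfK // subrr.
  rewrite coefB coefZ !(@nth_default _ 0) ?mulr0 ?subrr ?size_chebp //.
  exact: leq_trans sp _.
exists (fun k => if k == n then a else c k).
rewrite big_ord_recr /= eqxx -[LHS](subrK (a *: chebp K n)) hc; congr (_ + _).
by apply: eq_bigr => i _; rewrite ltn_eqF.
Qed.

End ChebyshevPolynomials.

(** * Chebyshev coefficients of real functions *)

Section RealCoefficients.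
Context {R : realType}.
Local Notation leb := (@lebesgue_measure R).
Implicit Types (g : R -> R) (u : R).

Definition rcont g : Prop := {within I11, continuous g}.

Lemma rcontD f g : rcont f -> rcont g -> rcont (fun t => f t + g t).
Proof. by move=> cf cg t; apply: cvgD; [exact: cf|exact: cg]. Qed.

Lemma rcontN f : rcont f -> rcont (fun t => - f t).
Proof. by move=> cf t; apply: cvgN; exact: cf. Qed.

Lemma rcontM f g : rcont f -> rcont g -> rcont (fun t => f t * g t).
Proof. by move=> cf cg t; apply: cvgM; [exact: cf|exact: cg]. Qed.

Lemma rcont_cst (a : R) : rcont (fun=> a).
Proof. by apply: continuous_subspaceT => t; exact: cvg_cst. Qed.

Arguments rcont_cst a : clear implicits.

Lemma rcontT g : continuous g -> rcont g.
Proof. exact: continuous_subspaceT. Qed.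

Lemma rcont_horner (p : {poly R}) : rcont (fun t => p.[t]).
Proof. by apply: rcontT; exact: continuous_horner. Qed.

(** The factor that normalizes the Chebyshev polynomial of degree k. *)
Definition chebk (k : nat) : R := Num.sqrt ((if k == 0%N then 1 else 2) / pi).

Lemma chebk_gt0 k : 0 < chebk k.
Proof. by rewrite sqrtr_gt0 divr_gt0 ?pi_gt0 //; case: ifP. Qed.

Lemma sqr_chebk k : chebk k ^+ 2 = (if k == 0%N then 1 else 2) / pi.
Proof. by rewrite sqr_sqrtr // divr_ge0 ?pi_ge0 //; case: ifP. Qed.

Lemma chebE k (t : R) : I11 t -> cheb k t = (chebp R k).[t].
Proof.
by rewrite /I11 /= => tI; rewrite /cheb -chebp_horner_cos acosK.
Qed.

Lemma chebL2E k (t : R) : I11 t -> chebL2 k t = chebk k * (chebp R k).[t].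
Proof. by move=> tI; rewrite /chebL2 chebE. Qed.

(** The Chebyshev coefficient after the substitution t = cos u, under which the
    weight disappears. *)
Definition rcoef k g : R := chebk k * \int[leb]_(u in `[0, pi]) (g (cos u) * cos (k%:R * u)).

Lemma integrable_0pi (f : R -> R) : continuous f ->
  leb.-integrable `[0, pi] (EFin \o f).
Proof. by move=> cf; apply: integrable_cc; exact: continuous_subspaceT. Qed.

Lemma continuous_coskx (a : R) : continuous (fun u : R => cos (a * u)).
Proof.
move=> u; apply: continuous_comp; last exact: continuous_cos.
by apply: cvgM; [exact: cvg_cst|exact: cvg_id].
Qed.

Lemma continuous_gcos g k : rcont g ->
  continuous (fun u : R => g (cos u) * cos (k%:R * u)).
Proof.
move=> cg u; apply: cvgM; last exact: continuous_coskx.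
exact: continuous_compose_cos.
Qed.

Lemma weighted_coefE g k : rcont g ->
  \int[leb]_(t in I11) (chebL2 k t * g t * cheb_weight t) = rcoef k g.
Proof.
move=> cg.
have cg' : rcont (fun t => chebk k * (chebp R k).[t] * g t).
  by apply: rcontM => //; apply: rcontM; [exact: rcont_cst|exact: rcont_horner].
transitivity (\int[leb]_(t in I11) (chebk k * (chebp R k).[t] * g t * cheb_weight t)).
  by apply: eq_Rintegral => t; rewrite inE => tI; rewrite chebL2E.
rewrite weighted_change // /rcoef -RintegralZl //; last first.
  by apply: integrable_0pi; exact: continuous_gcos.
by apply: eq_Rintegral => u _; rewrite chebp_horner_cos; ring.
Qed.

Lemma eq_rcoef k f g : (forall t, I11 t -> f t = g t) -> rcoef k f = rcoef k g.
Proof.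
by move=> fg; congr (_ * _); apply: eq_Rintegral => u _; rewrite fg //; exact: I11_cos.
Qed.

Lemma rcoefD k f g : rcont f -> rcont g ->
  rcoef k (fun t => f t + g t) = rcoef k f + rcoef k g.
Proof.
move=> cf cg; rewrite /rcoef -mulrDr -RintegralD //;
  try by apply: integrable_0pi; exact: continuous_gcos.
by congr (_ * _); apply: eq_Rintegral => u _; rewrite mulrDl.
Qed.

Lemma rcoefZ k a g : rcont g -> rcoef k (fun t => a * g t) = a * rcoef k g.
Proof.
move=> cg; rewrite /rcoef mulrCA; congr (_ * _); rewrite -RintegralZl //;
  last by apply: integrable_0pi; exact: continuous_gcos.
by apply: eq_Rintegral => u _; rewrite mulrA.
Qed.

Lemma rcoef_sum k (n : nat) (F : nat -> R -> R) : (forall i, rcont (F i)) ->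
  rcont (fun t => \sum_(i < n) F i t) /\
  rcoef k (fun t => \sum_(i < n) F i t) = \sum_(i < n) rcoef k (F i).
Proof.
move=> cF; elim: n => [|n [IH1 IH2]].
  have E : (fun t : R => \sum_(i < 0) F i t) = (fun t => 0 * 0).
    by apply/funext => t; rewrite big_ord0 mulr0.
  rewrite big_ord0 E; split; first exact: rcont_cst.
  by rewrite (rcoefZ _ 0 (rcont_cst 0)) mul0r.
have E : (fun t : R => \sum_(i < n.+1) F i t) = (fun t => \sum_(i < n) F i t + F n t).
  by apply/funext => t; rewrite big_ord_recr.
by rewrite E big_ord_recr /= rcoefD // IH2; split => //; exact: rcontD.
Qed.

Lemma int_coskx (m : nat) :
  \int[leb]_(u in `[0, pi]) cos (m%:R * u) = if m == 0%N then pi else 0 :> R.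
Proof.
have [->|m0] := eqVneq m 0%N.
  under eq_Rintegral do rewrite mul0r cos0.
  by rewrite Rintegral_cst //= lebesgue_measure_itv /= lte_fin pi_gt0 /= subr0 mul1r.
have mn0 : m%:R != 0 :> R by rewrite pnatr_eq0.
rewrite /Rintegral (@continuous_FTC2 _ _ (fun u => m%:R^-1 * sin (m%:R * u))) ?pi_gt0 //.
- rewrite mulr0 sin0 mulr0 -EFinB subr0 /= mulr_natl.
  suff -> : sin (pi *+ m) = 0 :> R by rewrite mulr0.
  elim: m {m0 mn0} => [|m IH]; first by rewrite mulr0n sin0.
  by rewrite mulrSr sinDpi IH oppr0.
- by apply: continuous_subspaceT; exact: continuous_coskx.
- have D (x : R) : is_derive x 1 (fun u => m%:R^-1 * sin (m%:R * u)) (cos (m%:R * x)).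
    apply: is_derive_eq; rewrite /GRing.scale /=.
    by rewrite !mulr1 ?mulr0 ?add0r ?addr0; field.
  have cS : continuous (fun u : R => m%:R^-1 * sin (m%:R * u)).
    move=> x; apply: cvgM; first exact: cvg_cst.
    apply: continuous_comp; last exact: continuous_sin.
    by apply: cvgM; [exact: cvg_cst|exact: cvg_id].
  split.
  + by move=> x _; exact: ex_derive.
  + by apply: cvg_at_right_filter; exact: cS.
  + by apply: cvg_at_left_filter; exact: cS.
- move=> x _; rewrite derive1E.
  have D : is_derive x 1 (fun u => m%:R^-1 * sin (m%:R * u)) (cos (m%:R * x)).
    apply: is_derive_eq; rewrite /GRing.scale /=.
    by rewrite !mulr1 ?mulr0 ?add0r ?addr0; field.
  by rewrite derive_val.
Qed.

Lemma int_coscos (j k : nat) :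
  \int[leb]_(u in `[0, pi]) (cos (j%:R * u) * cos (k%:R * u)) =
  if j == k then chebk k ^- 2 else 0 :> R.
Proof.
wlog kj : j k / (k <= j)%N.
  move=> h; have [|/ltnW jk] := leqP k j; first exact: h.
  under eq_Rintegral do rewrite mulrC.
  by rewrite (h _ _ jk) eq_sym; case: eqP => // ->.
transitivity (\int[leb]_(u in `[0, pi]) (2^-1 * cos ((j + k)%:R * u)
    + 2^-1 * cos ((j - k)%:R * u))).
  apply: eq_Rintegral => u _.
  by rewrite natrD natrB // mulrDl mulrBl cosB cosD; field.
rewrite RintegralD //; try (apply: integrable_0pi => u; apply: cvgM;
    [exact: cvg_cst|exact: continuous_coskx]).
rewrite !RintegralZl //; try (apply: integrable_0pi; exact: continuous_coskx).
rewrite !int_coskx addn_eq0 subn_eq0 sqr_chebk.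
have p0 : pi != 0 :> R by rewrite gt_eqF // pi_gt0.
have [->|jk] := eqVneq j k.
  by rewrite leqnn andbb; case: eqP => _; [rewrite div1r invrK; field|rewrite invf_div; field].
have -> : (j <= k)%N = false.
  by apply/negbTE; rewrite -ltnNge ltn_neqAle kj andbT eq_sym.
case: eqP => [j0|_]; last by rewrite !mulr0 addr0.
by move: kj jk; rewrite j0 leqn0 => /eqP ->.
Qed.

Lemma rcoef_chebp (j k : nat) (a : R) :
  rcoef k (fun t => a * (chebp R j).[t]) = if j == k then a / chebk k else 0.
Proof.
rewrite rcoefZ; last exact: rcont_horner.
rewrite /rcoef; under eq_Rintegral do rewrite chebp_horner_cos.
rewrite int_coscos; case: eqP => _; last by rewrite !mulr0.
by congr (_ * _); rewrite expr2; field; rewrite gt_eqF // chebk_gt0.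
Qed.

End RealCoefficients.

(** * The value at an end point *)

Section CauchySchwarz.

Lemma sum_cauchy_schwarz (R : rcfType) (I : Type) (r : seq I) (P : pred I) (a b : I -> R) :
  (\sum_(i <- r | P i) a i * b i) ^+ 2 <=
  (\sum_(i <- r | P i) a i ^+ 2) * (\sum_(i <- r | P i) b i ^+ 2).
Proof.
suff [_ _] : [/\ 0 <= \sum_(i <- r | P i) a i ^+ 2, 0 <= \sum_(i <- r | P i) b i ^+ 2 &
  (\sum_(i <- r | P i) a i * b i) ^+ 2 <=
  (\sum_(i <- r | P i) a i ^+ 2) * (\sum_(i <- r | P i) b i ^+ 2)] by [].
elim/big_rec3 : _ => [|i S B A _ [A0 B0 h]]; first by rewrite expr0n mulr0.
split; [by rewrite addr_ge0 ?sqr_ge0|by rewrite addr_ge0 ?sqr_ge0|].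
set x := a i; set y := b i.
have : 2 * (x * y * S) <= A * y ^+ 2 + x ^+ 2 * B.
  have X0 : 0 <= A * y ^+ 2 by rewrite mulr_ge0 ?sqr_ge0.
  have Y0 : 0 <= x ^+ 2 * B by rewrite mulr_ge0 ?sqr_ge0.
  rewrite (le_trans (ler_norm _)) // -(@ler_pXn2r _ 2) ?nnegrE ?addr_ge0 //.
  rewrite real_normK ?num_real //.
  apply: (@le_trans _ _ (4 * (A * y ^+ 2) * (x ^+ 2 * B))).
    have -> : (2 * (x * y * S)) ^+ 2 = 4 * (x ^+ 2 * y ^+ 2) * S ^+ 2 by ring.
    have -> : 4 * (A * y ^+ 2) * (x ^+ 2 * B) = 4 * (x ^+ 2 * y ^+ 2) * (A * B) by ring.
    by rewrite ler_wpM2l // mulr_ge0 ?ler0n // mulr_ge0 ?sqr_ge0.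
  rewrite -subr_ge0.
  have -> : (A * y ^+ 2 + x ^+ 2 * B) ^+ 2 - 4 * (A * y ^+ 2) * (x ^+ 2 * B) =
    (A * y ^+ 2 - x ^+ 2 * B) ^+ 2 by ring.
  exact: sqr_ge0.
move: h; nra.
Qed.

End CauchySchwarz.

Section EndpointBound.
Context {R : realType}.
Local Notation leb := (@lebesgue_measure R).
Implicit Types (f g : R -> R) (p : {poly R}).

Let cint (f : R -> R) : R := \int[leb]_(u in `[0, pi]) f u.

Let cintD f g : continuous f -> continuous g ->
  cint (fun u => f u + g u) = cint f + cint g.
Proof. by move=> cf cg; rewrite /cint RintegralD //; exact: integrable_0pi. Qed.

Let cintZ a f : continuous f -> cint (fun u => a * f u) = a * cint f.
Proof. by move=> cf; rewrite /cint RintegralZl //; exact: integrable_0pi. Qed.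

Let le_cint f g : continuous f -> continuous g ->
  (forall u, 0 <= u <= pi -> f u <= g u) -> cint f <= cint g.
Proof.
move=> cf cg fg; by apply: le_Rintegral => //; exact: integrable_0pi.
Qed.

Let cint_cst (a : R) : cint (fun=> a) = a * pi.
Proof.
by rewrite /cint Rintegral_cst //= lebesgue_measure_itv /= lte_fin pi_gt0 /= subr0.
Qed.

Let abs_cint f : continuous f -> `|cint f| <= cint (fun u => `|f u|).
Proof. by move=> cf; apply: le_normr_Rintegral => //; exact: integrable_0pi. Qed.

Let cont_poly_cos p : continuous (fun u : R => p.[cos u]).
Proof. by move=> u; apply: (@continuous_comp _ _ _ cos (horner p));
    [exact: continuous_cos|exact: continuous_horner]. Qed.

Let contM f g : continuous f -> continuous g -> continuous (fun u => f u * g u : R).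
Proof. by move=> cf cg u; apply: cvgM; [exact: cf|exact: cg]. Qed.

Let sum_chebk n : \sum_(k < n) (@chebk R k / k.+1%:R) ^+ 2 <= 3 / pi.
Proof.
have p0 : 0 < pi :> R by exact: pi_gt0.
case: n => [|n]; first by rewrite big_ord0 divr_ge0 // ltW.
apply: (@le_trans _ _ ((3 - 2 / n.+1%:R) / pi)); last first.
  by rewrite ler_pM2r ?invr_gt0 // lerBlDr lerDl divr_ge0.
(* The correction 2 / (n + 1) telescopes and makes the induction go through. *)
elim: n => [|n IH].
  rewrite big_ord_recr big_ord0 /= add0r expr_div_n sqr_chebk /= expr1n !divr1.
  by rewrite ler_pM2r ?invr_gt0 //; lra.
rewrite big_ord_recr /=; apply: (le_trans (lerD IH (lexx _))).
rewrite expr_div_n sqr_chebk /= mulrAC -mulrDl ler_pM2r ?invr_gt0 //.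
have m0 : 0 < n.+1%:R :> R by [].
have -> : n.+2%:R = n.+1%:R + 1 :> R by rewrite -natr1.
set m := n.+1%:R : R in m0 *.
rewrite -lerBrDl -subr_ge0.
have -> : 3 - 2 / (m + 1) - (3 - 2 / m) - 2 / (m + 1) ^+ 2 = 2 / (m * (m + 1) ^+ 2).
  by field; rewrite !gt_eqF //; lra.
by rewrite divr_ge0 // mulr_ge0 ?sqr_ge0 // ltW.
Qed.

(** Testing against a nonnegative polynomial of unit mass involves only
    finitely many coefficients of the function, and those of the polynomial are
    bounded by its mass. *)
Let kernel_bound g p B : rcont g -> 0 <= B ->
  (forall n, \sum_(k < n) k.+1%:R ^+ 2 * rcoef k g ^+ 2 <= B) ->
  (forall t, I11 t -> 0 <= p.[t]) ->
  `|cint (fun u => g (cos u) * p.[cos u])| <= cint (fun u => p.[cos u]) * Num.sqrt (3 / pi * B).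
Proof.
move=> cg B0 hB p0.
have [c pE] := chebp_span (leqnn (size p)).
set n := size p in pE.
have pcos u : p.[cos u] = \sum_(k < n) c k * cos (k%:R * u).
  by rewrite {1}pE horner_sum; apply: eq_bigr => k _; rewrite hornerZ chebp_horner_cos.
set P := cint (fun u => p.[cos u]).
have P0 : 0 <= P.
  by rewrite /P; apply: Rintegral_ge0 => u _; apply: p0; exact: I11_cos.
have cE k : (k < n)%N -> c k = chebk k * rcoef k (fun t => p.[t]).
  move=> kn.
  have -> : rcoef k (fun t => p.[t]) = \sum_(i < n) rcoef k (fun t => c i * (chebp R i).[t]).
    have F i : rcont (fun t => c i * (chebp R i).[t]).
      by apply: rcontM; [exact: rcont_cst|exact: rcont_horner].
    have [_ <-] := rcoef_sum k n F.
    by congr rcoef; apply/funext => t; rewrite {1}pE horner_sum; apply: eq_bigr => i _;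
        rewrite hornerZ.
  rewrite (bigD1 (Ordinal kn)) //= big1 => [|i ik].
    by rewrite rcoef_chebp eqxx addr0 mulrC divfK // gt_eqF // chebk_gt0.
  rewrite rcoef_chebp ifN //.
have cB k : (k < n)%N -> `|c k| <= chebk k ^+ 2 * P.
  move=> kn; rewrite cE // normrM /rcoef normrM mulrA -expr2.
  rewrite real_normK ?num_real // ler_wpM2l ?sqr_ge0 //.
  have cc : continuous (fun u : R => p.[cos u] * cos (k%:R * u)).
    by apply: contM => //; exact: continuous_coskx.
  apply: (le_trans (abs_cint cc)); apply: le_cint => //.
    by move=> u; apply: cvg_norm; exact: cc.
  move=> u _; rewrite normrM ger0_norm; last by apply: p0; exact: I11_cos.
  by rewrite ler_piMr ?cos_max // p0 //; exact: I11_cos.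
have -> : cint (fun u => g (cos u) * p.[cos u]) = \sum_(k < n) c k / chebk k * rcoef k g.
  have cF k : continuous (fun u : R => c k * (g (cos u) * cos (k%:R * u))).
    by apply: contM => [u|]; [exact: cvg_cst|exact: continuous_gcos].
  have -> : (fun u => g (cos u) * p.[cos u]) = (fun u =>
      \sum_(k < n) c k * (g (cos u) * cos (k%:R * u))).
    by apply/funext => u; rewrite pcos mulr_sumr; apply: eq_bigr => k _; ring.
  have S m : continuous (fun u : R => \sum_(k < m) c k * (g (cos u) * cos (k%:R * u))) /\
    cint (fun u : R => \sum_(k < m) c k * (g (cos u) * cos (k%:R * u))) =
        \sum_(k < m) c k / chebk k * rcoef k g.
    elim: m => [|m [IH1 IH2]].
      under eq_fun do rewrite big_ord0.
      by rewrite big_ord0 cint_cst mul0r; split => // u; exact: cvg_cst.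
    under eq_fun do rewrite big_ord_recr /=.
    split; first by move=> u; apply: cvgD; [exact: IH1|exact: cF].
    rewrite cintD // IH2 big_ord_recr /=; congr (_ + _).
    rewrite cintZ; last exact: continuous_gcos.
    by rewrite /rcoef mulrA divfK // gt_eqF // chebk_gt0.
  by have [_] := S n.
apply: (@le_trans _ _ (P * \sum_(k < n) (chebk k / k.+1%:R) * (k.+1%:R * `|rcoef k g|))).
  rewrite (le_trans (ler_norm_sum _ _ _)) // mulr_sumr ler_sum // => k _.
  have k0 : k.+1%:R != 0 :> R by rewrite pnatr_eq0.
  have -> : chebk k / k.+1%:R * (k.+1%:R * `|rcoef k g|) = chebk k * `|rcoef k g|.
    by rewrite mulrA divfK.
  rewrite normrM mulrA ler_wpM2r // normrM normfV.
  rewrite [X in _ / X]ger0_norm ?(ltW (chebk_gt0 _)) // ler_pdivrMr ?chebk_gt0 //.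
  by rewrite -mulrA -expr2 mulrC cB.
rewrite ler_wpM2l // -[leLHS]ger0_norm; last first.
  by rewrite sumr_ge0 // => k _; rewrite !mulr_ge0 // ?invr_ge0 // ltW ?chebk_gt0.
rewrite -sqrtr_sqr ler_wsqrtr // (le_trans (sum_cauchy_schwarz _ _ _ _)) //.
rewrite ler_pM ?sum_chebk ?sumr_ge0 //; try by move=> k _; rewrite sqr_ge0.
apply: le_trans (hB n); rewrite ler_sum // => k _.
by rewrite exprMn real_normK ?num_real.
Qed.

Let conc (t : R) : R := (1 - cos t) / 2.

(** The powers of (1 - t) / 2 concentrate at -1: their mass is at least that of
    a neighbourhood of pi in the variable u, where they are exponentially larger
    than at a fixed distance from pi. *)
Let kernel_concentrates g (e : R) : rcont g -> 0 < e ->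
  exists p, [/\ forall t, I11 t -> 0 <= p.[t], 0 < cint (fun u => p.[cos u]) &
   cint (fun u => `|g (-1) - g (cos u)| * p.[cos u]) <= e * cint (fun u => p.[cos u])].
Proof.
move=> cg e0.
have cG := continuous_compose_cos cg.
have [M M0 hM] := within_bounded cg.
have e2 : 0 < e / 2 by rewrite divr_gt0.
have p2 : 2 <= pi :> R by exact: pi_ge2.
have [d0 d00 hd0] : exists2 d0 : R, 0 < d0 & forall u,
    `|pi - u| < d0 -> `|g (-1) - g (cos u)| < e / 2.
  have /cvgrPdist_lt /(_ _ e2) := cG pi.
  rewrite /= cospi => -[d0 d00 H]; by exists d0.
pose d := Num.min d0 1.
have d0' : 0 < d by rewrite lt_min d00 ltr01.
have d1 : d <= 1 by rewrite ge_min lexx orbT.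
have dd0 : d <= d0 by rewrite ge_min lexx.
pose a : R := pi - d / 2; pose b : R := pi - d / 4.
have conc_lt u v : 0 <= u -> u < v -> v <= pi -> conc u < conc v.
  move=> u0 uv vp; rewrite /conc.
  have : cos v < cos u by rewrite ltr_cos // in_itv /=; lra.
  lra.
have conc_ge0 u : 0 <= conc u by have := cos_le1 u; rewrite /conc; lra.
have ab : conc a < conc b by apply: conc_lt; rewrite /a /b; lra.
have a0 : 0 <= conc a by [].
have b0 : 0 < conc b by exact: le_lt_trans ab.
have ra1 : `|conc a / conc b| < 1.
  by rewrite ger0_norm ?divr_ge0 // ?ltW // ltr_pdivrMr // mul1r.
(* The ratio of the kernel at a to the kernel at b tends to 0. *)
have [n hn] : exists n, 2 * M * pi * (conc a / conc b) ^+ n <= e / 2 * (d / 4).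
  have q0 : 0 < e / 2 * (d / 4) by rewrite mulr_gt0 // divr_gt0.
  have : 2 * M * pi * (conc a / conc b) ^+ n @[n --> \oo] --> 2 * M * pi * 0.
    by apply: cvgM; [exact: cvg_cst|exact: cvg_expr].
  rewrite mulr0 => /cvgrPdist_lt /(_ _ q0) [n _ /(_ n (leqnn _))] /=.
  rewrite sub0r normrN => h; exists n.
  by rewrite ltW // (le_lt_trans _ h) // ler_norm.
pose p : {poly R} := (2^-1%:P * (1 - 'X)) ^+ n.
have pE u : p.[cos u] = conc u ^+ n.
  by rewrite /p horner_exp !hornerE /conc mulrC.
have cp := @cont_poly_cos p.
have p_ge0 t : I11 t -> 0 <= p.[t].
  by rewrite /I11 /= => tI; rewrite -(acosK tI) pE exprn_ge0.
have Pb : d / 4 * conc b ^+ n <= cint (fun u => p.[cos u]).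
  rewrite /cint -[leRHS](subrK (\int[leb]_(u in `[0, b]) p.[cos u])).
  rewrite (@Rintegral_itvB _ _ (BLeft 0) (BRight pi)); last 3 first.
  - exact: integrable_0pi.
  - by rewrite bnd_simp /b; lra.
  - by rewrite bnd_simp /b; lra.
  rewrite ler_wpDr ?Rintegral_ge0 => // [u _|]; first by rewrite pE exprn_ge0.
  have -> : d / 4 * conc b ^+ n = \int[leb]_(u in `]b, pi]) (conc b ^+ n).
    rewrite Rintegral_cst //= lebesgue_measure_itv /= lte_fin ifT /=; last by rewrite /b; lra.
    by rewrite mulrC; congr (_ * _); rewrite /b; ring.
  have io (f : R -> R) : continuous f -> leb.-integrable `]b, pi] (EFin \o f).
    move=> cf; have If : leb.-integrable `[b, pi] (EFin \o f).
      by apply: integrable_cc; exact: continuous_subspaceT.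
    by apply: integrableS If => //; exact: subset_itv_oc_cc.
  apply: le_Rintegral => //.
  + by apply: io => u; exact: cvg_cst.
  + exact: io.
  + move=> u; rewrite /= in_itv /= => /andP[bu up].
    by rewrite pE lerXn2r ?nnegrE // ltW // conc_lt // /b; lra.
have P0 : 0 < cint (fun u => p.[cos u]).
  by apply: lt_le_trans Pb; rewrite mulr_gt0 ?exprn_gt0 // divr_gt0.
exists p; split => //.
have cd : continuous (fun u : R => `|g (-1) - g (cos u)|).
  by move=> u; apply: cvg_norm; apply: cvgB; [exact: cvg_cst|exact: cG].
have cl : continuous (fun u : R => e / 2 * p.[cos u]).
  by apply: contM => // u; exact: cvg_cst.
apply: (@le_trans _ _ (cint (fun u => e / 2 * p.[cos u] + 2 * M * conc a ^+ n))).
  apply: le_cint.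
  - exact: contM.
  - by move=> u; apply: cvgD; [exact: cl|exact: cvg_cst].
  move=> u /andP[u0 up].
  have p0u : 0 <= p.[cos u] by apply: p_ge0; exact: I11_cos.
  have [ua|au] := leP u a.
    have pa : p.[cos u] <= conc a ^+ n.
      rewrite pE lerXn2r ?nnegrE //.
      move: ua; rewrite le_eqVlt => /orP[/eqP -> //|ua].
      by rewrite ltW // conc_lt // /a; lra.
    have m2 : `|g (-1) - g (cos u)| <= 2 * M.
      by rewrite (le_trans (ler_normB _ _)) // mulr_natl mulr2n lerD // hM //;
          [exact: I11_N1|exact: I11_cos].
    apply: ler_wpDl; first by rewrite mulr_ge0 // ltW.
    exact: ler_pM.
  apply: ler_wpDr; first by rewrite !mulr_ge0 // exprn_ge0.
  rewrite ler_wpM2r // ltW // hd0 // ger0_norm; move: au; rewrite /a; lra.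
rewrite cintD //; last by move=> u; exact: cvg_cst.
rewrite cintZ // cint_cst.
have -> : e * cint (fun u => p.[cos u]) =
  e / 2 * cint (fun u => p.[cos u]) + e / 2 * cint (fun u => p.[cos u]) by field.
rewrite lerD2l (le_trans _ (ler_wpM2l (ltW e2) Pb)) //.
move: hn; rewrite expr_div_n => hn.
have bn : 0 < conc b ^+ n by rewrite exprn_gt0.
have := ler_wpM2r (ltW bn) hn.
rewrite -!mulrA mulVf ?gt_eqF // mulr1 mulrA.
by move=> h; apply: le_trans h; rewrite le_eqVlt; apply/orP; left; apply/eqP; ring.
Qed.

(** The value at -1 is a limit of averages against polynomial kernels.  Each
    average involves finitely many coefficients, and Cauchy-Schwarz bounds it
    because the inverses of the weights k + 1 are square summable. *)
Lemma endpoint_bound g B : rcont g ->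
  (forall n, \sum_(k < n) k.+1%:R ^+ 2 * rcoef k g ^+ 2 <= B) ->
  g (-1) ^+ 2 <= 3 / pi * B.
Proof.
move=> cg hB.
have B0 : 0 <= B by apply: le_trans (hB 0%N); rewrite big_ord0.
have K0 : 0 <= 3 / pi * B by rewrite mulr_ge0 // divr_ge0 // pi_ge0.
rewrite -(real_normK (num_real _)) -[leRHS]sqr_sqrtr //.
rewrite lerXn2r ?nnegrE ?sqrtr_ge0 //.
apply/ler_addgt0Pr => e e0.
have [p [p0 P0 hp]] := kernel_concentrates cg e0.
have cp := @cont_poly_cos p.
have cgp : continuous (fun u : R => g (cos u) * p.[cos u]).
  by apply: contM => //; exact: continuous_compose_cos.
have cdp : continuous (fun u : R => (g (-1) - g (cos u)) * p.[cos u]).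
  apply: contM => // u; apply: cvgB; [exact: cvg_cst|exact: continuous_compose_cos].
rewrite -(ler_pM2r P0) mulrDl -[X in `|_| * X]ger0_norm ?(ltW P0) // -normrM.
rewrite -cintZ //.
have -> : (fun u => g (-1) * p.[cos u]) =
    (fun u => g (cos u) * p.[cos u] + (g (-1) - g (cos u)) * p.[cos u]).
  by apply/funext => u; ring.
rewrite cintD // (le_trans (ler_normD _ _)) // lerD //.
  by rewrite [leRHS]mulrC; exact: kernel_bound.
apply: le_trans hp; apply: (le_trans (abs_cint cdp)); apply: le_cint.
- by move=> u; apply: cvg_norm; exact: cdp.
- apply: contM => // u; apply: cvg_norm.
  by apply: cvgB; [exact: cvg_cst|exact: continuous_compose_cos].
- move=> u _; rewrite normrM [X in _ * X]ger0_norm //.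
  by apply: p0; exact: I11_cos.
Qed.

End EndpointBound.

(** * First-order expansions of analytic functions *)

Section LocalExpansion.
Context {R : realType}.
Local Notation C := R[i].
Implicit Types (z w c : C).

(** Complex differentiability in a quantitative form: the remainder is quadratic
    with a constant that is uniform near z0, so that compactness provides uniform
    bounds on second differences. *)
Definition holo_at (f : C -> C) (z0 : C) : Prop :=
  exists2 r : R, 0 < r & exists M : R, forall z, normc (z - z0) < r ->
    normc (f z) <= M /\
    exists2 c, normc c <= M & forall w, normc (w - z0) < r ->
      normc (f w - f z - c * (w - z)) <= M * normc (w - z) ^+ 2.

Lemma holo_at_mull (f : C -> C) z0 c : holo_at f z0 -> holo_at (fun z => c * f z) z0.
Proof.
move=> [r r0 [M hM]]; exists r => //; exists (normc c * M) => z /hM [hz [e he hw]].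
split; first by rewrite normcM ler_wpM2l ?normc_ge0.
exists (c * e) => [|w /hw h]; first by rewrite normcM ler_wpM2l ?normc_ge0.
rewrite -mulrA -!mulrBr normcM -mulrA ler_wpM2l ?normc_ge0 //.
Qed.

Lemma holo_at_cvg (f : C -> C) z0 : holo_at f z0 ->
  forall e : R, 0 < e -> exists2 d : R, 0 < d &
    forall z, normc (z - z0) < d -> normc (f z - f z0) < e.
Proof.
move=> [r r0 [M hM]] e e0.
have [h0 [c hc hw]] := hM z0 ltac:(by rewrite subrr normc0).
have M0 : 0 <= M by apply: le_trans h0; exact: normc_ge0.
pose d := Num.min r (Num.min 1 (e / (2 * M + 1))).
have q0 : 0 < e / (2 * M + 1) by rewrite divr_gt0 // ltr_wpDl // mulr_ge0.
exists d => [|z]; first by rewrite !lt_min r0 ltr01 q0.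
rewrite !lt_min => /and3P[zr z1 zq].
have -> : f z - f z0 = (f z - f z0 - c * (z - z0)) + c * (z - z0) by rewrite subrK.
apply: (le_lt_trans (le_normcD _ _)).
apply: (@le_lt_trans _ _ (M * normc (z - z0) + M * normc (z - z0))).
  apply: lerD; last by rewrite normcM ler_wpM2r ?normc_ge0.
  apply: (le_trans (hw z zr)); rewrite ler_wpM2l // expr2 ler_piMl ?normc_ge0 //.
  exact: ltW.
rewrite -mulrDl -mulr2n -mulr_natl.
apply: (@le_lt_trans _ _ ((2 * M + 1) * normc (z - z0))).
  by rewrite ler_wpM2r ?normc_ge0 // lerDl.
by rewrite mulrC -ltr_pdivlMr // ltr_wpDl // mulr_ge0.
Qed.

(** The factor rho ^+ 2 on the left stands for a division; it keeps the power of
    rho equal to k, as needed to sum over the terms of a power series. *)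
Lemma monomial_remainder (rho : R) z w k : 0 <= rho -> normc z <= rho -> normc w <= rho ->
  rho ^+ 2 * normc (w ^+ k - z ^+ k - z ^+ k.-1 *+ k * (w - z)) <=
  k%:R ^+ 2 * rho ^+ k * normc (w - z) ^+ 2.
Proof.
move=> r0 zr wr; elim: k => [|k IH].
  by rewrite subrr mulr0n mul0r subr0 normc0 mulr0 expr0n !mul0r.
have -> : w ^+ k.+1 - z ^+ k.+1 - z ^+ k *+ k.+1 * (w - z) =
  w * (w ^+ k - z ^+ k - z ^+ k.-1 *+ k * (w - z)) + z ^+ k.-1 *+ k * (w - z) ^+ 2.
  case: k {IH} => [|k] /=; first by rewrite !mulr0n !expr0 mulr1n; ring.
  rewrite -(mulr_natl _ k.+2) -(mulr_natl _ k.+1) -[k.+2%:R]natr1 !exprS expr0 !mulr1.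
  move: (z ^+ k) (w ^+ k) (k.+1%:R) => Z W m; ring.
apply: (@le_trans _ _ (rho * (k%:R ^+ 2 * rho ^+ k * normc (w - z) ^+ 2) +
   k%:R * rho ^+ k.+1 * normc (w - z) ^+ 2)).
  apply: (le_trans (ler_wpM2l (sqr_ge0 _) (le_normcD _ _))); rewrite mulrDr.
  apply: lerD.
    rewrite normcM mulrCA; apply: ler_pM => //; rewrite ?normc_ge0 //.
    by rewrite mulr_ge0 ?sqr_ge0 ?normc_ge0.
  rewrite normcM normc_exp mulrA ler_wpM2r ?sqr_ge0 //.
  rewrite normcMn normc_exp; case: k {IH} => [|k /=]; first by rewrite mulr0n mulr0 !mul0r.
  rewrite -(mulr_natl (normc z ^+ k) k.+1) mulrCA ler_wpM2l // -[k.+2]/(2 + k)%N exprD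
    ler_wpM2l ?sqr_ge0 //.
  by rewrite lerXn2r ?nnegrE ?normc_ge0.
rewrite [rho ^+ k.+1]exprS -[k.+1%:R]natr1.
set x := k%:R; set y := normc _ ^+ 2; set p := rho ^+ k.
have -> : rho * (x ^+ 2 * p * y) + x * (rho * p) * y = (x ^+ 2 + x) * (rho * p * y) by ring.
rewrite -[leRHS]mulrA ler_wpM2r //; first by rewrite !mulr_ge0 ?exprn_ge0 ?sqr_ge0 ?normc_ge0.
by rewrite sqrrD1 ler_wpDr // lerD2l mulr2n lerDl /x.
Qed.

Let cvg_seq (u : nat -> C) (l : C) :=
  forall e : R, 0 < e -> exists n0, forall n, (n0 <= n)%N -> normc (u n - l) < e.

Lemma complex_series_cvg (u : nat -> C) (K : R) :
  (forall k, normc (u k) <= K * 2^-1 ^+ k) ->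
  exists l, cvg_seq (fun n => \sum_(k < n) u k) l.
Proof.
move=> hu.
have K0 : 0 <= K by have := hu 0%N; rewrite expr0 mulr1; apply: le_trans; exact: normc_ge0.
have gc : cvgn (series (fun k => K * 2^-1 ^+ k : R)).
  by apply: is_cvg_geometric_series; rewrite ger0_norm ?invf_lt1 ?invr_ge0 // ltr1n.
have comp (v : nat -> R) : (forall k, `|v k| <= normc (u k)) -> cvgn (series v).
  move=> hv; apply: normed_cvg; apply: series_le_cvg gc => k /=.
  - exact: normr_ge0.
  - by rewrite mulr_ge0 // exprn_ge0 // invr_ge0.
  - exact: le_trans (hv k) (hu k).
have /cvg_ex[/= a ha] := comp _ (fun k => abs_Re_le (u k)).
have /cvg_ex[/= b hb] := comp _ (fun k => abs_Im_le (u k)).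
exists (a +i* b) => e e0.
have ReS n : complex.Re (\sum_(k < n) u k) = series (fun k => complex.Re (u k)) n.
  rewrite seriesEord /=; elim: n => [|n IH]; first by rewrite !big_ord0.
  by rewrite !big_ord_recr cReD IH.
have ImS n : complex.Im (\sum_(k < n) u k) = series (fun k => complex.Im (u k)) n.
  rewrite seriesEord /=; elim: n => [|n IH]; first by rewrite !big_ord0.
  by rewrite !big_ord_recr cImD IH.
have : (\sum_(k < n) u k) @[n --> \oo] --> (a +i* b : C^o).
  apply: cvgC_ReIm => /=.
    by under eq_fun do rewrite ReS.
  by under eq_fun do rewrite ImS.
move=> /cvgCP /(_ e e0) [n0 _ hn0]; exists n0 => n n0n; exact: hn0.
Qed.

Lemma pow8_bound k : k%:R ^+ 2 * 8^-1 ^+ k <= 2^-1 ^+ k :> R.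
Proof.
have -> : 8^-1 = 4^-1 * 2^-1 :> R by rewrite -invfM; congr (_^-1); rewrite -natrM.
rewrite exprMn mulrA ler_piMl ?exprn_ge0 ?invr_ge0 //.
rewrite exprVn ler_pdivrMr ?exprn_gt0 // mul1r -!natrX ler_nat.
have h : (k <= 2 ^ k)%N by exact/ltnW/ltn_expl.
by rewrite (_ : 4 = 2 ^ 2)%N // -expnM mulnC expnM leq_sqr.
Qed.

Lemma geo_sum_le n : \sum_(k < n) 2^-1 ^+ k <= 2 :> R.
Proof.
suff : \sum_(k < n) 2^-1 ^+ k = 2 - 2 * 2^-1 ^+ n :> R.
  by move=> ->; rewrite gerBl mulr_ge0 // exprn_ge0 // invr_ge0.
elim: n => [|n IH]; first by rewrite big_ord0 expr0 mulr1 subrr.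
by rewrite big_ord_recr /= IH exprS; field.
Qed.

(** The expansion is summed term by term.  On a disc of radius r / 16 the
    coefficients gain a factor 8 ^ (- k), which absorbs the growth k ^ 2 of the
    remainders of the monomials. *)
Lemma analytic_holo (f : C -> C) z0 : analytic_at f z0 -> holo_at f z0.
Proof.
move=> [a [r r0 hf]].
have hf' z : normc (z - z0) < r -> cvg_seq (fun n => \sum_(k < n) a k * (z - z0) ^+ k) (f z).
  move=> /hf /cvgCP h e /h [n0 _ hn0]; exists n0 => n /hn0 /=.
  by rewrite big_mkord.
pose r1 := r / 2; have r10 : 0 < r1 by rewrite divr_gt0.
have [A A0 hA] : exists2 A : R, 0 <= A & forall k, normc (a k) * r1 ^+ k <= A.
  have [|n0 hn0] := hf' (z0 + r1%:C) _ 1 ltr01.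
    by rewrite addrC addKr normcR ger0_norm ?ltW // /r1; lra.
  rewrite addrC addKr in hn0.
  have T k : normc (a k * r1%:C ^+ k) = normc (a k) * r1 ^+ k.
    by rewrite normcM normc_exp normcR ger0_norm ?ltW.
  have S0 : 0 <= \sum_(k < n0) normc (a k) * r1 ^+ k.
    by rewrite sumr_ge0 // => k _; rewrite mulr_ge0 ?normc_ge0 ?exprn_ge0 ?ltW.
  exists (2 + \sum_(k < n0) normc (a k) * r1 ^+ k) => [|k]; first by rewrite addr_ge0.
  have [kn|nk] := ltnP k n0.
    rewrite (bigD1 (Ordinal kn)) //= addrCA lerDl addr_ge0 //.
    by rewrite sumr_ge0 // => i _; rewrite mulr_ge0 ?normc_ge0 ?exprn_ge0 ?ltW.
  rewrite -T; apply: ler_wpDr => //.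
  have h1 := hn0 k.+1 (leqW nk); have h2 := hn0 k nk.
  move: h1; rewrite big_ord_recr /=; set s := \sum_(i < k) _ in h2 *; set t := a k * _ => h1.
  have -> : t = (s + t - f (z0 + r1%:C)) - (s - f (z0 + r1%:C)) by ring.
  rewrite (le_trans (ler_normcB _ _)) //; move: h1 h2; rewrite [z0 + _]addrC; lra.
pose rho := r1 / 8; have rho0 : 0 < rho by rewrite divr_gt0.
have rhor : rho < r by rewrite /rho /r1; lra.
have r18 : r1 = 8 * rho by rewrite /rho; field.
have hA' k : normc (a k) * rho ^+ k <= A * 8^-1 ^+ k.
  have := hA k; rewrite r18 exprMn exprVn ler_pdivlMr ?exprn_gt0 //.
  by move=> h; apply: le_trans h; rewrite -mulrA [rho ^+ k * _]mulrC.
pose M1 := 2 * A / rho; pose M2 := 2 * A / rho ^+ 2.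
have M10 : 0 <= M1 by rewrite divr_ge0 ?mulr_ge0 // ltW.
have M20 : 0 <= M2 by apply: divr_ge0; [exact: mulr_ge0|exact: sqr_ge0].
have k8 k : A * 8^-1 ^+ k <= A * 2^-1 ^+ k.
  by rewrite ler_wpM2l // lerXn2r ?nnegrE ?invr_ge0 // lef_pV2 ?posrE // ler_nat.
have seq_le (u : nat -> C) l (B : R) : cvg_seq u l -> (forall n, normc (u n) <= B) -> normc l <= B.
  move=> ul uB; apply/ler_addgt0Pr => e /ul [n0 /(_ _ (leqnn _)) h].
  have -> : l = u n0 - (u n0 - l) by rewrite opprB addrC subrK.
  by rewrite (le_trans (ler_normcB _ _)) // lerD // ltW.
exists rho => //; exists (2 * A + M1 + M2) => z zr.
have zr' := lt_trans zr rhor.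
split.
  rewrite -addrA ler_wpDr ?addr_ge0 //.
  apply: (seq_le _ _ _ (hf' z zr')) => n.
  rewrite (le_trans (normc_sum _ _ _)) //.
  rewrite mulrC; apply: le_trans (ler_wpM2l A0 (geo_sum_le n)).
  rewrite mulr_sumr ler_sum // => k _; apply: le_trans (k8 k); apply: le_trans (hA' k).
  rewrite normcM normc_exp ler_wpM2l ?normc_ge0 // lerXn2r ?nnegrE ?normc_ge0 ?ltW //.
pose dc k := a k * ((z - z0) ^+ k.-1 *+ k).
have dcB k : normc (dc k) <= A / rho * 2^-1 ^+ k.
  rewrite mulrAC ler_pdivlMr //.
  apply: (@le_trans _ _ (k%:R * (normc (a k) * rho ^+ k))).
    rewrite /dc normcM normcMn normc_exp; case: k => [|k /=].
      by rewrite mulr0n mulr0 !mul0r.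
    rewrite -(mulr_natl (_ ^+ k) k.+1).
    have -> : normc (a k.+1) * (k.+1%:R * normc (z - z0) ^+ k) * rho =
        k.+1%:R * (normc (a k.+1) * (rho * normc (z - z0) ^+ k)).
      move: (normc _) (_ ^+ k) (k.+1%:R) => x y m; ring.
    rewrite ler_wpM2l // ler_wpM2l ?normc_ge0 // exprS (ler_wpM2l (ltW rho0)) //.
    by rewrite lerXn2r ?nnegrE ?normc_ge0 // ltW.
  apply: (le_trans (ler_wpM2l (ler0n _ k) (hA' k))).
  rewrite mulrCA ler_wpM2l //; apply: le_trans (pow8_bound k).
  rewrite ler_wpM2r ?exprn_ge0 ?invr_ge0 // -natrX ler_nat.
  by case: (k) => // k'; rewrite -mulnn leq_pmulr.
have [c hc] := complex_series_cvg dcB.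
exists c.
  apply: (@le_trans _ _ M1); last by have := mulr_ge0 (ler0n R 2) A0; lra.
  apply: (seq_le _ _ _ hc) => n; rewrite (le_trans (normc_sum _ _ _)) //.
  have -> : M1 = A / rho * 2 by rewrite /M1; ring.
  have q0 : 0 <= A / rho by rewrite divr_ge0 // ltW.
  apply: le_trans (ler_wpM2l q0 (geo_sum_le n)).
  by rewrite mulr_sumr ler_sum.
move=> w wr; have wr' := lt_trans wr rhor.
apply: (@le_trans _ _ (M2 * normc (w - z) ^+ 2)); last first.
  by rewrite ler_wpM2r ?sqr_ge0 //; have := mulr_ge0 (ler0n R 2) A0; lra.
apply: (seq_le (fun n => \sum_(k < n) a k * (w - z0) ^+ k - \sum_(k < n) a k * (z - z0) ^+ k
    - (\sum_(k < n) dc k) * (w - z))).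
  move=> e e0; pose q := e / (2 + normc (w - z)).
  have d0 : 0 < 2 + normc (w - z) by rewrite ltr_pwDl // normc_ge0.
  have q0 : 0 < q by rewrite divr_gt0.
  have [n1 h1] := hf' w wr' q q0; have [n2 h2] := hf' z zr' q q0; have [n3 h3] := hc q q0.
  exists (maxn n1 (maxn n2 n3)) => n; rewrite !geq_max => /and3P[/h1 k1 /h2 k2 /h3 k3].
  move: k1 k2 k3; set x := \sum_(k < n) _; set y := \sum_(k < n) _; set t := \sum_(k < n) _.
  move=> k1 k2 k3.
  have -> : x - y - t * (w - z) - (f w - f z - c * (w - z)) =
     (x - f w) - (y - f z) - (t - c) * (w - z) by ring.
  have qE : e = q + q + q * normc (w - z).
    by rewrite /q; field; rewrite gt_eqF.
  rewrite qE (le_lt_trans (ler_normcB _ _)) // ltr_leD //.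
    by rewrite (le_lt_trans (ler_normcB _ _)) // ltrD.
  by rewrite normcM ler_wpM2r ?normc_ge0 // ltW.
move=> n.
have -> : \sum_(k < n) a k * (w - z0) ^+ k - \sum_(k < n) a k * (z - z0) ^+ k
    - (\sum_(k < n) dc k) * (w - z) =
  \sum_(k < n) a k * ((w - z0) ^+ k - (z - z0) ^+ k - (z - z0) ^+ k.-1 *+ k * (w - z)).
  rewrite mulr_suml -!sumrB; apply: eq_bigr => k _; rewrite /dc; ring.
rewrite (le_trans (normc_sum _ _ _)) //.
have e2 : 0 < rho ^+ 2 by rewrite exprn_gt0.
rewrite /M2 mulrAC ler_pdivlMr // mulr_suml [2 * A]mulrC -mulrA.
apply: (@le_trans _ _ (A * ((\sum_(k < n) 2^-1 ^+ k) * normc (w - z) ^+ 2))); last first.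
  by rewrite ler_wpM2l // ler_wpM2r ?sqr_ge0 // geo_sum_le.
rewrite mulr_suml mulr_sumr ler_sum // => k _.
have wz : w - z = (w - z0) - (z - z0) by ring.
have := @monomial_remainder rho (z - z0) (w - z0) k (ltW rho0) (ltW zr) (ltW wr).
rewrite -wz => mr.
rewrite normcM -mulrA [normc (_ - _ - _) * _]mulrC.
apply: (le_trans (ler_wpM2l (normc_ge0 _) mr)).
have -> (x y u v : R) : x * (y * u * v) = y * (x * u) * v by ring.
rewrite [leRHS]mulrA ler_wpM2r ?sqr_ge0 //.
apply: (le_trans (ler_wpM2l (sqr_ge0 _) (hA' k))).
by rewrite mulrCA ler_wpM2l // pow8_bound.
Qed.

End LocalExpansion.

(** * Holomorphic functions and the hyperbolic cosine *)

Section HoloClosure.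
Context {R : realType}.
Local Notation C := R[i].
Implicit Types (z w c : C) (f g : C -> C).

(** Shrinking the radius also gives a Lipschitz bound, on which the rules for
    products and compositions rest. *)
Lemma holo_atP f z0 : holo_at f z0 -> exists r M : R, [/\ 0 < r, r <= 2^-1, 0 <= M &
  forall z, normc (z - z0) < r -> normc (f z) <= M /\
    exists2 c, normc c <= M & forall w, normc (w - z0) < r ->
      [/\ normc (f w - f z - c * (w - z)) <= M * normc (w - z) ^+ 2,
          normc (f w - f z) <= 2 * M * normc (w - z) & normc (w - z) <= 1]].
Proof.
move=> [r r0 [M hM]].
have M0 : 0 <= M.
  have [h _] := hM z0 ltac:(by rewrite subrr normc0).
  by apply: le_trans h; exact: normc_ge0.
exists (Num.min r 2^-1), M; split => //; first by rewrite lt_min r0 invr_gt0 ltr0n.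
  by rewrite ge_min lexx orbT.
move=> z; rewrite lt_min => /andP[zr z2]; have [hz [c hc hw]] := hM z zr.
split=> //; exists c => // w; rewrite lt_min => /andP[wr w2].
have wz : normc (w - z) <= 1.
  have -> : w - z = (w - z0) - (z - z0) by ring.
  by rewrite (le_trans (ler_normcB _ _)) //; lra.
split => //; first exact: hw.
have -> : f w - f z = (f w - f z - c * (w - z)) + c * (w - z) by ring.
rewrite (le_trans (le_normcD _ _)) // mulr_natl mulr2n mulrDl lerD //.
  by rewrite (le_trans (hw w wr)) // ler_wpM2l // expr2 ler_piMl ?normc_ge0.
by rewrite normcM ler_wpM2r ?normc_ge0.
Qed.

Lemma holo_at_lin c z0 : holo_at (fun z => c * z) z0.
Proof.
exists 1 => //; exists (normc c * (normc z0 + 1)) => z z1; split.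
  have -> : z = (z - z0) + z0 by rewrite subrK.
  rewrite normcM ler_wpM2l ?normc_ge0 // (le_trans (le_normcD _ _)) //.
  by rewrite addrC lerD2l ltW.
exists c => [|w _]; first by rewrite ler_peMr ?normc_ge0 // lerDr normc_ge0.
rewrite -mulrBr subrr normc0 !mulr_ge0 ?sqr_ge0 ?normc_ge0 //.
by rewrite addr_ge0 ?normc_ge0.
Qed.

Lemma holo_at_add f g z0 : holo_at f z0 -> holo_at g z0 -> holo_at (fun z => f z + g z) z0.
Proof.
move=> [r r0 [M hM]] [r' r0' [M' hM']].
exists (Num.min r r'); first by rewrite lt_min r0.
exists (M + M') => z; rewrite lt_min => /andP[/hM [z1 [c hc hw]] /hM' [z1' [c' hc' hw']]].
split; first by rewrite (le_trans (le_normcD _ _)) // lerD.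
exists (c + c'); first by rewrite (le_trans (le_normcD _ _)) // lerD.
move=> w; rewrite lt_min => /andP[/hw h /hw' h'].
have -> : f w + g w - (f z + g z) - (c + c') * (w - z) =
  (f w - f z - c * (w - z)) + (g w - g z - c' * (w - z)) by ring.
by rewrite (le_trans (le_normcD _ _)) // mulrDl lerD.
Qed.

Lemma holo_at_mul f g z0 : holo_at f z0 -> holo_at g z0 -> holo_at (fun z => f z * g z) z0.
Proof.
move=> /holo_atP [r [M [r0 _ M0 hM]]] /holo_atP [r' [M' [r0' _ M0' hM']]].
exists (Num.min r r'); first by rewrite lt_min r0.
exists (4 * (M * M')) => z; rewrite lt_min => /andP[/hM [z1 [c hc hw]] /hM' [z1' [c' hc' hw']]].
have MM : 0 <= M * M' by rewrite mulr_ge0.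
split.
  by rewrite normcM (le_trans (ler_pM (normc_ge0 _) (normc_ge0 _) z1 z1')) // ler_peMl // ler1n.
exists (c * g z + f z * c').
  rewrite (le_trans (le_normcD _ _)) // !normcM.
  apply: (@le_trans _ _ (M * M' + M * M')); last by lra.
  by rewrite lerD // ler_pM ?normc_ge0.
move=> w; rewrite lt_min => /andP[wr wr']; have [_ [cw hcw _]] := hM w wr.
have [w1 _] := hM w wr; have [h hl h1] := hw w wr; have [h' hl' _] := hw' w wr'.
have -> : f w * g w - f z * g z - (c * g z + f z * c') * (w - z) =
  f w * (g w - g z - c' * (w - z)) + g z * (f w - f z - c * (w - z)) +
  (f w - f z) * (c' * (w - z)) by ring.
have -> : 4 * (M * M') * normc (w - z) ^+ 2 = M * (M' * normc (w - z) ^+ 2) +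
  M' * (M * normc (w - z) ^+ 2) + 2 * M * normc (w - z) * (M' * normc (w - z)) by ring.
rewrite (le_trans (le_normcD _ _)) // lerD //.
  rewrite (le_trans (le_normcD _ _)) // lerD // normcM ler_pM ?normc_ge0 //.
rewrite normcM ler_pM ?normc_ge0 // normcM ler_wpM2r ?normc_ge0 //.
Qed.

Lemma holo_at_comp f g z0 : holo_at f (g z0) -> holo_at g z0 -> holo_at (fun z => f (g z)) z0.
Proof.
move=> /holo_atP [r [M [r0 _ M0 hM]]] hg.
have [d d0 hd] := holo_at_cvg hg r0.
have [r' [M' [r0' _ M0' hM']]] := holo_atP hg.
exists (Num.min d r'); first by rewrite lt_min d0.
pose B := M + M * M' + M * (2 * M') ^+ 2.
have MM : 0 <= M * M' by rewrite mulr_ge0.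
have M2 : 0 <= M * (2 * M') ^+ 2 by rewrite mulr_ge0 ?sqr_ge0.
exists B => z; rewrite lt_min => /andP[/hd /hM [z1 [c hc hw]] /hM' [z1' [c' hc' hw']]].
split; first by apply: (le_trans z1); rewrite /B -addrA lerDl addr_ge0.
exists (c * c').
  rewrite normcM (le_trans (ler_pM (normc_ge0 _) (normc_ge0 _) hc hc')) // /B; lra.
move=> w; rewrite lt_min => /andP[/hd /hw [h _ _] /hw' [h' hl _]].
have -> : f (g w) - f (g z) - c * c' * (w - z) =
  (f (g w) - f (g z) - c * (g w - g z)) + c * (g w - g z - c' * (w - z)) by ring.
apply: (le_trans (le_normcD _ _)).
apply: (@le_trans _ _ (M * (2 * M' * normc (w - z)) ^+ 2 + M * (M' * normc (w - z) ^+ 2))).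
  apply: lerD.
    apply: (le_trans h); rewrite ler_wpM2l // lerXn2r ?nnegrE ?normc_ge0 //.
    by rewrite !mulr_ge0 ?normc_ge0.
  by rewrite normcM ler_pM ?normc_ge0.
have -> (x y : R) : M * (y * x) ^+ 2 + M * (M' * x ^+ 2) = (M * y ^+ 2 + M * M') * x ^+ 2 by ring.
by rewrite ler_wpM2r ?sqr_ge0 // /B; lra.
Qed.

(** ** The complex exponential *)

Definition cexp z : C := (expR (complex.Re z) * cos (complex.Im z)) +i*
  (expR (complex.Re z) * sin (complex.Im z)).

Lemma cexpD z w : cexp (z + w) = cexp z * cexp w.
Proof.
apply: complex_ext; rewrite ?cE /= cReD cImD expRD ?cosD ?sinD; ring.
Qed.

Lemma normc_cexp z : normc (cexp z) = expR (complex.Re z).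
Proof.
have e0 := expR_ge0 (complex.Re z).
rewrite -[RHS]ger0_norm // -sqrtr_sqr; congr Num.sqrt.
by rewrite !exprMn -mulrDr cos2Dsin2 mulr1.
Qed.

Lemma abs_sin_le (x : R) : `|sin x| <= `|x|.
Proof.
wlog x0 : x / 0 <= x.
  move=> h; have [/h //|/ltW x0] := leP 0 x.
  by rewrite -normrN -sinN -[leRHS]normrN; apply: h; rewrite oppr_ge0.
have [c _] := @MVT_segment R sin cos 0 x x0 (fun y _ => is_derive_sin y)
  (continuous_subspaceT (@continuous_sin R)).
by rewrite sin0 !subr0 => ->; rewrite normrM ler_piMl // cos_max.
Qed.

Lemma abs_cosB1_le (x : R) : `|cos x - 1| <= x ^+ 2.
Proof.
have -> : cos x - 1 = - (sin (x / 2) ^+ 2 *+ 2).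
  have {1}-> : x = (x / 2) *+ 2 by rewrite -mulr_natr divfK // pnatr_eq0.
  rewrite cos_mulr2n cos2sin2; ring.
rewrite normrN normrMn normrX.
have := abs_sin_le (x / 2); rewrite normrM [`|2^-1|]ger0_norm ?invr_ge0 // => h.
have := normr_ge0 (sin (x / 2)); rewrite -[x ^+ 2]real_normK ?num_real //.
have := normr_ge0 x; move: h; nra.
Qed.

Lemma abs_sinB_le (x : R) : `|x| <= 1 -> `|sin x - x| <= x ^+ 2.
Proof.
wlog x0 : x / 0 <= x.
  move=> h x1; have [/h -> //|/ltW x0] := leP 0 x.
  have := h (- x); rewrite oppr_ge0 normrN sinN sqrrN -opprD normrN; exact.
rewrite ger0_norm // => x1.
have D y : y \in `]0, x[%R -> is_derive y 1 (fun y => sin y - y) (cos y - 1)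
  by move=> _; apply: is_deriveB.
have cS : continuous (fun y : R => sin y - y).
  by move=> y; apply: cvgB; [exact: continuous_sin|exact: cvg_id].
have [c] := @MVT_segment R (fun y => sin y - y)
    (fun y => cos y - 1) 0 x x0 D (continuous_subspaceT cS).
rewrite in_itv /= sin0 !subr0 => /andP[c0 cx] ->.
rewrite normrM [`|x|]ger0_norm // expr2 ler_wpM2r //.
apply: (le_trans (abs_cosB1_le c)); nra.
Qed.

Lemma abs_expRB1_le (x : R) : `|x| <= 2^-1 -> `|expR x - 1 - x| <= 2 * x ^+ 2.
Proof.
move=> x2; have h1 := expR_ge1Dx x; have h2 := expR_ge1Dx (- x).
rewrite ger0_norm; last by lra.
have e0 := expR_gt0 x; have := expRxMexpNx_1 x => h3.
move: x2; rewrite ler_norml => /andP[xl xr].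
have : expR x * (1 - x) <= 1 by rewrite -[leRHS]h3 ler_wpM2l // ltW.
nra.
Qed.

Lemma cexp_remainder z : normc z <= 2^-1 -> normc (cexp z - 1 - z) <= 6 * normc z ^+ 2.
Proof.
case: z => a b zn; set z := a +i* b in zn *.
have an : `|a| <= 2^-1 by exact: le_trans (abs_Re_le z) zn.
have bn : `|b| <= 2^-1 by exact: le_trans (abs_Im_le z) zn.
have ha := abs_expRB1_le an.
have b1 : `|b| <= 1 by lra.
have hb := abs_sinB_le b1.
have hb' := abs_cosB1_le b.
have E : cexp z - 1 - z = (expR a - 1 - a)%:C * (cos b +i* sin b) +
   (1 + a)%:C * ((cos b - 1) +i* (sin b - b)) + a%:C * (0 +i* b).
  by apply: complex_ext; rewrite ?cE /=; ring.
have n1 : normc (cos b +i* sin b) = 1 by rewrite /= cos2Dsin2 sqrtr1.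
have n2 : normc ((cos b - 1) +i* (sin b - b)) <= 2 * b ^+ 2.
  by rewrite (le_trans (normc_le_ReIm _)) //= mulr_natl mulr2n lerD.
have n3 : normc (0 +i* b) = `|b| by rewrite /= expr0n /= add0r sqrtr_sqr.
have zE : normc z ^+ 2 = a ^+ 2 + b ^+ 2 by rewrite sqr_normcE.
rewrite E zE (le_trans (le_normcD _ _)) //.
apply: (@le_trans _ _ ((2 * a ^+ 2 + 2 * (2 * b ^+ 2)) + `|a| * `|b|)).
  apply: lerD; last by rewrite normcZ n3.
  apply: (le_trans (le_normcD _ _)); apply: lerD; first by rewrite normcZ n1 mulr1.
  rewrite normcZ ler_pM ?normc_ge0 // ler_norml; move: an; rewrite ler_norml; lra.
rewrite -[a ^+ 2]real_normK ?num_real // -[b ^+ 2]real_normK ?num_real //.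
have := normr_ge0 a; have := normr_ge0 b; nra.
Qed.

Lemma holo_at_cexp z0 : holo_at cexp z0.
Proof.
pose B := expR (complex.Re z0 + 1).
have B0 : 0 <= B by exact: expR_ge0.
exists 4^-1; first by rewrite invr_gt0 ltr0n.
exists (6 * B) => z zr.
have zB : normc (cexp z) <= B.
  rewrite normc_cexp ler_expR; have := le_trans (ler_norm _) (abs_Re_le (z - z0)).
  by rewrite cReD cReN; lra.
split; first by rewrite (le_trans zB) // ler_peMl // ler1n.
exists (cexp z); first by rewrite (le_trans zB) // ler_peMl // ler1n.
move=> w wr.
have -> : cexp w - cexp z - cexp z * (w - z) = cexp z * (cexp (w - z) - 1 - (w - z)).
  have -> : cexp w = cexp z * cexp (w - z) by rewrite -cexpD addrC subrK.
  ring.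
rewrite normcM [6 * B]mulrC -mulrA; apply: ler_pM; rewrite ?normc_ge0 //.
apply: cexp_remainder.
have -> : w - z = (w - z0) - (z - z0) by ring.
by rewrite (le_trans (ler_normcB _ _)) //; lra.
Qed.

Definition ccosh z : C := 2^-1 * (cexp z + cexp (-1 * z)).

Lemma holo_at_ccosh z0 : holo_at ccosh z0.
Proof.
apply: holo_at_mull; apply: holo_at_add; first exact: holo_at_cexp.
by apply: holo_at_comp; [exact: holo_at_cexp|exact: holo_at_lin].
Qed.

(** This is the integrand of the Chebyshev coefficients, as a function of the
    complex variable that replaces i u. *)
Lemma holo_at_contour f (k : nat) z0 : holo_at f (ccosh z0) ->
  holo_at (fun z => f (ccosh z) * cexp (k%:R * z)) z0.
Proof.
move=> hf; apply: holo_at_mul; first by apply: holo_at_comp => //; exact: holo_at_ccosh.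
by apply: holo_at_comp; [exact: holo_at_cexp|exact: holo_at_lin].
Qed.

End HoloClosure.

(** * Shifting the contour *)

Section ContourShift.
Context {R : realType}.
Local Notation C := R[i].
Local Notation leb := (@lebesgue_measure R).

Let intc (a b : R) (phi : R -> R) : R := \int[leb]_(t in `[a, b]) phi t.

Let integrable_ab (a b : R) (phi : R -> R) : continuous phi ->
  leb.-integrable `[a, b] (EFin \o phi).
Proof. by move=> c; apply: integrable_cc; exact: continuous_subspaceT. Qed.

Let intc_split (a b c : R) (phi : R -> R) : continuous phi -> a <= b -> b <= c ->
  intc a c phi = intc a b phi + intc b c phi.
Proof.
move=> cp ab bc; rewrite /intc.
have := @Rintegral_itvB R phi (BLeft a) (BRight c) b (integrable_ab _ _ cp).
rewrite !bnd_simp => /(_ ab bc); rewrite Rintegral_itv_obnd_cbnd.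
  by move=> <-; rewrite addrC subrK.
by apply: integrableS (integrable_ab b c cp) => //; exact: subset_itv_oc_cc.
Qed.

Let intc_shift (a b h : R) (phi : R -> R) : continuous phi -> a <= b ->
  intc a b (fun t => phi (t + h)) = intc (a + h) (b + h) phi.
Proof.
move=> cp ab; rewrite /intc /Rintegral; congr fine; apply/esym.
have dF : derive1 (fun t : R => t + h) = (fun=> 1).
  by apply/funext => t; rewrite derive1E derive_val addr0.
have cF : continuous (fun t : R => t + h).
  by move=> t; apply: cvgD; [exact: cvg_id|exact: cvg_cst].
rewrite (@integration_by_substitution_increasing R (fun t => t + h)) //.
- by apply: eq_integral => t _; rewrite /= !fctE /= dF mulr1.
- by move=> x y _ _; rewrite ltrD2r.
- by rewrite dF => t _; exact: cvg_cst.
- by rewrite dF; exact: is_cvg_cst.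
- by rewrite dF; exact: is_cvg_cst.
- split.
  + by move=> x _; apply: derivableD.
  + by apply: cvg_at_right_filter; exact: cF.
  + by apply: cvg_at_left_filter; exact: cF.
- exact: continuous_subspaceT.
Qed.

Let intc_period (h : R) (phi : R -> R) : continuous phi ->
  (forall t, phi (t + pi *+ 2) = phi t) -> 0 <= h ->  h <= pi *+ 2 ->
  intc (- pi) pi (fun t => phi (t + h)) = intc (- pi) pi phi.
Proof.
move=> cp per h0 h2; have p0 := @pi_ge0 R.
rewrite intc_shift //; last by lra.
rewrite (@intc_split _ pi); [|by []|by rewrite mulr2n in h2; lra|by lra].
rewrite [RHS](@intc_split _ (- pi + h)); [|by []|by lra|by rewrite mulr2n in h2; lra].
rewrite addrC; congr (_ + _).
have -> : phi = fun t => phi (t + pi *+ 2) by apply/funext => t; rewrite per.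
rewrite [RHS]intc_shift //; last by lra.
have -> : (fun t => phi (t + pi *+ 2)) = phi by apply/funext => t; rewrite per.
by congr intc; rewrite mulr2n; ring.
Qed.

Let intc_period_abs (h : R) (phi : R -> R) : continuous phi ->
  (forall t, phi (t + pi *+ 2) = phi t) -> `|h| <= 1 ->
  intc (- pi) pi (fun t => phi (t + h)) = intc (- pi) pi phi.
Proof.
move=> cp per; have p2 := @pi_ge2 R; rewrite ler_norml => /andP[h1 h2].
have [h0|h0] := leP 0 h; first by apply: intc_period => //; rewrite mulr2n; lra.
rewrite -[RHS](@intc_period (pi *+ 2 + h)) //; try by rewrite mulr2n; lra.
by congr intc; apply/funext => t; rewrite [pi *+ 2 + h]addrC addrA per.
Qed.

(** Such increments force the derivative to vanish. *)
Let quadratic_increments_constant (G : R -> R) (a b : R) : a <= b ->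
  (forall s, a <= s <= b -> exists n : nat, forall s', a <= s' <= b ->
    `|s' - s| <= n.+1%:R^-1 -> `|G s' - G s| <= n%:R * (s' - s) ^+ 2) ->
  G a = G b.
Proof.
move=> ab hG.
have D x : x \in `]a, b[ -> is_derive x 1 G (cst 0 x).
  rewrite in_itv /= => /andP[ax xb].
  have [|n hn] := hG x; first by rewrite !ltW.
  have L : h^-1 *: (G (h *: 1 + x) - G x) @[h --> 0^'] --> (0 : R).
    apply/cvgrPdist_lt => e e0.
    pose d := Num.min (Num.min (x - a) (b - x)) (Num.min n.+1%:R^-1 (e / n.+1%:R)).
    have d0 : 0 < d by rewrite !lt_min !subr_gt0 ax xb invr_gt0 ltr0n divr_gt0.
    near=> h.
    have h0 : h != 0 by near: h; exact: nbhs_dnbhs_neq.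
    have : `|h| < d by near: h; apply: dnbhs0_lt.
    rewrite !lt_min => /andP[/andP[h1 h2] /andP[h3 h4]].
    have hx : h *: (1 : R) + x = x + h by rewrite /GRing.scale /= mulr1 addrC.
    have := hn (x + h); rewrite hx [x + h - x]addrC addKr => H.
    have {}H : `|G (x + h) - G x| <= n%:R * h ^+ 2.
      apply: H; last exact: ltW.
      by move: h1 h2; rewrite !ltr_norml; lra.
    rewrite sub0r normrN /GRing.scale /= normrM normfV.
    rewrite mulrC ltr_pdivrMr ?normr_gt0 //; apply: (le_lt_trans H).
    rewrite -real_normK ?num_real // expr2 mulrA ltr_pM2r ?normr_gt0 //.
    apply: (@le_lt_trans _ _ (n.+1%:R * `|h|)); first by rewrite ler_wpM2r // ler_nat.
    by rewrite mulrC -ltr_pdivlMr.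
  have dG : derivable G x 1 by apply/cvg_ex; exists 0; exact: L.
  apply: DeriveDef => //; rewrite /derive; exact: cvg_lim L.
have cG : {within `[a, b], continuous G}.
  apply/subspace_continuousP => s; rewrite /= in_itv /= => sab.
  have [n hn] := hG s sab.
  apply/cvgrPdist_lt => e e0.
  pose d := Num.min n.+1%:R^-1 (e / n.+1%:R).
  have d0 : 0 < d by rewrite lt_min invr_gt0 ltr0n divr_gt0.
  exists d => //= s' /= hs; rewrite in_itv /= => s'ab.
  move: hs; rewrite lt_min distrC => /andP[h1 h2].
  rewrite distrC; apply: (le_lt_trans (hn s' s'ab (ltW h1))).
  have u1 : `|s' - s| <= 1 by rewrite (le_trans (ltW h1)) // invf_le1 // ler1n.
  apply: (@le_lt_trans _ _ (n.+1%:R * `|s' - s|)); last by rewrite mulrC -ltr_pdivlMr.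
  rewrite -real_normK ?num_real // expr2 ler_pM ?mulr_ge0 ?ler_nat //.
  by rewrite ler_piMl.
have [c _ /eqP] := MVT_segment ab D cG.
by rewrite mul0r subr_eq0 => /eqP.
Unshelve. all: by end_near. Qed.

Variables (f : C -> C) (k : nat).

Let K (z : C) : C := f (ccosh z) * cexp (k%:R * z).

Let Kpt (s t : R) : C := K (s +i* t).

Let ccosh_period (s t : R) : ccosh (s +i* (t + pi *+ 2)) = ccosh (s +i* t).
Proof.
have E (u v : R) : cexp (u +i* (v + pi *+ 2)) = cexp (u +i* v).
  by rewrite /cexp /= cosD2pi sinD2pi.
rewrite /ccosh E; congr (_ * (_ + _)).
have -> : -1 * (s +i* t) = - s +i* (- (t + pi *+ 2) + pi *+ 2) :> C.
  by apply: complex_ext; rewrite ?cE /=; ring.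
rewrite E; congr cexp.
by apply: complex_ext; rewrite ?cE /=; ring.
Qed.

Let K_period (s t : R) : Kpt s (t + pi *+ 2) = Kpt s t.
Proof.
rewrite /Kpt /K ccosh_period; congr (_ * _).
rewrite /cexp !cReM !cImM /= (_ : complex.Im k%:R = 0 :> R) ?mul0r; last first.
  by elim: k => [//|m IH]; rewrite -natr1 cImD IH add0r.
rewrite (_ : complex.Re k%:R = k%:R :> R); last first.
  by elim: k => [//|m IH]; rewrite -natr1 cReD IH -natr1.
rewrite !addr0 mulrDr.
have P m (x : R) : cos (x + m%:R * pi *+ 2) = cos x /\ sin (x + m%:R * pi *+ 2) = sin x.
  elim: m => [|m [IH1 IH2]]; first by rewrite mul0r mul0rn addr0.
  rewrite -natr1 mulrDl mul1r mulrnDl addrA cosD2pi sinD2pi //.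
by rewrite mulrnAr; have [-> ->] := P k (k%:R * t).
Qed.

Lemma holo_at_continuous (g : C -> C) (s t : R) : holo_at g (s +i* t) ->
  {for t, continuous (fun u => complex.Re (g (s +i* u)))} /\
  {for t, continuous (fun u => complex.Im (g (s +i* u)))}.
Proof.
move=> /holo_at_cvg hg.
have L : g (s +i* u) @[u --> t] --> (g (s +i* t) : C^o).
  apply/cvgCP => e /hg [d d0 hd]; near=> u.
  apply: hd; have -> : s +i* u - (s +i* t) = 0 +i* (u - t) :> C.
    by apply: complex_ext; rewrite ?cE /=; ring.
  rewrite /= expr0n /= add0r sqrtr_sqr distrC.
  by near: u; exact: (nbhsx_ballx t d d0).
split; [exact: cvgC_Re L|exact: cvgC_Im L].
Unshelve. all: by end_near. Qed.

(** Up to second order, a real step h changes the function by c h and an imaginary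
    one by i c h, so that c cancels; compactness of a period makes the constant
    independent of t. *)
Let second_difference (s : R) : (forall t, holo_at K (s +i* t)) ->
  exists n : nat, forall t, - pi <= t <= pi -> forall h : R, `|h| <= n.+1%:R^-1 ->
    normc (Kpt (s + h) t - Kpt s t + (0 +i* 1) * (Kpt s (t + h) - Kpt s t))
      <= n%:R * h ^+ 2.
Proof.
move=> hK.
pose P (n : nat) t := forall h : R, `|h| <= n.+1%:R^-1 ->
    normc (Kpt (s + h) t - Kpt s t + (0 +i* 1) * (Kpt s (t + h) - Kpt s t))
      <= n%:R * h ^+ 2.
have : \forall n \near \oo, `[(- pi), pi]%classic `<=` P n.
  apply: (proj1 (compact_near_coveringP _) (@segment_compact R (- pi) pi) nat \oo P _) => t0 _.
  have [r r0 [M hM]] := hK t0.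
  have M0 : 0 <= M.
    have [h _] := hM (s +i* t0) ltac:(by rewrite subrr normc0).
    by apply: le_trans h; exact: normc_ge0.
  have r2 : 0 < r / 2 by rewrite divr_gt0.
  near=> t n => h hn.
  have t1 : `|t0 - t| < r / 2 by near: t; exact: (nbhsx_ballx t0 (r / 2) r2).
  have n1 : n.+1%:R^-1 < r / 2 by near: n; exact: near_infty_natSinv_lt (PosNum r2).
  have n2 : 2 * M <= n%:R by near: n; exact: nbhs_infty_ger.
  have hr : `|h| < r / 2 by exact: le_lt_trans n1.
  have V (a b : R) : normc (a +i* b) <= `|a| + `|b| by exact: normc_le_ReIm.
  have e0 : s +i* t - (s +i* t0) = 0 +i* (t - t0) :> C.
    by apply: complex_ext; rewrite ?cE /=; ring.
  have [|_ [c _ hc]] := hM (s +i* t).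
    by rewrite e0 (le_lt_trans (V _ _)) // normr0 add0r distrC; lra.
  have h1 := hc ((s + h) +i* t); have h2 := hc (s +i* (t + h)).
  have e1 : (s + h) +i* t - (s +i* t) = h%:C :> C.
    by apply: complex_ext; rewrite ?cE /=; ring.
  have e2 : s +i* (t + h) - (s +i* t) = (0 +i* 1) * h%:C :> C.
    by apply: complex_ext; rewrite ?cE /=; ring.
  have ni : normc (0 +i* 1 : C) = 1 by rewrite /= expr0n /= add0r expr1n sqrtr1.
  have k1 : normc ((s + h) +i* t - (s +i* t0) : C) < r.
    have -> : (s + h) +i* t - (s +i* t0) = h +i* (t - t0) :> C.
      by apply: complex_ext; rewrite ?cE /=; ring.
    by rewrite (le_lt_trans (V _ _)) // [`|t - _|]distrC; lra.
  have k2 : normc (s +i* (t + h) - (s +i* t0) : C) < r.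
    have -> : s +i* (t + h) - (s +i* t0) = 0 +i* ((t - t0) + h) :> C.
      by apply: complex_ext; rewrite ?cE /=; ring.
    rewrite (le_lt_trans (V _ _)) // normr0 add0r (le_lt_trans (ler_normD _ _)) //.
    by rewrite [`|t - _|]distrC; lra.
  move: (h1 k1) (h2 k2); rewrite e1 e2 !normcM ni mul1r normcR real_normK ?num_real // => H1 H2.
  have -> : Kpt (s + h) t - Kpt s t + (0 +i* 1) * (Kpt s (t + h) - Kpt s t) =
    (Kpt (s + h) t - Kpt s t - c * h%:C) +
    (0 +i* 1) * (Kpt s (t + h) - Kpt s t - c * ((0 +i* 1) * h%:C)).
    have ii : (0 +i* 1) * (0 +i* 1) = -1 :> C.
      by apply: complex_ext; rewrite ?cE /=; ring.
    have -> (J y x : C) : J * (y - c * (J * x)) = J * y - (J * J) * (c * x) by ring.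
    rewrite ii; ring.
  apply: (le_trans (le_normcD _ _)).
  apply: (@le_trans _ _ (2 * M * h ^+ 2)); last by rewrite ler_wpM2r ?sqr_ge0.
  have -> : 2 * M * h ^+ 2 = M * h ^+ 2 + M * h ^+ 2 by ring.
  by apply: lerD => //; rewrite normcM ni mul1r.
move=> [n _ /(_ n (leqnn _)) hn]; exists n => t tp h hh; apply: hn => //.
Unshelve. all: by end_near. Qed.

(** Translating t does not change the integral over a period.  Since a step in s
    amounts to a step in t up to second order, the integral has quadratic
    increments in s and is therefore constant: this plays the part of Cauchy's
    theorem. *)
Lemma contour_integral_constant (b : R) : b <= 0 ->
  (forall s t, b <= s <= 0 -> holo_at f (ccosh (s +i* t))) ->
  \int[leb]_(t in `[- pi, pi]) complex.Re (K (b +i* t)) =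
  \int[leb]_(t in `[- pi, pi]) complex.Re (K (0 +i* t)).
Proof.
move=> b0 hf.
have hK s t : b <= s <= 0 -> holo_at K (s +i* t).
  by move=> sb; apply: holo_at_contour; exact: hf.
have cRe s : b <= s <= 0 -> continuous (fun t => complex.Re (Kpt s t)).
  by move=> sb t; have [] := holo_at_continuous (hK s t sb).
have cIm s : b <= s <= 0 -> continuous (fun t => complex.Im (Kpt s t)).
  by move=> sb t; have [] := holo_at_continuous (hK s t sb).
have cshift (phi : R -> R) h : continuous phi -> continuous (fun t => phi (t + h)).
  move=> cp t; apply: (@continuous_comp _ _ _ (fun t => t + h) phi); last exact: cp.
  by apply: cvgD; [exact: cvg_id|exact: cvg_cst].
have cB (u v : R -> R) : continuous u -> continuous v -> continuous (fun t => u t - v t).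
  by move=> cu cv t; apply: cvgB; [exact: cu|exact: cv].
have IB (u v : R -> R) : continuous u -> continuous v ->
   intc (- pi) pi (fun t => u t - v t) = intc (- pi) pi u - intc (- pi) pi v.
  by move=> cu cv; rewrite /intc RintegralB //; exact: integrable_ab.
apply: (@quadratic_increments_constant (fun s => intc (- pi) pi (fun t =>
    complex.Re (Kpt s t)))) => // s sb.
have [n hn] := second_difference (fun t => hK s t sb).
(* The period has length 2 pi <= 8, whence the factor 8. *)
have p4 : pi <= 4 :> R by have [/andP[_]] := @pihalf_02_cos_pihalf R; lra.
exists (8 * n)%N => s' s'b hs.
pose h := s' - s; have s'E : s' = s + h by rewrite /h addrC subrK.
have h1 : `|h| <= n.+1%:R^-1.
  by rewrite (le_trans hs) // lef_pV2 ?posrE // ler_nat ltnS leq_pmull.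
have h11 : `|h| <= 1 by rewrite (le_trans h1) // invf_le1 // ler1n.
have cs := cshift _ h (cIm s sb).
have cq : continuous (fun t => (complex.Re (Kpt s' t) - complex.Re (Kpt s t))
     - (complex.Im (Kpt s (t + h)) - complex.Im (Kpt s t))).
  exact: (cB _ _ (cB _ _ (cRe s' s'b) (cRe s sb)) (cB _ _ cs (cIm s sb))).
have -> : intc (- pi) pi (fun t => complex.Re (Kpt s' t)) - intc (- pi) pi (fun t =>
    complex.Re (Kpt s t)) =
  intc (- pi) pi (fun t => (complex.Re (Kpt s' t) - complex.Re (Kpt s t))
     - (complex.Im (Kpt s (t + h)) - complex.Im (Kpt s t))).
  rewrite (IB _ _ (cB _ _ (cRe s' s'b) (cRe s sb)) (cB _ _ cs (cIm s sb))).
  rewrite (IB _ _ (cRe s' s'b) (cRe s sb)) (IB _ _ cs (cIm s sb)).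
  rewrite (@intc_period_abs h (fun t => complex.Im (Kpt s t))) ?subrr ?subr0 //; first exact: cIm.
  by move=> t; rewrite K_period.
rewrite /intc; apply: (le_trans (le_normr_Rintegral _ _)) => //; first exact: integrable_ab.
apply: (@le_trans _ _ (\int[leb]_(t in `[- pi, pi]) (n%:R * h ^+ 2))).
  apply: le_Rintegral => //.
  - by apply: (@integrable_ab _ _ (fun t => `| _ |)) => t; apply: cvg_norm; exact: cq.
  - by apply: integrable_ab => t; exact: cvg_cst.
  move=> t; rewrite /= in_itv /= => tp.
  apply: le_trans (hn t tp h h1); apply: le_trans (abs_Re_le _).
  have Rei (z : C) : complex.Re ((0 +i* 1) * z) = - complex.Im z.
    by rewrite cReM /= mul0r mul1r sub0r.
  by rewrite cReD Rei !cReD !cReN !cImD !cImN -s'E.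
rewrite Rintegral_cst //= lebesgue_measure_itv /= lte_fin ifT; last by have := @pi_gt0 R; lra.
rewrite -/h /= opprK mulrC natrM mulrA ler_wpM2r ?sqr_ge0 // ler_wpM2r //; lra.
Qed.

End ContourShift.

(** * Decay of the Chebyshev coefficients *)

Section CoefficientDecay.
Context {R : realType}.
Local Notation C := R[i].
Local Notation leb := (@lebesgue_measure R).

Lemma cRe_nat (k : nat) : complex.Re (k%:R : C) = k%:R.
Proof. by elim: k => [//|m IH]; rewrite -natr1 cReD IH -natr1. Qed.

Lemma cIm_nat (k : nat) : complex.Im (k%:R : C) = 0.
Proof. by elim: k => [//|m IH]; rewrite -natr1 cImD IH add0r. Qed.

Lemma ccoshE (a t : R) : ccosh (a +i* t) =
  ((expR a + expR (- a)) / 2 * cos t) +i* ((expR a - expR (- a)) / 2 * sin t).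
Proof.
rewrite /ccosh.
have -> : -1 * (a +i* t) = (- a) +i* (- t) :> C.
  by apply: complex_ext; rewrite ?cE /=; ring.
have -> : 2^-1 = (2^-1 : R)%:C by rewrite fmorphV rmorph_nat.
by apply: complex_ext; rewrite ?cE /= cosN sinN; ring.
Qed.

Lemma ccosh_imag (t : R) : ccosh (0 +i* t) = (cos t)%:C.
Proof. by rewrite ccoshE oppr0 expR0 subrr mul0r mul0r -mulr2n divff ?mul1r // pnatr_eq0. Qed.

(** Vertical segments are mapped into the confocal ellipses. *)
Lemma ccosh_ellipse (S s eta a t : R) : ellipse_axes S s -> expR eta = S + s ->
  - eta <= a <= 0 -> ellipse S s (ccosh (a +i* t)).
Proof.
move=> [s0 sS Ss] eE /andP[ea a0].
have S0 : 0 < S by lra.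
have E0 := expR_gt0 eta; have eN : expR (- eta) = S - s.
  apply: (mulfI (lt0r_neq0 E0)); rewrite expRxMexpNx_1 eE; lra.
have a1 : expR a <= 1 by rewrite expR_le1.
have a2 : expR (- eta) <= expR a by rewrite ler_expR.
have a3 := expRxMexpNx_1 a; have a4 := expR_gt0 a; have a5 := expR_gt0 (- a).
have a6 : 1 <= expR (- a) by rewrite -expR0 ler_expR; lra.
have a7 : expR (- a) <= expR eta by rewrite ler_expR; lra.
rewrite ccoshE /ellipse /=.
set x := expR a in a1 a2 a3 a4 *; set y := expR (- a) in a3 a5 a6 a7 *.
have c0 : 0 <= (x + y) / 2 by lra.
have c1 : (x + y) / 2 <= S.
  have : 0 <= (S + s - y) * (y - (S - s)).
    by rewrite mulr_ge0 ?subr_ge0 -?eE // -eN (le_trans a2) // (le_trans a1).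
  have -> : (S + s - y) * (y - (S - s)) =
    (2 * S - (x + y)) * y + (x * y - (S ^+ 2 - s ^+ 2)) by ring.
  by rewrite a3 Ss subrr addr0 pmulr_lge0 //; lra.
have d1 : ((x - y) / 2) ^+ 2 <= s ^+ 2.
  have -> : ((x - y) / 2) ^+ 2 = ((x + y) / 2) ^+ 2 - x * y by field.
  have -> : s ^+ 2 = S ^+ 2 - 1 by lra.
  by rewrite a3 lerB // lerXn2r ?nnegrE // ltW.
have P1 : ((x + y) / 2 * cos t / S) ^+ 2 <= cos t ^+ 2.
  rewrite expr_div_n exprMn ler_pdivrMr ?exprn_gt0 // mulrC ler_wpM2l ?sqr_ge0 //.
  by rewrite lerXn2r ?nnegrE // ltW.
have P2 : ((x - y) / 2 * sin t / s) ^+ 2 <= sin t ^+ 2.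
  by rewrite expr_div_n exprMn ler_pdivrMr ?exprn_gt0 // mulrC ler_wpM2l ?sqr_ge0.
by apply: (le_trans (lerD P1 P2)); rewrite cos2Dsin2.
Qed.

Variables (S s eta M : R) (f : C -> C).
Hypotheses (hE : ellipse_axes S s) (heta : expR eta = S + s) (eta0 : 0 <= eta).
Hypothesis hf : forall z, ellipse S s z -> holo_at f z.
Hypothesis fM : forall z, ellipse S s z -> normc (f z) <= M.

(** Symmetrizing in t turns the exponential into twice a cosine, so the integral
    is half of a contour integral at s = 0.  Moved to s = - eta, where the contour
    is the boundary of the ellipse, the exponential has modulus
    exp (- k eta). *)
Lemma cosine_integral_bound (k : nat) :
  `|\int[leb]_(u in `[0, pi]) (complex.Re (f (cos u)%:C) * cos (k%:R * u))| <=
  pi * M * expR (- (k%:R * eta)).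
Proof.
pose K (z : C) := f (ccosh z) * cexp (k%:R * z).
have H a t : - eta <= a <= 0 -> holo_at f (ccosh (a +i* t)).
  by move=> ha; apply: hf; exact: ccosh_ellipse hE heta ha.
have eta1 : - eta <= 0 by rewrite oppr_le0.
have /= E1 := contour_integral_constant k eta1 H.
have p0 := @pi_gt0 R.
have cK a : - eta <= a <= 0 -> continuous (fun t => complex.Re (K (a +i* t))).
  move=> ha t; have [] // := @holo_at_continuous _ K a t _.
  by apply: holo_at_contour; exact: H.
have h0 : - eta <= (0 : R) <= 0 by rewrite eta1 lexx.
have c0 := cK 0 h0.
have kE (a t : R) : k%:R * (a +i* t) = (k%:R * a) +i* (k%:R * t) :> C.
  by apply: complex_ext; rewrite ?cReM ?cImM cRe_nat cIm_nat /=; ring.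
have K0 t : complex.Re (K (0 +i* t)) = complex.Re (f (cos t)%:C) * cos (k%:R * t)
   - complex.Im (f (cos t)%:C) * sin (k%:R * t).
  by rewrite /K ccosh_imag cReM kE /cexp /= mulr0 expR0 !mul1r.
have iK : leb.-integrable `[- pi, pi] (EFin \o (fun t => complex.Re (K (0 +i* t)))).
  by apply: integrable_cc; exact: continuous_subspaceT.
have E2 : \int[leb]_(t in `[- pi, pi]) complex.Re (K (0 +i* t)) =
   2 * \int[leb]_(u in `[0, pi]) (complex.Re (f (cos u)%:C) * cos (k%:R * u)).
  have := @Rintegral_itvB R _ (BLeft (- pi)) (BRight pi) 0 iK.
  rewrite !bnd_simp => /(_ ltac:(lra) ltac:(lra)) /eqP; rewrite subr_eq => /eqP ->.
  rewrite Rintegral_itv_obnd_cbnd; last first.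
    by apply: integrableS iK => //; move=> t /=; rewrite !in_itv /=; lra.
  have -> : \int[leb]_(t in `[- pi, 0]) complex.Re (K (0 +i* t)) =
      \int[leb]_(t in `[0, pi]) complex.Re (K (0 +i* (- t))).
    rewrite /Rintegral -[X in `[- pi, X]]oppr0; congr fine.
    by rewrite integration_by_substitution_oppr ?ltW //; exact: continuous_subspaceT.
  have cN : continuous (fun t => complex.Re (K (0 +i* (- t)))).
    move=> t; apply: (@continuous_comp _ _ _ -%R (fun t => complex.Re (K (0 +i* t)))).
      by apply: continuousN; exact: cvg_id.
    exact: c0.
  rewrite -RintegralD //; try (apply: integrable_cc; exact: continuous_subspaceT).
  have cosint : leb.-integrable `[0, pi] (EFin \o (fun u =>
      complex.Re (f (cos u)%:C) * cos (k%:R * u))).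
    have e t : complex.Re (f (cos t)%:C) * cos (k%:R * t) =
      2^-1 * (complex.Re (K (0 +i* t)) + complex.Re (K (0 +i* (- t)))).
      by rewrite !K0 cosN mulrN cosN sinN; field.
    rewrite (_ : (fun u => _) = (fun t => 2^-1 * (complex.Re (K (0 +i* t))
        + complex.Re (K (0 +i* (- t)))))); last exact/funext.
    apply: integrable_cc; apply: continuous_subspaceT => t.
    by apply: cvgM; [exact: cvg_cst|apply: cvgD; [exact: c0|exact: cN]].
  rewrite -RintegralZl //; apply: eq_Rintegral => t _.
  by rewrite !K0 cosN mulrN cosN sinN; ring.
have hb : - eta <= - eta <= 0 by rewrite lexx eta1.
have e1 : `|\int[leb]_(t in `[- pi, pi]) complex.Re (K (- eta +i* t))| <=
   M * expR (- (k%:R * eta)) * (2 * pi).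
  have cb := cK _ hb.
  apply: (le_trans (le_normr_Rintegral _ _)) => //.
    by apply: integrable_cc; exact: continuous_subspaceT.
  have -> : M * expR (- (k%:R * eta)) * (2 * pi) =
     \int[leb]_(t in `[- pi, pi]) (M * expR (- (k%:R * eta))).
    rewrite Rintegral_cst //= lebesgue_measure_itv /= lte_fin ifT; last by lra.
    by rewrite /= opprK; congr (_ * _); ring.
  apply: le_Rintegral => //.
  - by apply: integrable_cc; apply: continuous_subspaceT => t; apply: cvg_norm; exact: cb.
  - by apply: integrable_cc; apply: continuous_subspaceT => t; exact: cvg_cst.
  move=> t _; apply: (le_trans (abs_Re_le _)).
  rewrite normcM kE normc_cexp /= mulrN ler_wpM2r ?expR_ge0 // fM //.
  exact: ccosh_ellipse hE heta hb.
have e2 : 2 * \int[leb]_(u in `[0, pi]) (complex.Re (f (cos u)%:C) * cos (k%:R * u)) =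
   \int[leb]_(t in `[- pi, pi]) complex.Re (K (- eta +i* t)) by rewrite -E2; exact/esym.
move: e1; rewrite -e2 normrM ger0_norm // => e1.
rewrite -(ler_pM2l (ltr0Sn R 1)); apply: (le_trans e1).
by rewrite le_eqVlt; apply/orP; left; apply/eqP; ring.
Qed.

End CoefficientDecay.

Section ComplexCoefficients.
Context {R : realType}.
Local Notation C := R[i].
Local Notation leb := (@lebesgue_measure R).
Implicit Types f g : R -> C.

Definition ccoef (k : nat) f : C :=
  rcoef k (fun t => complex.Re (f t)) +i* rcoef k (fun t => complex.Im (f t)).

Lemma cheb_coefE f k : wcont f -> cheb_coef f k = ccoef k f.
Proof.
move=> /wcontP[cr ci]; rewrite /cheb_coef /L2dot /Cint /ccoef -!weighted_coefE //.
by congr (_ +i* _); apply: eq_Rintegral => t _; rewrite ?cReM ?cImM ?cReM ?cImM /=; ring.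
Qed.

Lemma eq_ccoef k f g : (forall t, I11 t -> f t = g t) -> ccoef k f = ccoef k g.
Proof. by move=> fg; congr (_ +i* _); apply: eq_rcoef => t /fg ->. Qed.

Lemma sqr_ccoef k f : normc (ccoef k f) ^+ 2 =
  rcoef k (fun t => complex.Re (f t)) ^+ 2 + rcoef k (fun t => complex.Im (f t)) ^+ 2.
Proof. by rewrite sqr_normcE. Qed.

Lemma wcontD f g : wcont f -> wcont g -> wcont (fun t => f t + g t).
Proof.
move=> /wcontP[f1 f2] /wcontP[g1 g2]; apply/wcontP; split.
  by under eq_fun do rewrite cReD; exact: rcontD.
by under eq_fun do rewrite cImD; exact: rcontD.
Qed.

Lemma wcontM f g : wcont f -> wcont g -> wcont (fun t => f t * g t).
Proof.
move=> /wcontP[f1 f2] /wcontP[g1 g2]; apply/wcontP; split.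
  under eq_fun do rewrite cReM; apply: rcontD; first exact: rcontM.
  by apply: rcontN; exact: rcontM.
by under eq_fun do rewrite cImM; apply: rcontD; exact: rcontM.
Qed.

Lemma wcont_cst (c : C) : wcont (fun=> c).
Proof. by apply/wcontP; split; exact: rcont_cst. Qed.
Arguments wcont_cst c : clear implicits.

Lemma wcont_sum (I : Type) (r : seq I) (P : pred I) (F : I -> R -> C) :
  (forall i, wcont (F i)) -> wcont (fun t => \sum_(i <- r | P i) F i t).
Proof.
move=> cF; elim: r => [|i r IH].
  by under eq_fun do rewrite big_nil; exact: wcont_cst.
under eq_fun do rewrite big_cons.
case: (P i); last exact: IH.
exact: (wcontD (cF i) IH).
Qed.

Lemma wcont_prod (I : Type) (r : seq I) (P : pred I) (F : I -> R -> C) :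
  (forall i, wcont (F i)) -> wcont (fun t => \prod_(i <- r | P i) F i t).
Proof.
move=> cF; elim: r => [|i r IH].
  by under eq_fun do rewrite big_nil; exact: wcont_cst.
under eq_fun do rewrite big_cons.
case: (P i); last exact: IH.
exact: (wcontM (cF i) IH).
Qed.

Lemma wcont_real (u : R -> R) : rcont u -> wcont (fun t => (u t)%:C).
Proof. by move=> cu; apply/wcontP; split => //=; exact: rcont_cst. Qed.

Lemma wcont_horner (p : {poly C}) : wcont (fun t => p.[t%:C]).
Proof.
elim/poly_ind : p => [|p c IH].
  by under eq_fun do rewrite horner0; exact: wcont_cst.
under eq_fun do rewrite hornerMXaddC.
apply: wcontD; last exact: wcont_cst.
by apply: wcontM => //; apply: wcont_real; apply: rcontT => t; exact: cvg_id.
Qed.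

Lemma ccoefD k f g : wcont f -> wcont g ->
  ccoef k (fun t => f t + g t) = ccoef k f + ccoef k g.
Proof.
move=> /wcontP[f1 f2] /wcontP[g1 g2]; apply: complex_ext; rewrite ?cE /= -rcoefD //.
  by congr rcoef; apply/funext => t; rewrite cReD.
by congr rcoef; apply/funext => t; rewrite cImD.
Qed.

Lemma ccoefZ k c f : wcont f -> ccoef k (fun t => c * f t) = c * ccoef k f.
Proof.
move=> /wcontP[f1 f2]; apply: complex_ext.
  rewrite cReM /= -rcoefZ // -mulNr -rcoefZ // -rcoefD.
  - by congr rcoef; apply/funext => t; rewrite cReM mulNr.
  - by apply: rcontM => //; exact: rcont_cst.
  - by apply: rcontM => //; exact: rcont_cst.
rewrite cImM /= -rcoefZ // -rcoefZ // -rcoefD.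
- by congr rcoef; apply/funext => t; rewrite cImM.
- by apply: rcontM => //; exact: rcont_cst.
- by apply: rcontM => //; exact: rcont_cst.
Qed.

Lemma ccoef_sum k (I : Type) (r : seq I) (P : pred I) (F : I -> R -> C) :
  (forall i, wcont (F i)) ->
  ccoef k (fun t => \sum_(i <- r | P i) F i t) = \sum_(i <- r | P i) ccoef k (F i).
Proof.
move=> cF; elim: r => [|i r IH].
  rewrite big_nil (_ : (fun t => _) = (fun t => 0 * 0)); last first.
    by apply/funext => t; rewrite big_nil mulr0.
  by rewrite (ccoefZ k 0 (wcont_cst 0)) mul0r.
rewrite big_cons -IH; under eq_fun do rewrite big_cons.
case: (P i); last by [].
by rewrite (ccoefD _ (cF i) (@wcont_sum _ r P F cF)).
Qed.

Lemma ccoef_chebp j k (c : C) :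
  ccoef k (fun t => c * (chebp C j).[t%:C]) = if j == k then c / (chebk k)%:C else 0.
Proof.
have E : (fun t : R => (chebp C j).[t%:C]) = (fun t => ((chebp R j).[t])%:C).
  by apply/funext => t; rewrite chebp_horner_complex.
rewrite ccoefZ; last exact: wcont_horner.
have -> : ccoef k (fun t => (chebp C j).[t%:C]) = if j == k then (chebk k)^-1%:C else 0.
  have r1 := rcoef_chebp j k 1; have r0 := rcoef_chebp j k 0.
  rewrite E /ccoef /=.
  have -> : (fun t : R => (chebp R j).[t]) = (fun t => 1 * (chebp R j).[t]).
    by apply/funext => t; rewrite mul1r.
  have -> : (fun t : R => 0) = (fun t => 0 * (chebp R j).[t]).
    by apply/funext => t; rewrite mul0r.
  by rewrite r1 r0; case: eqP => _; rewrite ?mul0r ?div1r.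
by case: eqP => _; rewrite ?mulr0 // fmorphV.
Qed.

(** The bound for real parts suffices, because the imaginary part of f is the real
    part of - i f. *)
Lemma ccoef_decay (S s eta M : R) (f : C -> C) (k : nat) :
  ellipse_axes S s -> expR eta = S + s -> 0 <= eta ->
  (forall z, ellipse S s z -> holo_at f z) ->
  (forall z, ellipse S s z -> normc (f z) <= M) ->
  normc (ccoef k (fun t => f t%:C)) ^+ 2 <= 4 * pi * M ^+ 2 * expR (- (k%:R * eta)) ^+ 2.
Proof.
move=> hE heta eta0 hf fM.
have p0 := @pi_gt0 R.
have B (g : C -> C) : (forall z, ellipse S s z -> holo_at g z) ->
  (forall z, ellipse S s z -> normc (g z) <= M) ->
  rcoef k (fun t => complex.Re (g t%:C)) ^+ 2 <= 2 * pi * M ^+ 2 * expR (- (k%:R * eta)) ^+ 2.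
  move=> hg gM; have := cosine_integral_bound hE heta eta0 hg gM k.
  rewrite /rcoef exprMn sqr_chebk; set J := \int[_]_(_ in _) _ => hJ.
  have M0 : 0 <= M.
    apply: le_trans (gM (ccosh (0 +i* 0)) _); first exact: normc_ge0.
    by apply: (ccosh_ellipse _ hE heta); rewrite oppr_le0 eta0 lexx.
  have J2 : J ^+ 2 <= (pi * M * expR (- (k%:R * eta))) ^+ 2.
    by rewrite -real_normK ?num_real // lerXn2r ?nnegrE // !mulr_ge0 ?expR_ge0 // ltW.
  apply: (@le_trans _ _ (2 / pi * (pi * M * expR (- (k%:R * eta))) ^+ 2)).
    rewrite ler_pM ?sqr_ge0 ?divr_ge0 ?(ltW p0) //; first by case: ifP.
    by rewrite ler_pM2r ?invr_gt0 //; case: ifP => // _; rewrite ler1n.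
  have E (p m y : R) : 0 < p -> 2 / p * (p * m * y) ^+ 2 = 2 * p * m ^+ 2 * y ^+ 2.
    by move=> q; field; exact: lt0r_neq0.
  by rewrite E.
rewrite sqr_ccoef.
have h1 := B f hf fM.
have ni : normc (0 -i* 1 : C) = 1 by rewrite /= expr0n /= add0r sqrrN expr1n sqrtr1.
have h2 : rcoef k (fun t => complex.Re ((0 -i* 1) * f t%:C)) ^+ 2 <=
    2 * pi * M ^+ 2 * expR (- (k%:R * eta)) ^+ 2.
  apply: (B (fun z => (0 -i* 1) * f z)) => z ez; first by apply: holo_at_mull; exact: hf.
  by rewrite normcM ni mul1r fM.
have h3 : rcoef k (fun t => complex.Im (f t%:C)) =
    rcoef k (fun t => complex.Re ((0 -i* 1) * f t%:C)).
  by congr rcoef; apply/funext => t; rewrite cReM /= mul0r sub0r mulN1r opprK.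
rewrite h3; lra.
Qed.

End ComplexCoefficients.

(** * Sequences of coefficients *)

Section SquareSummable.
Context {R : realType} (d : nat).
Local Notation C := R[i].
Implicit Types (v w : 'cV[C]_d) (a b : nat -> 'cV[C]_d).

Lemma vnorm_ge0 v : 0 <= vnorm v.
Proof. exact: sqrtr_ge0. Qed.

Lemma sqr_vnorm v : vnorm v ^+ 2 = \sum_(s < d) normc (v s 0) ^+ 2.
Proof. by rewrite sqr_sqrtr // sumr_ge0 // => s _; exact: sqr_ge0. Qed.

Lemma vnormZ (c : C) v : vnorm (c *: v) = normc c * vnorm v.
Proof.
apply/eqP; rewrite -(@eqrXn2 _ 2) ?mulr_ge0 ?vnorm_ge0 ?normc_ge0 //.
rewrite exprMn !sqr_vnorm mulr_sumr; apply/eqP; apply: eq_bigr => s _.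
by rewrite mxE normcM exprMn.
Qed.

Lemma vnorm0 : vnorm (0 : 'cV[C]_d) = 0.
Proof. by rewrite -(scale0r (0 : 'cV[C]_d)) vnormZ normc0 mul0r. Qed.

Lemma vnormN v : vnorm (- v) = vnorm v.
Proof. by rewrite -scaleN1r vnormZ normcN normc1 mul1r. Qed.

Lemma normc_le_vnorm v s : normc (v s 0) <= vnorm v.
Proof.
rewrite -(@ler_pXn2r _ 2) ?nnegrE ?vnorm_ge0 ?normc_ge0 // sqr_vnorm.
by rewrite (bigD1 s) //= lerDl sumr_ge0 // => i _; exact: sqr_ge0.
Qed.

Lemma vnorm_delta (s : 'I_d) : vnorm (delta_mx s 0 : 'cV[C]_d) = 1.
Proof.
apply/eqP; rewrite -(@eqrXn2 _ 2) ?vnorm_ge0 // sqr_vnorm expr1n (bigD1 s) //=.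
rewrite mxE !eqxx normc1 expr1n big1 ?addr0 // => r rs.
by rewrite mxE (negPf rs) normc0 expr0n.
Qed.

Lemma vnorm_eq0 v : vnorm v = 0 -> v = 0.
Proof.
move=> v0; apply/colP => s; rewrite mxE; apply: eq0_normc; apply/eqP.
by rewrite eq_le normc_ge0 andbT -v0 normc_le_vnorm.
Qed.

Lemma sum_sqr_triangle (I : Type) (r : seq I) (x y : I -> R) (A B : R) :
  0 <= A -> 0 <= B -> (forall i, 0 <= x i) -> (forall i, 0 <= y i) ->
  \sum_(i <- r) x i ^+ 2 <= A ^+ 2 -> \sum_(i <- r) y i ^+ 2 <= B ^+ 2 ->
  \sum_(i <- r) (x i + y i) ^+ 2 <= (A + B) ^+ 2.
Proof.
move=> A0 B0 x0 y0 hx hy.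
have xy : \sum_(i <- r) x i * y i <= A * B.
  rewrite -(@ler_pXn2r _ 2) ?nnegrE ?mulr_ge0 ?sumr_ge0 //; last by move=> i _; rewrite mulr_ge0.
  rewrite (le_trans (sum_cauchy_schwarz _ _ _ _)) // exprMn ler_pM ?sumr_ge0 //.
  - by move=> i _; exact: sqr_ge0.
  - by move=> i _; exact: sqr_ge0.
have -> : \sum_(i <- r) (x i + y i) ^+ 2 =
  \sum_(i <- r) x i ^+ 2 + (2 * \sum_(i <- r) x i * y i + \sum_(i <- r) y i ^+ 2).
  by rewrite mulr_sumr -!big_split /=; apply: eq_bigr => i _; ring.
lra.
Qed.

Lemma vnormD v w : vnorm (v + w) <= vnorm v + vnorm w.
Proof.
rewrite -(@ler_pXn2r _ 2) ?nnegrE ?addr_ge0 ?vnorm_ge0 // sqr_vnorm.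
apply: (@le_trans _ _ (\sum_(s < d) (normc (v s 0) + normc (w s 0)) ^+ 2)).
  apply: ler_sum => s _; rewrite mxE lerXn2r ?nnegrE ?addr_ge0 ?normc_ge0 //.
  exact: le_normcD.
apply: sum_sqr_triangle; rewrite ?vnorm_ge0 ?sqr_vnorm // => s; exact: normc_ge0.
Qed.

(** All norm estimates are expressed by upper bounds on partial sums; this
    avoids arithmetic with infinite values. *)
Definition l2le a (c : R) : Prop :=
  0 <= c /\ forall n, \sum_(j < n) vnorm (a j) ^+ 2 <= c ^+ 2.

Lemma l2norm_ge0 a : (0 <= l2norm a)%E.
Proof. exact: sqrte_ge0. Qed.

Lemma l2leP a c : 0 <= c -> (l2norm a <= c%:E)%E <-> l2le a c.
Proof.
move=> c0.
have -> : (c%:E = sqrte (c ^+ 2)%:E)%E by rewrite /= sqrtr_sqr ger0_norm.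
rewrite /l2norm lee_sqrt ?lee_fin ?sqr_ge0 //.
have u0 (n : nat) : (0%N <= n)%N -> xpredT n -> (0 <= (vnorm (a n) ^+ 2)%:E)%E.
  by move=> _ _; rewrite lee_fin sqr_ge0.
split=> [h|[_ h]].
  split => // n; rewrite -lee_fin; apply: le_trans h.
  apply: le_trans (nneseries_lim_ge n u0).
  by rewrite sumEFin big_mkord.
apply: lime_le; first exact: is_cvg_nneseries.
apply: nearW => n; rewrite sumEFin lee_fin big_mkord; exact: h.
Qed.

Lemma l2_fin a : l2 a -> exists c, l2norm a = c%:E /\ 0 <= c.
Proof.
rewrite /l2 /=; have := l2norm_ge0 a; case: (l2norm a) => // c c0 _.
by exists c.
Qed.

Lemma l2le_l2 a c : l2le a c -> l2 a.
Proof.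
move=> h; rewrite /l2 /=; apply: (@le_lt_trans _ _ c%:E); last exact: ltry.
by apply/l2leP => //; case: h.
Qed.

Lemma l2le_norm a c : l2norm a = c%:E -> l2le a c.
Proof. by move=> e; apply/l2leP; rewrite ?e // -lee_fin -e l2norm_ge0. Qed.

Lemma l2le_scale a b c (K : R) : 0 <= K ->
  (forall j, vnorm (b j) <= K * vnorm (a j)) -> l2le a c -> l2le b (K * c).
Proof.
move=> K0 ab [c0 h]; split=> [|n]; first exact: mulr_ge0.
rewrite exprMn; apply: le_trans (ler_wpM2l (sqr_ge0 _) (h n)).
rewrite mulr_sumr ler_sum // => j _.
by rewrite -exprMn lerXn2r ?nnegrE ?mulr_ge0 ?vnorm_ge0.
Qed.

Lemma l2leZ a c (z : C) : l2le a c -> l2le (fun j => z *: a j) (normc z * c).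
Proof. by apply: l2le_scale => [|j]; rewrite ?normc_ge0 // vnormZ. Qed.

Lemma l2leD a b c e : l2le a c -> l2le b e -> l2le (fun j => a j + b j) (c + e).
Proof.
move=> [c0 ha] [e0 hb]; split=> [|n]; first exact: addr_ge0.
apply: (@le_trans _ _ (\sum_(j < n) (vnorm (a j) + vnorm (b j)) ^+ 2)).
  by rewrite ler_sum // => j _; rewrite lerXn2r ?nnegrE ?addr_ge0 ?vnorm_ge0 // vnormD.
by apply: sum_sqr_triangle => // j; exact: vnorm_ge0.
Qed.

Lemma l2leN a c : l2le a c -> l2le (fun j => - a j) c.
Proof.
by move=> h; rewrite -[c]mul1r; apply: l2le_scale h => // j; rewrite mul1r vnormN.
Qed.

Lemma l2leB a b c e : l2le a c -> l2le b e -> l2le (fun j => a j - b j) (c + e).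
Proof. by move=> ha /l2leN hb; exact: (l2leD ha hb). Qed.

Lemma l2le0 : l2le (fun=> 0) 0.
Proof.
split => // n; rewrite big1 ?expr0n // => j _.
by rewrite vnorm0 expr0n.
Qed.

Lemma l2le_weaken a c e : c <= e -> l2le a c -> l2le a e.
Proof.
move=> ce [c0 h]; split=> [|n]; first exact: le_trans ce.
by apply: (le_trans (h n)); rewrite lerXn2r ?nnegrE // (le_trans c0).
Qed.

Lemma l2le_sum (I : Type) (r : seq I) (F : I -> nat -> 'cV[C]_d) (c : I -> R) :
  (forall i, l2le (F i) (c i)) ->
  l2le (fun j => \sum_(i <- r) F i j) (\sum_(i <- r) c i).
Proof.
move=> h; elim: r => [|i r IH].
  by rewrite big_nil; under eq_fun do rewrite big_nil; exact: l2le0.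
by rewrite big_cons; under eq_fun do rewrite big_cons; exact: l2leD.
Qed.

Lemma l2le_entry a c j : l2le a c -> vnorm (a j) <= c.
Proof.
move=> [c0 /(_ j.+1)]; rewrite big_ord_recr /= => h.
rewrite -(@ler_pXn2r _ 2) ?nnegrE ?vnorm_ge0 //; apply: le_trans h.
by rewrite lerDr sumr_ge0 // => i _; exact: sqr_ge0.
Qed.

Lemma l2le_eq0 a : l2le a 0 -> forall j, a j = 0.
Proof.
move=> h j; apply: vnorm_eq0; apply/eqP.
by rewrite eq_le vnorm_ge0 andbT; exact: l2le_entry h.
Qed.

End SquareSummable.

Section SobolevCoefficients.
Context {R : realType} (d : nat).
Local Notation C := R[i].
Implicit Types f g : R -> 'cV[C]_d.

Definition vcont f : Prop := forall s, wcont (component f s).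

(** Coordinates in the orthonormal basis of the Sobolev space. *)
Definition hcoef f (j : nat) : 'cV[C]_d :=
  \col_s ((j.+1%:R)%:C * ccoef j (component f s)).

Lemma H1normE f : vcont f -> H1norm f = l2norm (hcoef f).
Proof.
move=> cf; rewrite /H1norm /l2norm; congr sqrte; rewrite /H1sqnorm.
rewrite -nneseries_sum; last by move=> s j _; rewrite lee_fin mulr_ge0 ?sqr_ge0.
apply: eq_eseriesr => j _; rewrite sumEFin sqr_vnorm; congr EFin.
apply: eq_bigr => s _; rewrite mxE cheb_coefE // normcM exprMn normcR.
by rewrite ger0_norm.
Qed.

Lemma hcoefD f g j : vcont f -> vcont g ->
  hcoef (fun t => f t + g t) j = hcoef f j + hcoef g j.
Proof.
move=> cf cg; apply/colP => s; rewrite !mxE -mulrDr; congr (_ * _).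
rewrite -ccoefD //; congr ccoef; apply/funext => t; by rewrite /component mxE.
Qed.

Lemma hcoefZ f (c : C) j : vcont f -> hcoef (fun t => c *: f t) j = c *: hcoef f j.
Proof.
move=> cf; apply/colP => s; rewrite !mxE mulrCA; congr (_ * _).
rewrite -ccoefZ //; congr ccoef; apply/funext => t; by rewrite /component mxE.
Qed.

Lemma vcontD f g : vcont f -> vcont g -> vcont (fun t => f t + g t).
Proof.
move=> cf cg s; rewrite (_ : component _ s = (fun t => component f s t + component g s t)).
  exact: wcontD.
by apply/funext => t; rewrite /component mxE.
Qed.

Lemma vcontZ f (c : C) : vcont f -> vcont (fun t => c *: f t).
Proof.
move=> cf s; rewrite (_ : component _ s = (fun t => c * component f s t)).
  by apply: wcontM => //; exact: wcont_cst.
by apply/funext => t; rewrite /component mxE.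
Qed.

Lemma vcontB f g : vcont f -> vcont g -> vcont (fun t => f t - g t).
Proof.
move=> cf cg; have -> : (fun t => f t - g t) = (fun t => f t + (-1) *: g t).
  by apply/funext => t; rewrite scaleN1r.
exact: (vcontD cf (@vcontZ g (-1) cg)).
Qed.

Lemma hcoefB f g j : vcont f -> vcont g ->
  hcoef (fun t => f t - g t) j = hcoef f j - hcoef g j.
Proof.
move=> cf cg; have -> : (fun t => f t - g t) = (fun t => f t + (-1) *: g t).
  by apply/funext => t; rewrite scaleN1r.
by rewrite (hcoefD _ cf (@vcontZ g (-1) cg)) (hcoefZ _ _ cg) scaleN1r.
Qed.

Lemma vcont_cst (v : 'cV[C]_d) : vcont (fun=> v).
Proof. by move=> s; exact: wcont_cst. Qed.

Lemma hcoef0 j : hcoef (fun=> 0) j = 0.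
Proof.
by have /= := hcoefZ 0 j (@vcont_cst 0); rewrite !scale0r.
Qed.

Lemma vcont_sum (I : Type) (r : seq I) (F : I -> R -> 'cV[C]_d) :
  (forall i, vcont (F i)) -> vcont (fun t => \sum_(i <- r) F i t).
Proof.
move=> cF; elim: r => [|i r IH].
  by under eq_fun do rewrite big_nil; exact: vcont_cst.
by under eq_fun do rewrite big_cons; exact: (vcontD (cF i) IH).
Qed.

Lemma hcoef_sum (I : Type) (r : seq I) (F : I -> R -> 'cV[C]_d) j :
  (forall i, vcont (F i)) ->
  hcoef (fun t => \sum_(i <- r) F i t) j = \sum_(i <- r) hcoef (F i) j.
Proof.
move=> cF; elim: r => [|i r IH].
  by rewrite big_nil; under eq_fun do rewrite big_nil; exact: hcoef0.
rewrite big_cons -IH; under eq_fun do rewrite big_cons.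
by rewrite (hcoefD _ (cF i) (@vcont_sum _ r F cF)).
Qed.

Lemma eq_hcoef f g j : (forall t, I11 t -> f t = g t) -> hcoef f j = hcoef g j.
Proof.
move=> fg; apply/colP => s; rewrite !mxE; congr (_ * _).
by apply: eq_ccoef => t /fg; rewrite /component => ->.
Qed.

Lemma H1v_vcont f : H1v f -> vcont f.
Proof. by move=> hf s; case: (hf s). Qed.

Lemma eq_wcont (u v : R -> C) : (forall t, I11 t -> u t = v t) -> wcont u -> wcont v.
Proof.
move=> uv /subspace_continuousP cu; apply/subspace_continuousP => t It.
have := cu t It; have -> : from_subspace I11 u t = v t by exact: uv.
apply: cvg_trans; apply: near_eq_cvg; near=> x; have xI : I11 x by near: x; exact: withinT.
  by first [exact: uv|exact: esym (uv _ xI)].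
Unshelve. all: by end_near. Qed.

Lemma eq_vcont f g : (forall t, I11 t -> f t = g t) -> vcont f -> vcont g.
Proof. by move=> fg cf s; apply: eq_wcont (cf s) => t /fg; rewrite /component => ->. Qed.

(** For a continuous function the weighted square integral is finite, so that the
    coefficients alone decide membership. *)
Lemma H1vP f (c : R) : vcont f -> l2le (hcoef f) c -> H1v f.
Proof.
move=> cf hc s; have cs := cf s; have /wcontP[c1 c2] := cs.
have mI : measurable (@I11 R : set (measurableTypeR R)) by exact: measurable_itv.
split => //.
  split.
  - exact: subspace_continuous_measurable_fun.
  - exact: subspace_continuous_measurable_fun.
  - have r : rcont (fun t => complex.Re (component f s t) ^+ 2 + complex.Im (component f s t) ^+ 2).
      by apply: rcontD; under eq_fun do rewrite expr2; exact: rcontM.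
    have /integrableP[_] := integrable_weighted r.
    apply: le_lt_trans; rewrite le_eqVlt; apply/orP; left; apply/eqP.
    apply: eq_integral => t _; rewrite /= ger0_norm ?sqr_normcE //.
    by rewrite mulr_ge0 ?addr_ge0 ?sqr_ge0 // invr_ge0 sqrtr_ge0.
have H : (H1norm f < +oo)%E by rewrite H1normE //; exact: l2le_l2 hc.
have /le_lt_trans : (H1sqnorm (component f s) <= \sum_(r < d) H1sqnorm (component f r))%E.
  rewrite (bigD1 s) //= leeDl // sume_ge0 // => r _.
  by apply: nneseries_ge0 => j _ _; rewrite lee_fin mulr_ge0 ?sqr_ge0.
apply; move: H; rewrite /H1norm; case: (\sum_(_ < _) _)%E => [x|//|//] _.
exact: ltry.
Qed.

Lemma chebH1_polyE k (s : 'I_d) (t : R) : I11 t ->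
  chebH1v k s t = ((chebk k / k.+1%:R)%:C * (chebp C k).[t%:C]) *: delta_mx s 0.
Proof.
move=> It; rewrite /chebH1v /chebH1 chebL2E // chebp_horner_complex -rmorphM /=.
by congr (_%:C *: _); ring.
Qed.

Lemma vcont_chebH1v k (s : 'I_d) : vcont (chebH1v k s).
Proof.
apply: (@eq_vcont (fun t => ((chebk k / k.+1%:R)%:C * (chebp C k).[t%:C]) *: delta_mx s 0)).
  by move=> t It; rewrite chebH1_polyE.
move=> r; rewrite (_ : component _ r = (fun t => ((chebk k / k.+1%:R)%:C *
    (delta_mx s 0 : 'cV[C]_d) r 0) * (chebp C k).[t%:C])).
  by apply: wcontM; [exact: wcont_cst|exact: wcont_horner].
by apply/funext => t; rewrite /component mxE mulrAC.
Qed.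

Lemma hcoef_chebH1v k (s : 'I_d) j :
  hcoef (chebH1v k s) j = if j == k then delta_mx s 0 else 0.
Proof.
apply/colP => r; rewrite mxE.
rewrite (_ : ccoef j _ = ccoef j (fun t => ((chebk k / k.+1%:R)%:C *
    (delta_mx s 0 : 'cV[C]_d) r 0) * (chebp C k).[t%:C])); last first.
  by apply: eq_ccoef => t It; rewrite /component chebH1_polyE // mxE mulrAC.
rewrite ccoef_chebp eq_sym; case: eqP => [->|_]; last by rewrite mulr0 mxE.
rewrite mulrAC mulrA -!fmorphV -!rmorphM /=.
have -> : k.+1%:R * (chebk k / k.+1%:R / chebk k) = 1 :> R.
  rewrite mulrA [_ * (chebk k / _)]mulrCA divff ?pnatr_eq0 // mulr1 divff //.
  by rewrite gt_eqF // chebk_gt0.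
by rewrite mul1r.
Qed.

End SobolevCoefficients.

(** * Interpolation and the eigenvector operator *)

Section PolynomialSpace.
Context {R : realType} (d N : nat).
Local Notation C := R[i].
Local Notation l := (colloc_size d N).

Lemma vcont_poly_fun (p : 'cV[{poly C}]_d) : vcont (poly_fun p).
Proof.
move=> s; rewrite (_ : component _ s = (fun t => (p s 0).[t%:C])); first exact: wcont_horner.
by apply/funext => t; rewrite /component mxE.
Qed.

Lemma hcoef_poly_high (p : 'cV[{poly C}]_d) j :
  poly_space N p -> (N < j)%N -> hcoef (poly_fun p) j = 0.
Proof.
move=> hp Nj; apply/colP => s; rewrite !mxE.
have [c pE] := chebp_span (hp s).
rewrite (_ : component _ s = (fun t => \sum_(k < N.+1) c k * (chebp C k).[t%:C])); last first.
  apply/funext => t; rewrite /component mxE {1}pE horner_sum.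
  by apply: eq_bigr => k _; rewrite hornerZ.
rewrite ccoef_sum; last by move=> k; apply: wcontM; [exact: wcont_cst|exact: wcont_horner].
rewrite big1 ?mulr0 // => k _; rewrite ccoef_chebp ifN //.
by rewrite neq_ltn (leq_trans (ltn_ord k)).
Qed.

Lemma poly_fun_interp (v : 'cV[C]_l) (t : R) (s : 'I_d) :
  poly_fun (interpN v) t s 0 = \sum_(i < N.+1) (lagr i : {poly C}).[t%:C] * submxcol v i s 0.
Proof.
rewrite !mxE horner_sum; apply: eq_bigr => i _.
by rewrite hornerZ mulrC.
Qed.

(** The coordinates of the interpolating polynomial, as a linear function of the
    values at the nodes. *)
Definition interp_coef (v : 'cV[C]_l) (j : nat) : 'cV[C]_d := hcoef (poly_fun (interpN v)) j.

Lemma interp_coefD v w j : interp_coef (v + w) j = interp_coef v j + interp_coef w j.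
Proof.
rewrite /interp_coef -hcoefD; try exact: vcont_poly_fun.
congr hcoef; apply/funext => t; apply/colP => s.
rewrite [RHS]mxE !poly_fun_interp -big_split; apply: eq_bigr => i _.
by rewrite submxcolD mxE mulrDr.
Qed.

Lemma interp_coefZ c v j : interp_coef (c *: v) j = c *: interp_coef v j.
Proof.
rewrite /interp_coef -hcoefZ; last exact: vcont_poly_fun.
congr hcoef; apply/funext => t; apply/colP => s.
rewrite [RHS]mxE !poly_fun_interp mulr_sumr; apply: eq_bigr => i _.
by rewrite !mxE mulrCA.
Qed.

Lemma interp_coef_sum (I : Type) (r : seq I) (F : I -> 'cV[C]_l) j :
  interp_coef (\sum_(i <- r) F i) j = \sum_(i <- r) interp_coef (F i) j.
Proof.
elim: r => [|i r IH].
  by rewrite !big_nil -(scale0r (0 : 'cV[C]_l)) interp_coefZ scale0r.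
by rewrite !big_cons interp_coefD IH.
Qed.

Lemma interp_coef_eval (p : 'cV[{poly C}]_d) j : poly_space N p ->
  interp_coef (evalN N p) j = hcoef (poly_fun p) j.
Proof. by move=> hp; rewrite /interp_coef evalNK. Qed.

Lemma sum_Rank (V : nmodType) (F : 'I_l -> V) :
  \sum_k F k = \sum_(i < N.+1) \sum_(s < d) F (tagnat.Rank i s).
Proof.
rewrite sig_big_dep /= (reindex _ tagnat.sig_bij_on) /=.
by apply: eq_bigr => k _; rewrite tagnat.sig2K.
Qed.

Lemma mulmx_sum_col (V : 'M[C]_l) (c : 'cV[C]_l) : V *m c = \sum_k c k 0 *: col k V.
Proof.
apply/colP => i; rewrite mxE summxE; apply: eq_bigr => k _.
by rewrite !mxE mulrC.
Qed.

(** A vector of coordinates, seen as a finitely supported sequence. *)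
Definition seqof (c : 'cV[C]_l) (j : nat) : 'cV[C]_d :=
  if (j <= N)%N then submxcol c (inord j) else 0.

Lemma seqof_ord (c : 'cV[C]_l) (i : 'I_N.+1) (s : 'I_d) :
  seqof c i s 0 = c (tagnat.Rank i s) 0.
Proof. by rewrite /seqof -ltnS ltn_ord inord_val mxE. Qed.

Lemma l2le_seqof c : exists e, l2le (seqof c) e.
Proof.
exists (Num.sqrt (\sum_(j < N.+1) vnorm (seqof c j) ^+ 2)); split=> [|n].
  exact: sqrtr_ge0.
rewrite sqr_sqrtr; last by rewrite sumr_ge0 // => j _; exact: sqr_ge0.
have [nN|Nn] := leqP n N.+1.
  rewrite (big_ord_widen _ (fun j => vnorm (seqof c j) ^+ 2) nN).
  rewrite [leRHS](bigID (fun j : 'I_N.+1 => (j < n)%N)) /= lerDl.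
  by rewrite sumr_ge0 // => j _; exact: sqr_ge0.
rewrite (big_ord_widen _ (fun j => vnorm (seqof c j) ^+ 2) (ltnW Nn)).
rewrite (bigID (fun j : 'I_n => (j < N.+1)%N)) /= [X in _ + X]big1 ?addr0 // => j.
by rewrite ltnS => /negbTE jN; rewrite /seqof jN vnorm0 expr0n.
Qed.

(** ** The synthesis operator on coefficients *)

(** The operator formed with the eigenvectors, in coordinates; [hcoef_Vhat] makes
    the connection. *)
Definition synth (V : 'M[C]_l) (a : nat -> 'cV[C]_d) (j : nat) : 'cV[C]_d :=
  \sum_(i < N.+1) \sum_(s < d) a i s 0 *: interp_coef (col (tagnat.Rank i s) V) j +
  (if (N < j)%N then a j else 0).

Lemma synthD V a b j : synth V (fun i => a i + b i) j = synth V a j + synth V b j.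
Proof.
rewrite /synth addrACA; congr (_ + _); last by case: ifP; rewrite ?addr0.
rewrite -big_split; apply: eq_bigr => i _; rewrite -big_split; apply: eq_bigr => s _.
by rewrite mxE scalerDl.
Qed.

Lemma synthZ V a c j : synth V (fun i => c *: a i) j = c *: synth V a j.
Proof.
rewrite /synth scalerDr; congr (_ + _); last by case: ifP; rewrite ?scaler0.
rewrite scaler_sumr; apply: eq_bigr => i _; rewrite scaler_sumr; apply: eq_bigr => s _.
by rewrite mxE scalerA.
Qed.

Lemma synth_seqof V c j : synth V (seqof c) j = interp_coef (V *m c) j.
Proof.
rewrite /synth /seqof [X in _ + X](_ : _ = 0) ?addr0; last first.
  by case: ifP => //; rewrite ltnNge => /negbTE ->.
rewrite mulmx_sum_col interp_coef_sum sum_Rank.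
apply: eq_bigr => i _; apply: eq_bigr => s _.
by rewrite interp_coefZ -/(seqof c i) seqof_ord.
Qed.

Lemma delta_sum (v : 'cV[C]_d) : \sum_(s < d) v s 0 *: (delta_mx s 0 : 'cV[C]_d) = v.
Proof.
rewrite [RHS]matrix_sum_delta; apply: eq_bigr => s _.
by rewrite big_ord1.
Qed.

Lemma vcont_partial V a n : vcont (@Vhat_partial R d N V a n).
Proof.
apply: vcontD; apply: vcont_sum => i; apply: vcont_sum => s; apply: vcontZ.
  exact: vcont_poly_fun.
exact: vcont_chebH1v.
Qed.

Lemma hcoef_partial V a n j : (j < n)%N -> hcoef (@Vhat_partial R d N V a n) j = synth V a j.
Proof.
move=> jn.
pose p i s : R -> 'cV[C]_d := poly_fun (interpN (col (tagnat.Rank i s) V)).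
have c1 (i : 'I_N.+1) (s : 'I_d) : vcont (fun t => a i s 0 *: p i s t).
  by apply: vcontZ; exact: vcont_poly_fun.
have c2 (i : nat) (s : 'I_d) : vcont (fun t => a i s 0 *: chebH1v i s t).
  by apply: vcontZ; exact: vcont_chebH1v.
have c1' (i : 'I_N.+1) : vcont (fun t => \sum_s a i s 0 *: p i s t).
  by apply: vcont_sum => s; exact: c1.
have c2' (i : nat) : vcont (fun t => \sum_s a i s 0 *: (chebH1v i s t : 'cV[C]_d)).
  by apply: vcont_sum => s; exact: c2.
rewrite /Vhat_partial hcoefD; [|by apply: vcont_sum|by apply: vcont_sum].
rewrite /synth; congr (_ + _).
  rewrite hcoef_sum //; apply: eq_bigr => i _.
  rewrite hcoef_sum //; apply: eq_bigr => s _.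
  by rewrite hcoefZ //; exact: vcont_poly_fun.
rewrite hcoef_sum // -[RHS](_ : \sum_(N.+1 <= i < n | i == j) a i = _); last first.
  by rewrite big_nat1_eq jn andbT.
rewrite [RHS]big_mkcond; apply: eq_bigr => i _; rewrite hcoef_sum //.
under eq_bigr => s _.
  rewrite hcoefZ; last exact: vcont_chebH1v.
  rewrite hcoef_chebH1v eq_sym; over.
case: eqP => _; first exact: delta_sum.
by rewrite big1 // => s _; rewrite scaler0.
Qed.

(** Convergence in norm forces convergence of every coefficient. *)
Lemma hcoef_Vhat V Vh a j : is_Vhat V Vh -> l2 a -> hcoef (Vh a) j = @synth V a j.
Proof.
move=> hV al; have [H1 L] := hV a al.
have cV := H1v_vcont H1.
apply/eqP; rewrite -subr_eq0; apply/eqP; apply: vnorm_eq0; apply/eqP.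
rewrite eq_le vnorm_ge0 andbT; apply/ler_addgt0Pr => e e0; rewrite add0r.
have e0' : (0 < e%:E)%E by rewrite lte_fin.
have [n0 _ hn] : \forall n \near \oo, (H1norm (fun t => Vh a t - Vhat_partial V a n t)%R < e%:E)%E.
  by apply: (L [set y | (y < e%:E)%E]); apply: open_nbhs_nbhs; split => //;
      exact: open_ereal_lt_ereal.
have := hn (maxn n0 j.+1) (leq_maxl _ _); set n := maxn _ _ => /ltW.
rewrite /= H1normE; last exact: (vcontB cV (@vcont_partial V a n)).
move=> /(l2leP _ (ltW e0)) /(l2le_entry j).
rewrite (hcoefB _ cV (@vcont_partial V a n)).
by rewrite hcoef_partial // leq_maxr.
Qed.

(** ** The orthogonal projection *)

Lemma cvg_eventually_const (u : nat -> C) (c : C) n0 :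
  (forall n, (n0 <= n)%N -> u n = c) -> limn (u : nat -> C^o) = c.
Proof.
move=> h; apply: cvg_lim; first exact: norm_hausdorff.
apply/cvgCP => e e0; exists n0 => // n /= /h ->.
by rewrite subrr normc0.
Qed.

(** A basis function of degree at most N differs from its projection by a
    polynomial of the space, which is then orthogonal to itself. *)
Lemma hcoef_orth_proj (P : (R -> 'cV[C]_d) -> 'cV[{poly C}]_d) j (r : 'I_d) i :
  orth_proj N P -> (j <= N)%N ->
  poly_space N (P (chebH1v j r)) /\
  hcoef (poly_fun (P (chebH1v j r))) i = hcoef (chebH1v j r) i.
Proof.
move=> hP jN; set f := chebH1v j r.
have cf : vcont f by exact: vcont_chebH1v.
have hf : H1v f.
  apply: (@H1vP _ _ _ 1) => //; split => // n; rewrite expr1n.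
  rewrite (eq_bigr (fun k : 'I_n => if k == j :> nat then 1 else 0)) => [|k _].
    by rewrite -big_mkcond (big_ord1_eq _ (fun=> 1)); case: ifP.
  rewrite hcoef_chebH1v; case: eqP => _; first by rewrite vnorm_delta expr1n.
  by rewrite vnorm0 expr0n.
have [pP orth] := hP f hf; split => //.
pose p0 : 'cV[{poly C}]_d :=
  \col_s (((chebk j / j.+1%:R)%:C * (delta_mx r 0 : 'cV[C]_d) s 0) *: chebp C j).
pose q := p0 - P f.
have qP : poly_space N q.
  move=> s; rewrite mxE (leq_trans (size_polyD _ _)) // geq_max !mxE size_polyN pP andbT.
  by rewrite (leq_trans (size_scale_leq _ _)) // size_chebp.
have qE t : I11 t -> f t - poly_fun (P f) t = poly_fun q t.
  move=> It; apply/colP => s; rewrite /f chebH1_polyE // !mxE hornerD hornerN hornerZ.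
  by rewrite mulrAC.
have gE k : hcoef (fun t => f t - poly_fun (P f) t) k = hcoef (poly_fun q) k by exact: eq_hcoef.
suff h0 : hcoef (poly_fun q) i = 0.
  move: (gE i); rewrite h0 (hcoefB _ cf (@vcont_poly_fun (P f))).
  by move/eqP; rewrite subr_eq0 => /eqP.
have cq : vcont (poly_fun q) by exact: vcont_poly_fun.
have := orth q qP; rewrite /H1dot.
have T (s : 'I_d) : limn (series (fun k => k.+1%:R ^+ 2 *
    (conjc (cheb_coef (component (poly_fun q) s) k) *
     cheb_coef (component (fun t => f t - poly_fun (P f) t) s) k)) : nat -> C^o) =
   (\sum_(k < N.+1) normc (hcoef (poly_fun q) k s 0) ^+ 2)%:C.
  have E k : k.+1%:R ^+ 2 *
    (conjc (cheb_coef (component (poly_fun q) s) k) *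
     cheb_coef (component (fun t => f t - poly_fun (P f) t) s) k) =
     (normc (hcoef (poly_fun q) k s 0) ^+ 2)%:C.
    have cg : wcont (component (fun t => f t - poly_fun (P f) t) s).
      by apply: (vcontB cf (@vcont_poly_fun (P f))).
    rewrite (cheb_coefE _ (cq s)) (cheb_coefE _ cg).
    have -> : ccoef k (component (fun t => f t - poly_fun (P f) t) s) =
        ccoef k (component (poly_fun q) s).
      by apply: eq_ccoef => t It; rewrite /component qE.
    rewrite mxE normcM exprMn normcR ger0_norm // sqr_normcE.
    have -> : (k.+1%:R : C) = (k.+1%:R : R)%:C by rewrite rmorph_nat.
    case: (ccoef k _) => a b; apply: complex_ext; rewrite ?cE /=; ring.
  apply: (@cvg_eventually_const _ _ N.+1) => n Nn.
  rewrite seriesEord /=.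
  transitivity (\sum_(k < n) (normc (hcoef (poly_fun q) k s 0) ^+ 2)%:C).
    by apply: eq_bigr => k _; exact: E.
  rewrite -rmorph_sum /=; congr _%:C.
  rewrite (big_ord_widen _ (fun k => normc (hcoef (poly_fun q) k s 0) ^+ 2) Nn).
  rewrite (bigID (fun k : 'I_n => (k < N.+1)%N)) /= [X in _ + X]big1 ?addr0 // => k.
  by rewrite -leqNgt => kN; rewrite (hcoef_poly_high qP kN) mxE normc0 expr0n.
move=> S0; have {S0} : (\sum_(s < d) \sum_(k < N.+1) normc (hcoef (poly_fun q) k s 0) ^+ 2)%:C = 0
    :> C.
  by rewrite -[RHS]S0 rmorph_sum; apply: eq_bigr => s _; rewrite T.
move=> /(congr1 (@complex.Re R)) /= /eqP.
have [iN|Ni] := leqP i N; last by move=> _; exact: (hcoef_poly_high qP Ni).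
rewrite psumr_eq0; last by move=> s _; rewrite sumr_ge0 // => k _; exact: sqr_ge0.
move=> /allP H; apply/colP => s; rewrite [RHS]mxE.
have := H s (mem_index_enum s); rewrite /= psumr_eq0; last by move=> k _; exact: sqr_ge0.
have iN1 : (i < N.+1)%N by [].
move=> /allP /(_ (Ordinal iN1) (mem_index_enum _)) /=.
by rewrite sqrf_eq0 => /eqP /eq0_normc.
Qed.

End PolynomialSpace.

(** * Operator norms and the perturbation of eigenvalues *)

Section OperatorBounds.
Context {R : realType} (d N : nat).
Local Notation C := R[i].
Local Notation l := (colloc_size d N).
Implicit Types (a b c : nat -> 'cV[C]_d).

Lemma l2le_lim a (c : R) : 0 <= c -> (forall e, 0 < e -> l2le a (c + e)) -> l2le a c.
Proof.
move=> c0 h; split=> // n; set S := \sum_(j < n) _.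
have S0 : 0 <= S by rewrite sumr_ge0 // => j _; exact: sqr_ge0.
rewrite -[S]sqr_sqrtr // lerXn2r ?nnegrE ?sqrtr_ge0 //.
apply/ler_addgt0Pr => e e0; have [ce /(_ n)] := h e e0.
rewrite -/S => hS; rewrite -[leRHS]ger0_norm // -sqrtr_sqr ler_wsqrtr //.
Qed.

Lemma eq_l2le a b (c : R) : (forall j, a j = b j) -> l2le a c -> l2le b c.
Proof. by move=> /funext ->. Qed.

Lemma l2leZr a (c z : R) : 0 <= z -> l2le a c -> l2le (fun j => z%:C *: a j) (z * c).
Proof. by move=> z0 /(l2leZ z%:C); rewrite normcR ger0_norm. Qed.

Lemma l2le_scaled a (c z : R) : 0 < z -> l2le (fun j => z%:C *: a j) c -> l2le a (z^-1 * c).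
Proof.
move=> z0 h; have zi : 0 <= z^-1 by rewrite invr_ge0 ltW.
apply: (eq_l2le _ (l2leZr zi h)) => j.
by rewrite scalerA -rmorphM /= mulVf ?gt_eqF // scale1r.
Qed.

Lemma opnorm_ge (U W : Type) (X : set U) (nX : U -> \bar R) (nY : W -> \bar R)
  (T : U -> W) (M : R) f : opnorm X nX nY T = M%:E -> X f -> (nX f <= 1)%E -> (nY (T f) <= M%:E)%E.
Proof.
by move=> <- Xf f1; apply: ereal_sup_ubound; exists f.
Qed.

Variables (V : 'M[C]_l) (Vh : (nat -> 'cV[C]_d) -> (R -> 'cV[C]_d))
  (Vi : (R -> 'cV[C]_d) -> (nat -> 'cV[C]_d)).
Hypotheses (hVh : is_Vhat V Vh) (hVi : is_inverse Vh Vi).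

Lemma l2Z a (z : C) : l2 a -> l2 (fun j => z *: a j).
Proof. by move=> /l2_fin[c [/l2le_norm h _]]; exact: l2le_l2 (l2leZ z h). Qed.

Lemma H1norm_Vhat a : l2 a -> H1norm (Vh a) = l2norm (synth V a).
Proof.
move=> al; have [h _] := hVh al; rewrite H1normE; last exact: H1v_vcont.
by congr l2norm; apply/funext => j; exact: hcoef_Vhat.
Qed.

(** An operator norm is tested on the unit ball only; homogeneity extends the
    bound.  The relation allows the operator, its inverse and the monodromy
    operator to be treated alike. *)
Lemma homogeneous_bound (rel : (nat -> 'cV[C]_d) -> (nat -> 'cV[C]_d) -> Prop) (M : R) :
  (forall a b (z : R), 0 < z -> rel a b -> rel (fun j => z%:C *: a j) (fun j => z%:C *: b j)) ->
  (forall a b, rel a b -> l2le a 1 -> l2le b M) ->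
  forall a b (c : R), rel a b -> l2le a c -> l2le b (M * c).
Proof.
move=> hZ h1.
have P a b (e : R) : 0 < e -> rel a b -> l2le a e -> l2le b (M * e).
  move=> e0 ab h; have ei : 0 < e^-1 by rewrite invr_gt0.
  have a1 : l2le (fun j => (e^-1)%:C *: a j) 1.
    by have := l2leZr (ltW ei) h; rewrite mulVf // gt_eqF.
  rewrite mulrC -[e]invrK; apply: l2le_scaled => //.
  exact: h1 (hZ _ _ _ ei ab) a1.
move=> a b c ab h; have [c0 _] := h.
have c1 : 0 < c + 1 by rewrite ltr_wpDl.
have M0 : 0 <= M.
  have [|+ _] := P a b (c + 1) c1 ab; last by rewrite pmulr_lge0.
  by apply: l2le_weaken h; rewrite lerDl.
apply: l2le_lim => [|e e0]; first exact: mulr_ge0.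
have M1 : 0 < M + 1 by rewrite ltr_wpDl.
have q0 : 0 < e / (M + 1) by rewrite divr_gt0.
apply: (@l2le_weaken _ _ _ (M * (c + e / (M + 1)))).
  rewrite mulrDr lerD2l mulrCA ler_piMr ?(ltW e0) //.
  by rewrite ler_pdivrMr // mul1r lerDl.
apply: (P a) => //; first by rewrite ltr_wpDl.
by apply: l2le_weaken h; rewrite lerDl ltW.
Qed.

Let rel_synth a b := l2 a /\ b = synth V a.

Let rel_synthZ a b (z : R) : rel_synth a b ->
  rel_synth (fun j => z%:C *: a j) (fun j => z%:C *: b j).
Proof.
move=> [al ->]; split; first exact: l2Z.
by apply/funext => j; rewrite synthZ.
Qed.

Lemma le_opnorm0 (M : R) (n : \bar R) : (0 <= n)%E -> (n <= M%:E)%E -> 0 <= M.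
Proof. by move=> n0 nM; rewrite -lee_fin; exact: le_trans nM. Qed.

Lemma synth_bound (M : R) a (c : R) : opnorm (@l2 R d) (@l2norm R d) (@H1norm R d) Vh = M%:E ->
  l2le a c -> l2le (synth V a) (M * c).
Proof.
move=> opM h.
apply: (@homogeneous_bound rel_synth M _ _ a) => //; last by split => //; exact: l2le_l2 h.
  by move=> a' b' z _; exact: rel_synthZ.
move=> a' _ [al ->] h1.
have := opnorm_ge opM al (proj2 (l2leP _ ler01) h1).
rewrite H1norm_Vhat // => hM.
by apply/l2leP => //; apply: le_opnorm0 hM; exact: l2norm_ge0.
Qed.

Lemma inverse_bound (M : R) a (c : R) : opnorm (@H1v R d) (@H1norm R d) (@l2norm R d) Vi = M%:E ->
  l2 a -> l2le (synth V a) c -> l2le a (M * c).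
Proof.
move=> opM al h.
apply: (@homogeneous_bound (fun b a => rel_synth a b) M _ _ (synth V a)) => //.
  by move=> a' b' z _; exact: rel_synthZ.
move=> _ a' [al' ->] h1.
have [H1 _] := hVh al'.
have V1 : (H1norm (Vh a') <= 1)%E by rewrite H1norm_Vhat //; exact/(l2leP _ ler01).
have := opnorm_ge opM H1 V1; rewrite (proj2 hVi) // => hM.
by apply/l2leP => //; apply: le_opnorm0 hM; exact: l2norm_ge0.
Qed.

Lemma synth_inverse f j : H1v f -> synth V (Vi f) j = hcoef f j.
Proof.
move=> hf; have [al E] := (proj1 hVi) f hf.
by rewrite -(hcoef_Vhat j hVh al); apply: eq_hcoef => t It; apply: E; rewrite inE.
Qed.

End OperatorBounds.

Section BauerFike.
Context {R : realType} (d N : nat).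
Local Notation C := R[i].
Local Notation l := (colloc_size d N).
Implicit Types (a b c : nat -> 'cV[C]_d).

Variables (V : 'M[C]_l) (lam : 'rV[C]_l) (lam1 mu : C) (p0 q0 u0 rho m : R).
Hypothesis hp : forall a (c : R), l2le a c -> l2le (synth V a) (p0 * c).
Hypothesis hq : forall a (c : R), l2 a -> l2le (synth V a) c -> l2le a (q0 * c).
Hypothesis lam1_max : forall i, normc (lam 0 i) <= normc lam1.
Hypothesis m_min : forall i, m <= normc (mu - lam 0 i).
Hypothesis m_min1 : m <= normc (mu - lam1).

Variables (x a ux : nat -> 'cV[C]_d) (k : nat).
Hypothesis kN : (k <= N)%N.
Hypothesis x1 : forall c : R, l2le x c -> 1 <= c.
Hypothesis x_le1 : l2le x 1.
Hypothesis al : l2 a.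
Hypothesis ax : forall j, synth V a j = x j.

(** The discarded tail of the eigenfunction, and the parts of its image. *)
Hypothesis tail : l2le (fun j => if (j <= k)%N then 0 else x j) rho.
Variables (U UN : nat -> 'I_d -> nat -> 'cV[C]_d) (nu : nat -> 'I_d -> R)
  (beta : nat -> 'I_d -> 'cV[C]_l).
Hypothesis hux : l2le ux (u0 * rho).
Hypothesis eigen : forall j, mu *: x j =
  \sum_(i < k.+1) \sum_(r < d) x i r 0 *: U i r j + ux j.
Hypothesis hbeta : forall (i : nat) (r : 'I_d) j, (i <= N)%N ->
  interp_coef (V *m beta i r) j = if j == i then delta_mx r 0 else 0.
Hypothesis hUN : forall (i : nat) (r : 'I_d) j, (i <= N)%N ->
  UN i r j = interp_coef (V *m (diag_mx lam *m beta i r)) j.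
Hypothesis hnu : forall (i : nat) (r : 'I_d), (i <= N)%N ->
  l2le (fun j => U i r j - UN i r j) (nu i r).

(** On the tail, where the approximate operator vanishes, the value lam1 is used
    instead of 0: the distance from mu to 0 would otherwise enter the minimum. *)
Let mult (j : nat) (s : 'I_d) : C :=
  if (j <= N)%N then lam 0 (tagnat.Rank (inord j : 'I_N.+1) s) else lam1.

Let act b (j : nat) : 'cV[C]_d := \col_s (mult j s * b j s 0).

Let actD b c j : act (fun i => b i + c i) j = act b j + act c j.
Proof. by apply/colP => s; rewrite !mxE mulrDr. Qed.

Let act_bound b (e : R) : l2le b e -> l2le (act b) (normc lam1 * e).
Proof.
apply: l2le_scale => [|j]; first exact: normc_ge0.
rewrite -(@ler_pXn2r _ 2) ?nnegrE ?mulr_ge0 ?vnorm_ge0 ?normc_ge0 //.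
rewrite exprMn !sqr_vnorm mulr_sumr; apply: ler_sum => s _.
rewrite mxE normcM exprMn ler_wpM2r ?sqr_ge0 // lerXn2r ?nnegrE ?normc_ge0 //.
by rewrite /mult; case: ifP.
Qed.

Let act_sub b (e : R) : 0 < m -> l2le (fun j => act b j - mu *: b j) e -> l2le b (m^-1 * e).
Proof.
move=> m0; apply: l2le_scale => [|j]; first by rewrite invr_ge0 ltW.
rewrite mulrC ler_pdivlMr // mulrC.
rewrite -(@ler_pXn2r _ 2) ?nnegrE ?mulr_ge0 ?vnorm_ge0 ?(ltW m0) //.
rewrite exprMn !sqr_vnorm mulr_sumr; apply: ler_sum => s _.
rewrite !mxE -mulrBl normcM exprMn ler_wpM2r ?sqr_ge0 // lerXn2r ?nnegrE ?normc_ge0 ?(ltW m0) //.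
by rewrite normc_oppB /mult; case: ifP.
Qed.

Let act_seqof (c : 'cV[C]_l) j : act (seqof c) j = seqof (diag_mx lam *m c) j.
Proof.
apply/colP => s; rewrite mxE /seqof /mult; case: ifP => jN; last by rewrite !mxE mulr0.
by rewrite mul_diag_mx !mxE.
Qed.

(** Let L be the diagonal operator [act].  Since m <= |L - mu| entrywise,
    m |a| <= |(L - mu) a| <= q0 |V (L - mu) a|, while 1 = |x| <= p0 |a|.  The
    sequence V (L - mu) a = V L a - U x is split at degree k: on the head
    V L V^-1 is the approximate operator and Cauchy-Schwarz applies to the errors
    nu, on the tail the operator norms apply to a sequence of norm at most rho. *)
Lemma bauer_fike : m <= p0 * q0 *
  (Num.sqrt (\sum_(i < k.+1) \sum_(r < d) nu i r ^+ 2) + rho * (u0 + normc lam1 * (p0 * q0))).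
Proof.
pose xi := Num.sqrt (\sum_(i < k.+1) \sum_(r < d) nu i r ^+ 2).
have [e ha] : exists e, l2le a e by have [e [/l2le_norm h _]] := l2_fin al; exists e.
have [rho0 _] := tail; have [urho0 _] := hux.
have iN (i : 'I_k.+1) : (i <= N)%N by rewrite (leq_trans _ kN) // -ltnS.
pose c := \sum_(i < k.+1) \sum_(r < d) x i r 0 *: beta i r.
have Vc W j : interp_coef (W *m c) j =
    \sum_(i < k.+1) \sum_(r < d) x i r 0 *: interp_coef (W *m beta i r) j.
  rewrite /c mulmx_sumr interp_coef_sum; apply: eq_bigr => i _.
  rewrite mulmx_sumr interp_coef_sum; apply: eq_bigr => r _.
  by rewrite -scalemxAr interp_coefZ.
have head j : interp_coef (V *m c) j = if (j <= k)%N then x j else 0.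
  rewrite Vc.
  rewrite -[RHS](_ : \sum_(i < k.+1 | i == j :> nat) x i = _); last first.
    by rewrite (big_ord1_eq _ x) ltnS.
  rewrite [RHS]big_mkcond; apply: eq_bigr => i _.
  under eq_bigr => r _ do rewrite hbeta // eq_sym.
  case: eqP => _; first exact: delta_sum.
  by rewrite big1 // => r _; rewrite scaler0.
(* c and ar are the coordinates of the head and of the tail. *)
pose ar j := a j - seqof c j.
have arE j : a j = seqof c j + ar j by rewrite /ar addrC subrK.
have [ec hc] := l2le_seqof c.
have arl : l2 ar by exact: l2le_l2 (l2leB ha hc).
have synthN b j : synth V (fun i => - b i) j = - synth V b j.
  by rewrite -scaleN1r -synthZ; congr synth; apply/funext => i; rewrite scaleN1r.
have har : l2le ar (q0 * rho).
  apply: hq => //; apply: eq_l2le tail => j.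
  rewrite /ar synthD synthN synth_seqof ax head.
  by case: ifP; rewrite ?subrr ?subr0.
have synth_act_ar := hp (act_bound har).
pose D j := \sum_(i < k.+1) \sum_(r < d) x i r 0 *: (UN i r j - U i r j).
have hD : l2le D xi.
  have : l2le D (\sum_(i < k.+1) \sum_(r < d) normc (x i r 0) * nu i r).
    apply: l2le_sum => i; apply: l2le_sum => r; apply: l2leZ.
    by apply: eq_l2le (l2leN (hnu r (iN i))) => j; rewrite opprB.
  apply: l2le_weaken.
  rewrite pair_bigA /= /xi pair_bigA /=.
  set S := \sum_p _; rewrite (le_trans (ler_norm S)) // -sqrtr_sqr ler_wsqrtr //.
  rewrite (le_trans (sum_cauchy_schwarz _ _ _ _)) // ler_piMl //.
    by rewrite sumr_ge0 // => i _; exact: sqr_ge0.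
  have [_ /(_ k.+1)] := x_le1; rewrite expr1n; apply: le_trans.
  rewrite -(pair_bigA _ (fun (i : 'I_k.+1) (r : 'I_d) => normc (x i r 0) ^+ 2)) /=.
  by apply: ler_sum => i _; rewrite sqr_vnorm.
pose E := xi + p0 * (normc lam1 * (q0 * rho)) + u0 * rho.
have hb : l2le (fun j => act a j - mu *: a j) (q0 * E).
  apply: hq.
    apply: l2le_l2 (l2leB (act_bound ha) (l2leZ mu ha)).
  apply: eq_l2le (l2leB (l2leD hD synth_act_ar) hux) => j.
  rewrite synthD synthN synthZ ax eigen.
  have -> : synth V (act a) j = interp_coef (V *m (diag_mx lam *m c)) j + synth V (act ar) j.
    rewrite -synth_seqof -synthD; congr synth; apply/funext => i.
    by rewrite -act_seqof -actD; congr act; apply/funext => i'; rewrite -arE.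
  have -> : D j = interp_coef (V *m (diag_mx lam *m c)) j -
      \sum_(i < k.+1) \sum_(r < d) x i r 0 *: U i r j.
    rewrite mulmxA Vc -sumrB; apply: eq_bigr => i _; rewrite -sumrB.
    by apply: eq_bigr => r _; rewrite hUN // scalerBr mulmxA.
  move: (synth V (act ar) j) => T.
  by rewrite opprD !addrA; congr (_ - _); rewrite addrAC.
have EE : p0 * q0 * (xi + rho * (u0 + normc lam1 * (p0 * q0))) = p0 * (q0 * E).
  by rewrite /E; ring.
rewrite -/xi EE.
have p1 : 1 <= p0 * (q0 * 1) by apply: x1; apply: eq_l2le (hp (hq al _)) => [//|];
    apply: eq_l2le x_le1.
have [qE0 _] := hb.
have pq0 : 0 <= p0 * (q0 * E).
  have [h1 _] := hp hb; exact: h1.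
have [m0|m0] := leP m 0; first exact: le_trans pq0.
have := x1 (eq_l2le ax (hp (act_sub m0 hb))).
rewrite mulrCA mulrC ler_pdivlMr // mul1r.
by [].
Qed.

End BauerFike.

(** * Linear differential equations *)

Section ComplexDerivative.
Context {R : realType}.
Local Notation C := R[i].
Implicit Types (f g : R -> C).

Lemma rderivD (u v : R -> R) (t a b : R) : is_derive t 1 u a -> is_derive t 1 v b ->
  is_derive t 1 (fun x => u x + v x) (a + b).
Proof. exact: is_deriveD. Qed.

Lemma rderivM (u v : R -> R) (t a b : R) : is_derive t 1 u a -> is_derive t 1 v b ->
  is_derive t 1 (fun x => u x * v x) (a * v t + u t * b).
Proof.
move=> du dv; apply: is_derive_eq (is_deriveM du dv) _.
by rewrite /GRing.scale /= addrC [v t * a]mulrC.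
Qed.

Lemma rderivN (u : R -> R) (t a : R) : is_derive t 1 u a -> is_derive t 1 (fun x => - u x) (- a).
Proof. exact: is_deriveN. Qed.

(** The derivative of a complex-valued function, by real and imaginary part. *)
Definition cderiv f (t : R) (l : C) : Prop :=
  is_derive t 1 (fun u => complex.Re (f u)) (complex.Re l) /\
  is_derive t 1 (fun u => complex.Im (f u)) (complex.Im l).

Lemma cderivD f g t a b : cderiv f t a -> cderiv g t b ->
  cderiv (fun u => f u + g u) t (a + b).
Proof.
move=> [f1 f2] [g1 g2]; split.
  rewrite cReD (_ : (fun u => _) = (fun u => complex.Re (f u) + complex.Re (g u))).
    exact: rderivD.
  by apply/funext => u; rewrite cReD.
rewrite cImD (_ : (fun u => _) = (fun u => complex.Im (f u) + complex.Im (g u))).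
  exact: rderivD.
by apply/funext => u; rewrite cImD.
Qed.

Lemma cderivM f g t a b : cderiv f t a -> cderiv g t b ->
  cderiv (fun u => f u * g u) t (a * g t + f t * b).
Proof.
move=> [f1 f2] [g1 g2]; split.
  rewrite (_ : (fun u => _) = (fun u => complex.Re (f u) * complex.Re (g u)
      + - (complex.Im (f u) * complex.Im (g u)))).
    apply: is_derive_eq (rderivD (rderivM f1 g1) (rderivN (rderivM f2 g2))) _.
    by rewrite cReD !cReM; ring.
  by apply/funext => u; rewrite cReM.
rewrite (_ : (fun u => _) = (fun u => complex.Re (f u) * complex.Im (g u) + complex.Im (f u)
    * complex.Re (g u))).
  apply: is_derive_eq (rderivD (rderivM f1 g2) (rderivM f2 g1)) _.
  by rewrite cImD !cImM; ring.
by apply/funext => u; rewrite cImM.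
Qed.

Lemma cderiv_cst (c : C) t : cderiv (fun=> c) t 0.
Proof. by split; exact: is_derive_cst. Qed.

Lemma cderiv_sum (I : Type) (r : seq I) (F : I -> R -> C) (l : I -> C) t :
  (forall i, cderiv (F i) t (l i)) ->
  cderiv (fun u => \sum_(i <- r) F i u) t (\sum_(i <- r) l i).
Proof.
move=> h; elim: r => [|i r IH].
  by rewrite big_nil; under eq_fun do rewrite big_nil; exact: cderiv_cst.
rewrite big_cons; under eq_fun do rewrite big_cons.
exact: (cderivD (h i) IH).
Qed.

Lemma near_interior (t : R) : -1 < t < 1 -> \forall u \near t, -1 < u < 1.
Proof.
move=> t1; have : t \in `](-1), 1[ by rewrite in_itv.
by move=> /near_in_itvoo; apply: filterS => u; rewrite in_itv.
Qed.

Lemma eq_cderiv f g t l : -1 < t < 1 -> (forall u, -1 < u < 1 -> f u = g u) ->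
  cderiv f t l -> cderiv g t l.
Proof.
move=> t1 fg [h1 h2]; split.
  by apply: near_eq_is_derive h1; near=> u; rewrite fg //; near: u; exact: near_interior.
by apply: near_eq_is_derive h2; near=> u; rewrite fg //; near: u; exact: near_interior.
Unshelve. all: by end_near. Qed.

Lemma has_deriv_within_cderiv f t l : -1 < t < 1 -> has_deriv_within f t l -> cderiv f t l.
Proof.
move=> t1 hd.
have D : (f u - f t) / (u - t)%:C @[u --> t^'] --> (l : C^o).
  apply/cvgCP => e e0; have /cvgCP /(_ e e0) := hd; rewrite near_withinE => hw.
  have ht : \forall u \near t^', -1 < u < 1 by apply: nbhs_dnbhs; exact: near_interior.
  by apply: filterS2 hw ht => u hu /I11_interior.
have E (x : C) (r : R) : complex.Re (x / r%:C) = complex.Re x / r /\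
   complex.Im (x / r%:C) = complex.Im x / r.
  have -> : x / r%:C = x * (r^-1)%:C by rewrite fmorphV.
  by rewrite cReM cImM /=; split; ring.
have main (phi : R -> R) (a : R) :
   (phi u - phi t) / (u - t) @[u --> t^'] --> a -> is_derive t 1 phi a.
  move=> L.
  have L' : h^-1 *: (phi (h *: 1 + t) - phi t) @[h --> 0^'] --> a.
    apply/cvgrPdist_lt => e e0.
    have /cvgrPdist_lt /(_ e e0) [d /= d0 hdd] := L.
    exists d => //= h; rewrite /= sub0r normrN => hh h0.
    have -> : h *: (1 : R) = h by rewrite /GRing.scale /= mulr1.
    have := hdd (h + t); rewrite /= opprD addrCA subrr addr0 normrN.
    rewrite addrK => /(_ hh); rewrite /GRing.scale /= mulrC; apply.
    by rewrite -subr_eq0 addrK.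
  have dphi : derivable phi t 1 by apply/cvg_ex; exists a; exact: L'.
  by apply: DeriveDef => //; rewrite /derive; exact: cvg_lim L'.
split; apply: main.
  have := cvgC_Re _ D; under eq_fun do rewrite (E _ _).1 cReD cReN; exact.
have := cvgC_Im _ D; under eq_fun do rewrite (E _ _).2 cImD cImN; exact.
Unshelve. all: by end_near. Qed.

Lemma has_deriv_within_wcont f (df : R -> C) :
  (forall t, I11 t -> has_deriv_within f t (df t)) -> wcont f.
Proof.
move=> hd; apply/subspace_continuousP => t It; apply/cvgCP => e e0.
have /cvgCP /(_ 1 ltr01) := hd t It.
rewrite !near_withinE near_simpl => -[d /= d0 hdd].
pose m := e / (normc (df t) + 2).
have l0 : 0 < normc (df t) + 2 by rewrite ltr_wpDl // normc_ge0.
have m0 : 0 < m by rewrite divr_gt0.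
exists (Num.min d m) => /=; first by rewrite lt_min d0.
move=> u /=; rewrite lt_min => /andP[ud um] Iu.
have [->|ut] := eqVneq u t; first by rewrite subrr normc0.
have {}hdd := hdd u ud ut Iu.
have ut0 : u - t != 0 by rewrite subr_eq0.
have utc : (u - t)%:C != 0 :> C by rewrite -(inj_eq (@complexI R)) in ut0.
have -> : from_subspace I11 f u - from_subspace I11 f t =
    ((f u - f t) / (u - t)%:C - df t + df t) * (u - t)%:C.
  by rewrite subrK divfK.
rewrite normcM normcR distrC.
apply: (@le_lt_trans _ _ ((1 + normc (df t)) * `|t - u|)).
  by rewrite ler_wpM2r // (le_trans (le_normcD _ _)) // lerD2r ltW.
apply: (@le_lt_trans _ _ ((normc (df t) + 2) * `|t - u|)).
  by rewrite ler_wpM2r //; lra.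
by rewrite mulrC -ltr_pdivlMr.
Qed.

Lemma holo_wcont (f : C -> C) : (forall t : R, I11 t -> holo_at f t%:C) ->
  wcont (fun t => f t%:C).
Proof.
move=> hf; apply/subspace_continuousP => t It; apply/cvgCP => e e0.
have [d d0 hd] := holo_at_cvg (hf t It) e0.
exists d => //= u /= ud Iu; apply: hd.
by rewrite -rmorphB normcR distrC.
Qed.

Lemma rcontV (u : R -> R) : rcont u -> (forall t, I11 t -> u t != 0) -> rcont (fun t => (u t)^-1).
Proof.
move=> /subspace_continuousP cu u0; apply/subspace_continuousP => t It.
by apply: cvgV; [exact: u0|exact: cu].
Qed.

Lemma wcontV f : wcont f -> (forall t, I11 t -> f t != 0) -> wcont (fun t => (f t)^-1).
Proof.
move=> /wcontP[f1 f2] f0.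
pose n t := complex.Re (f t) ^+ 2 + complex.Im (f t) ^+ 2.
have cn : rcont n by apply: rcontD; under eq_fun do rewrite expr2; exact: rcontM.
have n0 t : I11 t -> n t != 0.
  move=> It; rewrite /n -sqr_normcE expf_eq0 /=; apply/negP => /eqP /eq0_normc.
  by move/eqP; exact/negP/f0.
have cnV := rcontV cn n0.
have E t : (f t)^-1 = (complex.Re (f t) * (n t)^-1) +i* (- (complex.Im (f t) * (n t)^-1)).
  by rewrite /n; case: (f t).
apply/wcontP; split; under eq_fun do rewrite E /=; first exact: rcontM.
by apply: rcontN; exact: rcontM.
Qed.

End ComplexDerivative.

Section LinearODE.
Context {R : realType} (d : nat).
Local Notation C := R[i].
Implicit Types (M Phi : R -> 'M[C]_d) (g : R -> 'cV[C]_d).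

Definition solves M g : Prop :=
  forall t, -1 < t < 1 -> forall s, cderiv (component g s) t ((M t *m g t) s 0).

Definition mcont M : Prop := forall i j, wcont (fun t => M t i j).

Lemma mcont_bounded M : mcont M -> exists2 K : R, 0 <= K &
  forall t, I11 t -> forall i j, normc (M t i j) <= K.
Proof.
move=> cM.
have B i j : exists K : R, 0 <= K /\ forall t, I11 t -> normc (M t i j) <= K.
  have /wcontP[c1 c2] := cM i j.
  have [K1 K10 h1] := within_bounded c1; have [K2 K20 h2] := within_bounded c2.
  exists (K1 + K2); split => [|t It]; first exact: addr_ge0.
  by rewrite (le_trans (normc_le_ReIm _)) // lerD ?h1 ?h2.
have [K hK] := choice (fun p : 'I_d * 'I_d => B p.1 p.2).
exists (\sum_p K p) => [|t It i j]; first by rewrite sumr_ge0 // => p _; case: (hK p).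
rewrite (bigD1 (i, j)) //= ler_wpDr ?sumr_ge0 //; first by move=> p _; case: (hK p).
by case: (hK (i, j)) => _; exact.
Qed.

Let energy g t : R := \sum_(s < d) (complex.Re (g t s 0) ^+ 2 + complex.Im (g t s 0) ^+ 2).

Let energy_ge0 g t : 0 <= energy g t.
Proof. by rewrite sumr_ge0 // => s _; rewrite addr_ge0 ?sqr_ge0. Qed.

(** The energy satisfies a linear differential inequality in both directions,
    so that it vanishes identically if it vanishes somewhere. *)
Lemma ode_unique M g t0 : mcont M -> vcont g -> solves M g -> I11 t0 -> g t0 = 0 ->
  forall t, I11 t -> g t = 0.
Proof.
move=> cM cg sg It0 g0.
have [K K0 hK] := mcont_bounded cM.
pose c := 2 * K * d%:R.
have c0 : 0 <= c by rewrite !mulr_ge0.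
pose de t : R := \sum_(s < d) 2 * (complex.Re (g t s 0) * complex.Re ((M t *m g t) s 0) +
   complex.Im (g t s 0) * complex.Im ((M t *m g t) s 0)).
have D (t : R) : -1 < t < 1 -> is_derive t 1 (energy g) (de t).
  move=> t1.
  rewrite (_ : energy g = \sum_(s < d) (fun u => complex.Re (g u s 0) * complex.Re (g u s 0) +
      complex.Im (g u s 0) * complex.Im (g u s 0))); last first.
    by apply/funext => u; rewrite fct_sumE; apply: eq_bigr => s _; rewrite !expr2.
  apply: is_derive_sum => s; have [h1 h2] := sg t t1 s.
  apply: is_derive_eq (rderivD (rderivM h1 h1) (rderivM h2 h2)) _.
  by rewrite /component; ring.
have bde (t : R) : I11 t -> `|de t| <= c * energy g t.
  move=> It; rewrite /de.
  have nE s : complex.Re (g t s 0) ^+ 2 + complex.Im (g t s 0) ^+ 2 = normc (g t s 0) ^+ 2.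
    by rewrite sqr_normcE.
  rewrite /energy (eq_bigr _ (fun s _ => nE s)).
  apply: (@le_trans _ _ (\sum_(s < d) \sum_(r < d) K *
      (normc (g t s 0) ^+ 2 + normc (g t r 0) ^+ 2))).
    rewrite (le_trans (ler_norm_sum _ _ _)) //; apply: ler_sum => s _.
    apply: (@le_trans _ _ (2 * (normc (g t s 0) * normc ((M t *m g t) s 0)))).
      rewrite normrM ger0_norm // ler_wpM2l // -normcM.
      set z := g t s 0; set w := (_ *m _) s 0.
      have -> : complex.Re z * complex.Re w + complex.Im z * complex.Im w =
          complex.Re (conjc z * w).
        by rewrite cReM; case: (z) => a b /=; ring.
      rewrite (le_trans (abs_Re_le _)) // !normcM ler_wpM2r ?normc_ge0 //.
      by case: (z) => a b /=; rewrite sqrrN.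
    have mg : normc ((M t *m g t) s 0) <= \sum_(r < d) K * normc (g t r 0).
      rewrite mxE (le_trans (normc_sum _ _ _)) //; apply: ler_sum => r _.
      by rewrite normcM ler_wpM2r ?normc_ge0 // hK.
    rewrite mulrA; apply: (le_trans (ler_wpM2l _ mg)); first by rewrite mulr_ge0 ?normc_ge0.
    rewrite mulr_sumr; apply: ler_sum => r _.
    rewrite mulrCA ler_wpM2l //.
    have := sqr_ge0 (normc (g t s 0) - normc (g t r 0)); nra.
  have S0 (F : 'I_d -> R) : \sum_(s < d) \sum_(r < d) K * (F s + F r) = c * \sum_(s < d) F s.
    rewrite (eq_bigr (fun s => K * d%:R * F s + K * \sum_(r < d) F r)); last first.
      move=> s _; rewrite -mulr_sumr big_split /= sumr_const card_ord mulrDr -[F s *+ d]mulr_natl.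
      by rewrite mulrA.
    by rewrite big_split /= -mulr_sumr sumr_const card_ord -mulr_natl /c; ring.
  by rewrite S0.
have ce : {within `[-1, 1], continuous (energy g)}.
  have : rcont (fun t => complex.Re (\sum_(s < d)
      ((complex.Re (g t s 0))%:C ^+ 2 + (complex.Im (g t s 0))%:C ^+ 2) : C)).
    apply: (proj1 (proj1 (wcontP _) _)).
    apply: wcont_sum => s; have /wcontP[h1 h2] := cg s.
    by apply: wcontD; under eq_fun do rewrite expr2; apply: wcontM; apply: wcont_real.
  rewrite (_ : (fun t => _) = energy g) //.
  apply/funext => t; rewrite -[RHS]/(complex.Re (energy g t)%:C) rmorph_sum.
  by congr complex.Re; apply: eq_bigr => s _; rewrite rmorphD !rmorphXn.
have exd (a t : R) : is_derive t 1 (fun u => expR (a * u)) (a * expR (a * t)).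
  by apply: is_derive_eq; rewrite /GRing.scale /= !mulr1 ?mulr0 ?add0r ?addr0 mulrC.
have DE (a t : R) : -1 < t < 1 ->
   is_derive t 1 (fun u => energy g u * expR (a * u)) ((de t + a * energy g t) * expR (a * t)).
  by move=> t1; apply: is_derive_eq (rderivM (D t t1) (exd a t)) _; ring.
have cE (a : R) : {within `[-1, 1], continuous (fun u => energy g u * expR (a * u))}.
  apply: rcontM => //; apply: rcontT => u; apply: continuous_comp; last exact: continuous_expR.
  by apply: cvgM; [exact: cvg_cst|exact: cvg_id].
have e0 : energy g t0 = 0.
  by rewrite /energy big1 // => s _; rewrite g0 mxE /= expr0n /= addr0.
have oo (x : R) : x \in `](-1), 1[ -> -1 < x < 1 by rewrite in_itv.
have ez t : I11 t -> energy g t = 0.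
  move=> It; apply/eqP; rewrite eq_le energy_ge0 andbT.
  have [tt|tt] := leP t0 t.
    have H : {in `[-1, 1] &, {homo (fun u => energy g u * expR (- c * u)) : x y /~ x <= y}}.
      apply: ler0_derive1_le_cc => //.
      - by move=> x /oo x1; have dx := DE (- c) x x1; exact: ex_derive.
      - move=> x /oo x1; rewrite derive1E; have dx := DE (- c) x x1; rewrite derive_val.
        rewrite pmulr_lle0 ?expR_gt0 // mulNr subr_le0.
        exact: (le_trans (ler_norm _) (bde x (I11_interior x1))).
    have := H t t0 It It0 tt; rewrite e0 mul0r pmulr_lle0 // expR_gt0 //.
  have H : {in `[-1, 1] &, {homo (fun u => energy g u * expR (c * u)) : x y / x <= y}}.
    apply: ger0_derive1_le_cc => //.
    - by move=> x /oo x1; have dx := DE c x x1; exact: ex_derive.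
    - move=> x /oo x1; rewrite derive1E; have dx := DE c x x1; rewrite derive_val.
      rewrite mulr_ge0 ?expR_ge0 //.
      by have := bde x (I11_interior x1); rewrite ler_norml; lra.
  have := H t t0 It It0 (ltW tt); rewrite e0 mul0r pmulr_lle0 // expR_gt0 //.
move=> t It; apply/colP => s; rewrite mxE; apply: eq0_normc; apply/eqP.
rewrite -sqrf_eq0 sqr_normcE.
have := ez t It => /eqP; rewrite psumr_eq0 => [/allP /(_ s (mem_index_enum _)) //|r _].
by rewrite addr_ge0 ?sqr_ge0.
Qed.

Lemma fundamental_mcont M Phi : fundamental_solution M Phi -> mcont Phi.
Proof. by move=> [_ h] i j; apply: has_deriv_within_wcont => t It; exact: h. Qed.

Lemma mulmx_vcont M g : mcont M -> vcont g -> vcont (fun t => M t *m g t).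
Proof.
move=> cM cg s; rewrite (_ : component _ s = (fun t => \sum_(r < d) M t s r * g t r 0)).
  by apply: wcont_sum => r; apply: wcontM; [exact: cM|exact: cg].
by apply/funext => t; rewrite /component mxE.
Qed.

Lemma fundamental_solves M Phi (v : 'cV[C]_d) : fundamental_solution M Phi ->
  solves M (fun t => Phi t *m v).
Proof.
move=> [_ h] t t1 s.
have It := I11_interior t1.
rewrite (_ : component _ s = (fun u => \sum_(r < d) Phi u s r * v r 0)); last first.
  by apply/funext => u; rewrite /component mxE.
rewrite mulmxA mxE; apply: cderiv_sum => r.
have dP := has_deriv_within_cderiv t1 (h t It s r).
have := cderivM dP (cderiv_cst (v r 0) t).
by rewrite mulr0 addr0.
Qed.

(** A vector in the kernel of Phi t gives a solution that vanishes at t, hence at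
    -1, where Phi is the identity. *)
Lemma fundamental_unit M Phi t : mcont M -> fundamental_solution M Phi -> I11 t ->
  Phi t \in unitmx.
Proof.
move=> cM hP It; rewrite unitmxE unitfE; apply/negP => /eqP d0.
have /det0P[v v0 hv] : \det (Phi t)^T == 0 by rewrite det_tr d0.
have Pv : Phi t *m v^T = 0 by apply: trmx_inj; rewrite trmx_mul trmxK trmx0.
have cP : vcont (fun u => Phi u *m v^T).
  by apply: mulmx_vcont; [exact: fundamental_mcont hP|exact: vcont_cst].
have := ode_unique cM cP (fundamental_solves v^T hP) It Pv I11_N1.
rewrite (proj1 hP) mul1mx => /(congr1 trmx); rewrite trmxK trmx0 => v00.
by rewrite v00 eqxx in v0.
Qed.

Lemma wcont_det (n : nat) (F : R -> 'M[C]_n) : (forall i j, wcont (fun t => F t i j)) ->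
  wcont (fun t => \det (F t)).
Proof.
move=> cF; apply: wcont_sum => s; apply: wcontM; first exact: wcont_cst.
by apply: wcont_prod => i; exact: cF.
Qed.

(** Cramer's rule writes the inverse as a rational function of the entries. *)
Lemma mcont_inv Phi : mcont Phi -> (forall t, I11 t -> Phi t \in unitmx) ->
  mcont (fun t => invmx (Phi t)).
Proof.
move=> cP uP i j.
apply: (@eq_wcont _ (fun t => (\det (Phi t))^-1 * ((-1) ^+ (j + i)
    * \det (row' j (col' i (Phi t)))))).
  by move=> t It; rewrite /invmx uP // mxE [in RHS]mxE.
apply: wcontM.
  apply: wcontV; first exact: wcont_det.
  by move=> t /uP; rewrite unitmxE unitfE.
apply: wcontM; first exact: wcont_cst.
apply: wcont_det => r s; rewrite (_ : (fun t => _) = (fun t => Phi t (lift j r) (lift i s))).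
  exact: cP.
by apply/funext => t; rewrite !mxE.
Qed.

End LinearODE.

Section Primitive.
Context {R : realType}.
Local Notation C := R[i].
Local Notation leb := (@lebesgue_measure R).

Let prim (u : R -> R) (t : R) : R := \int[leb]_(s in `[-1, t]) u s.

Lemma rcont_integrable_sub (u : R -> R) (t : R) : rcont u -> I11 t ->
  leb.-integrable `[-1, t] (EFin \o u).
Proof.
move=> cu It; apply: integrable_cc; apply: continuous_subspaceW cu => s.
move: It; rewrite /I11 /= !in_itv /= => /andP[a b] /andP[c e].
by rewrite c (le_trans e).
Qed.

Let prim_cont (u : R -> R) : rcont u -> rcont (prim u).
Proof.
move=> cu; have N1 : -1 <= 1 :> R by lra.
exact: (parameterized_integral_continuous N1 (integrable_cc cu)).
Qed.

Let prim_deriv (u : R -> R) (t : R) : rcont u -> -1 < t < 1 -> is_derive t 1 (prim u) (u t).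
Proof.
move=> cu /andP[t0 t1].
have N1 : -1 < 1 :> R by lra.
have [c1 _ _] := (proj1 (continuous_within_itvP u N1)) cu.
have ct : {for t, continuous u} by apply: c1; rewrite in_itv /= t0 t1.
have [d1 d2] := continuous_FTC1_closed t1 (integrable_cc cu) t0 ct.
by apply: DeriveDef; [exact: d1|rewrite -derive1E].
Qed.

Definition cprim (g : R -> C) (t : R) : C := Cint `[-1, t]%classic g.

Lemma cprim_wcont g : wcont g -> wcont (cprim g).
Proof. by move=> /wcontP[g1 g2]; apply/wcontP; split; exact: prim_cont. Qed.

Lemma cprim_cderiv g t : wcont g -> -1 < t < 1 -> cderiv (cprim g) t (g t).
Proof.
move=> /wcontP[g1 g2] t1; split; [exact: (prim_deriv g1 t1)|exact: (prim_deriv g2 t1)].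
Qed.

Lemma cprimD f g t : wcont f -> wcont g -> I11 t ->
  cprim (fun s => f s + g s) t = cprim f t + cprim g t.
Proof.
move=> /wcontP[f1 f2] /wcontP[g1 g2] It; apply: complex_ext; rewrite ?cE /=.
  rewrite -RintegralD //; try exact: rcont_integrable_sub.
  by apply: eq_Rintegral => s _; rewrite cReD.
rewrite -RintegralD //; try exact: rcont_integrable_sub.
by apply: eq_Rintegral => s _; rewrite cImD.
Qed.

Lemma cprimZ c g t : wcont g -> I11 t -> cprim (fun s => c * g s) t = c * cprim g t.
Proof.
move=> /wcontP[g1 g2] It.
have S (a : R) (u : R -> R) : rcont u -> leb.-integrable `[-1, t] (EFin \o (fun s => a * u s)).
  by move=> cu; apply: rcont_integrable_sub => //; apply: rcontM => //; exact: rcont_cst.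
apply: complex_ext; rewrite ?cE /=.
  rewrite -RintegralZl //; last exact: rcont_integrable_sub.
  rewrite -RintegralZl //; last exact: rcont_integrable_sub.
  rewrite -RintegralB //; try exact: S.
  by apply: eq_Rintegral => s _; rewrite cReM.
rewrite -RintegralZl //; last exact: rcont_integrable_sub.
rewrite -RintegralZl //; last exact: rcont_integrable_sub.
rewrite -RintegralD //; try exact: S.
by apply: eq_Rintegral => s _; rewrite cImM.
Qed.

End Primitive.

Section Monodromy.
Context {R : realType} (d : nat).
Local Notation C := R[i].
Variables (A B : C -> 'M[C]_d) (PhiA : R -> 'M[C]_d).
Hypothesis cA : mcont (fun t => A t%:C).
Hypothesis cB : mcont (fun t => B t%:C).
Hypothesis hPhiA : fundamental_solution (fun t => A t%:C) PhiA.
Implicit Types f g : R -> 'cV[C]_d.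

Let cPhi : mcont PhiA. Proof. exact: fundamental_mcont hPhiA. Qed.

Let uPhi t : I11 t -> PhiA t \in unitmx.
Proof. exact: fundamental_unit cA hPhiA. Qed.

Let integrand f (u : R) : 'cV[C]_d := invmx (PhiA u) *m B u%:C *m f u.

Let vcont_integrand f : vcont f -> vcont (integrand f).
Proof.
move=> cf; rewrite (_ : integrand f = (fun u => invmx (PhiA u) *m (B u%:C *m f u))).
  by apply: mulmx_vcont; [exact: mcont_inv|apply: mulmx_vcont].
by apply/funext => u; rewrite /integrand mulmxA.
Qed.

Let W f (t : R) : 'cV[C]_d := \col_i cprim (component (integrand f) i) t.

Let monodromyE f t : monodromy B PhiA f t = PhiA t *m (f 1 + W f t).
Proof. by []. Qed.

Let WD f g t : vcont f -> vcont g -> I11 t -> W (fun u => f u + g u) t = W f t + W g t.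
Proof.
move=> cf cg It; apply/colP => i; rewrite !mxE -cprimD //; try exact: vcont_integrand.
by congr cprim; apply/funext => u; rewrite /component /integrand mulmxDr mxE.
Qed.

Let WZ f (c : C) t : vcont f -> I11 t -> W (fun u => c *: f u) t = c *: W f t.
Proof.
move=> cf It; apply/colP => i; rewrite !mxE -cprimZ //; try exact: vcont_integrand.
by congr cprim; apply/funext => u; rewrite /component /integrand -scalemxAr mxE.
Qed.

Lemma monodromyD f g t : vcont f -> vcont g -> I11 t ->
  monodromy B PhiA (fun u => f u + g u) t = monodromy B PhiA f t + monodromy B PhiA g t.
Proof.
by move=> cf cg It; rewrite !monodromyE (WD cf cg It) addrACA mulmxDr.
Qed.

Lemma monodromyZ f (c : C) t : vcont f -> I11 t ->
  monodromy B PhiA (fun u => c *: f u) t = c *: monodromy B PhiA f t.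
Proof.
by move=> cf It; rewrite !monodromyE (WZ c cf It) -scalerDr scalemxAr.
Qed.

Lemma monodromy_sum (I : Type) (r : seq I) (F : I -> R -> 'cV[C]_d) t :
  (forall i, vcont (F i)) -> I11 t ->
  monodromy B PhiA (fun u => \sum_(i <- r) F i u) t =
  \sum_(i <- r) monodromy B PhiA (F i) t.
Proof.
move=> cF It; elim: r => [|i r IH].
  rewrite big_nil (_ : (fun u => _) = (fun u => 0 *: 0)); last first.
    by apply/funext => u; rewrite big_nil scaler0.
  by rewrite monodromyZ ?scale0r //; exact: vcont_cst.
rewrite big_cons -IH; under eq_fun do rewrite big_cons.
exact: (monodromyD (cF i) (@vcont_sum _ _ _ r F cF) It).
Qed.

Lemma monodromy_vcont f : vcont f -> vcont (monodromy B PhiA f).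
Proof.
move=> cf; apply: mulmx_vcont; first exact: cPhi.
apply: vcontD; first exact: vcont_cst.
move=> s; rewrite (_ : component _ s = cprim (component (integrand f) s)).
  by apply: cprim_wcont; exact: vcont_integrand.
by apply/funext => t; rewrite /component mxE.
Qed.

(** Differentiating the eigenvalue equation gives x' = (A + B / mu) x, since on an
    eigenfunction the delayed value is the current one divided by mu; the solution
    is determined by its value at -1. *)
Lemma eigenfunction_ode (mu : C) (x : R -> 'cV[C]_d) (Phimu : R -> 'M[C]_d) :
  mu != 0 -> vcont x -> (forall t, I11 t -> monodromy B PhiA x t = mu *: x t) ->
  fundamental_solution (fun t => A t%:C + mu^-1 *: B t%:C) Phimu ->
  forall t, I11 t -> x t = Phimu t *m x (-1).
Proof.
move=> mu0 cx eig hPm.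
pose M t := A t%:C + mu^-1 *: B t%:C.
have cM : mcont M.
  move=> i j; rewrite (_ : (fun t => M t i j) = (fun t => A t%:C i j + mu^-1 * B t%:C i j)).
    by apply: wcontD; [exact: cA|apply: wcontM; [exact: wcont_cst|exact: cB]].
  by apply/funext => t; rewrite !mxE.
pose z t := x 1 + W x t.
have dz t s : -1 < t < 1 -> cderiv (component z s) t (integrand x t s 0).
  move=> t1; rewrite (_ : component z s = (fun t => x 1 s 0 + cprim (component (integrand x) s) t)).
    have := cderivD (cderiv_cst (x 1 s 0) t) (cprim_cderiv (@vcont_integrand x cx s) t1).
    by rewrite add0r.
  by apply/funext => u; rewrite /component !mxE.
have sx : solves M x.
  move=> t t1 s; have It := I11_interior t1.
  apply: (@eq_cderiv _ (fun u => mu^-1 * \sum_(r < d) PhiA u s r * z u r 0)) => //.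
    move=> u u1; have Iu := I11_interior u1.
    have : x u = mu^-1 *: (PhiA u *m z u).
      by rewrite -monodromyE eig // scalerA mulVf // scale1r.
    by rewrite /component => ->; rewrite !mxE.
  have S : cderiv (fun u => \sum_(r < d) PhiA u s r * z u r 0) t
     (\sum_(r < d) ((A t%:C *m PhiA t) s r * z t r 0 + PhiA t s r * integrand x t r 0)).
    apply: cderiv_sum => r; apply: cderivM; last exact: dz.
    apply: has_deriv_within_cderiv => //; exact: (proj2 hPhiA).
  have := cderivM (cderiv_cst (mu^-1) t) S.
  rewrite mul0r add0r; congr cderiv.
  have zE : PhiA t *m z t = mu *: x t by rewrite -monodromyE eig.
  have iE : PhiA t *m integrand x t = B t%:C *m x t.
    by rewrite /integrand -mulmxA mulKVmx //; exact: uPhi.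
  rewrite big_split /=.
  have -> : \sum_(r < d) (A t%:C *m PhiA t) s r * z t r 0 =
      ((A t%:C *m PhiA t) *m z t) s 0 by rewrite [RHS]mxE.
  have -> : \sum_(r < d) PhiA t s r * integrand x t r 0 =
      (PhiA t *m integrand x t) s 0 by rewrite [RHS]mxE.
  have E1 : M t *m x t = A t%:C *m x t + mu^-1 *: (B t%:C *m x t).
    by rewrite /M mulmxDl -scalemxAl.
  have E2 : A t%:C *m (mu *: x t) = mu *: (A t%:C *m x t) by rewrite -scalemxAr.
  rewrite iE -mulmxA zE E1 E2; move: (A t%:C *m x t) (B t%:C *m x t) => p q.
  by rewrite !mxE mulrDr mulrA mulVf // mul1r.
have cP : vcont (fun t => Phimu t *m x (-1)).
  by apply: mulmx_vcont; [exact: fundamental_mcont hPm|exact: vcont_cst].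
have sP := fundamental_solves (x (-1)) hPm.
pose g t := x t - Phimu t *m x (-1).
have cg : vcont g by exact: (vcontB cx cP).
have sg : solves M g.
  move=> t t1 s.
  rewrite (_ : component g s = (fun u => component x s u + (-1) * component (fun t =>
      Phimu t *m x (-1)) s u)).
    have := cderivD (sx t t1 s) (cderivM (cderiv_cst (-1) t) (sP t t1 s)).
    rewrite mul0r add0r; congr cderiv.
    rewrite /g mulmxBr; move: (M t *m x t) (M t *m (Phimu t *m x (-1))) => p q.
    by rewrite !mxE mulN1r.
  apply/funext => u; rewrite /component /g; move: (x u) (Phimu u *m x (-1)) => p q.
  by rewrite !mxE mulN1r.
have g0 : g (-1) = 0 by rewrite /g (proj1 hPm) mul1mx subrr.
move=> t It; have := ode_unique cM cg sg I11_N1 g0 It.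
by move/eqP; rewrite subr_eq0 => /eqP.
Qed.

End Monodromy.

(** * The tail of an eigenfunction *)

Section GeometricTail.
Context {R : realType}.
Implicit Types (u eta : R) (k : nat).

Lemma bernoulli_pow u k : 0 <= u -> u <= 1 -> 1 - k%:R * (1 - u) <= u ^+ k.
Proof.
move=> u0 u1; elim: k => [|k IH]; first by rewrite mul0r subr0 expr0.
rewrite exprS -natr1; apply: le_trans (ler_wpM2l u0 IH).
have : 0 <= k%:R * (1 - u) ^+ 2 by rewrite mulr_ge0 ?sqr_ge0.
nra.
Qed.

(** The closed form of the sum of (i + 1) ^ 2 u ^ i over all i >= j. *)
Let tailsum u (j : nat) : R :=
  (j.+1%:R ^+ 2 / (1 - u) + 2 * j.+1%:R * u / (1 - u) ^+ 2 + u * (1 + u) / (1 - u) ^+ 3) * u ^+ j.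

Let tailsum_step u j : u < 1 -> tailsum u j - tailsum u j.+1 = j.+1%:R ^+ 2 * u ^+ j.
Proof.
move=> u1; have v0 : 1 - u != 0 by rewrite gt_eqF // subr_gt0.
rewrite /tailsum [u ^+ j.+1]exprS -[j.+2%:R]natr1; move: (j.+1%:R) (u ^+ j) => m p.
by field.
Qed.

Let tailsum_ge0 u j : 0 <= u -> u < 1 -> 0 <= tailsum u j.
Proof.
move=> u0 u1; have v0 : 0 <= 1 - u by rewrite subr_ge0 ltW.
by rewrite mulr_ge0 ?exprn_ge0 // !addr_ge0 // divr_ge0 ?exprn_ge0 // !mulr_ge0 // addr_ge0.
Qed.

Lemma geometric_tail u k n : 0 <= u -> u < 1 ->
  \sum_(j < n) (if (j <= k)%N then 0 else j.+1%:R ^+ 2 * u ^+ j) <= tailsum u k.+1.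
Proof.
move=> u0 u1.
suff : \sum_(j < n) (if (j <= k)%N then 0 else j.+1%:R ^+ 2 * u ^+ j) <=
  tailsum u k.+1 - tailsum u (maxn n k.+1).
  move=> h; apply: (le_trans h); rewrite gerBl; exact: tailsum_ge0.
elim: n => [|n IH]; first by rewrite big_ord0 max0n subrr.
rewrite big_ord_recr /=; case: leqP => nk.
  by move: IH; rewrite !(maxn_idPr _) ?addr0 //; exact: leqW.
move: IH; rewrite !(maxn_idPl _) //; last exact: leqW.
by rewrite -tailsum_step //; lra.
Qed.

(** The left side of the hypothesis is small only if k (1 - u) is bounded below;
    the tail is then comparable with k ^ 2 u ^ k / (1 - u) ^ 2, and sinh eta is
    (1 - u) / (2 exp (- eta)). *)
Lemma tail_constant eta k u : u = expR (- eta) ^+ 2 -> 0 < eta -> (0 < k)%N ->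
  8 * k%:R * expR (- (k%:R * eta)) < sinh eta ->
  12 * tailsum u k.+1 <= 64 * (sinh eta)^-1 ^+ 2 * k%:R ^+ 2 * u ^+ k.
Proof.
move=> uE eta0 k0 small.
have r0 : 0 < expR (- eta) by exact: expR_gt0.
have r1 : expR (- eta) < 1 by rewrite expR_lt1 oppr_lt0.
have rr : expR eta * expR (- eta) = 1 by exact: expRxMexpNx_1.
set r := expR (- eta) in uE r0 r1 rr *.
have u0 : 0 < u by rewrite uE exprn_gt0.
have u1 : u < 1 by rewrite uE expr2; nra.
have v0 : 0 < 1 - u by rewrite subr_gt0.
have shE : sinh eta = (1 - u) / (2 * r).
  rewrite /sinh -/r -[expR eta]mulr1 -(divff (lt0r_neq0 r0)) mulrA rr uE.
  by field; exact: lt0r_neq0.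
have k1 : 1 <= k%:R :> R by rewrite ler1n.
have ke : expR (- (k%:R * eta)) = r ^+ k by rewrite -mulrN expRM_natl.
have kv : 2^-1 <= k%:R * (1 - u).
  (* Otherwise u ^ k >= 1 / 2 by the Bernoulli inequality. *)
  rewrite leNgt; apply/negP => kv.
  have ub : 2^-1 <= u ^+ k by have := bernoulli_pow k (ltW u0) (ltW u1); lra.
  have : 16 * k%:R * (r ^+ k * r) < 1 - u.
    move: small; rewrite ke shE ltr_pdivlMr; last by rewrite mulr_gt0.
    by rewrite (_ : 16 * _ * _ = 8 * k%:R * r ^+ k * (2 * r)) //; ring.
  have : u ^+ k <= r ^+ k * r.
    rewrite uE -exprM -exprSr ler_wiXn2l ?(ltW r0) ?(ltW r1) //.
    by case: (k) k0 => // k' _; rewrite mul2n -addnn addSn ltnS addnS ltnS leq_addr.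
  nra.
have -> : 64 * (sinh eta)^-1 ^+ 2 * k%:R ^+ 2 * u ^+ k =
   256 * k%:R ^+ 2 * u ^+ k.+1 / (1 - u) ^+ 2.
  rewrite shE [u ^+ k.+1]exprSr; move: (u ^+ k) (k%:R) => p m.
  have -> : p * u = p * r ^+ 2 by rewrite uE.
  by field; rewrite !lt0r_neq0.
have -> : 12 * tailsum u k.+1 =
  12 * ((k.+2%:R ^+ 2 * (1 - u) + 2 * k.+2%:R * u + u * (1 + u) / (1 - u))
      * u ^+ k.+1 / (1 - u) ^+ 2).
  rewrite /tailsum; move: (u ^+ k.+1) (k.+2%:R) => p m.
  by field; rewrite lt0r_neq0.
rewrite 2!mulrA ler_pM2r ?invr_gt0 ?exprn_gt0 // ler_pM2r ?exprn_gt0 //.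
have k2 : k.+2%:R <= 3 * k%:R :> R.
  by rewrite -natrM ler_nat; case: (k) k0 => // k' _; rewrite !mulSn mul0n; lia.
have kk0 : 0 <= k.+2%:R :> R by [].
have h3 : u * (1 + u) / (1 - u) <= 4 * k%:R.
  rewrite ler_pdivrMr //; have : u * (1 + u) <= 2 by nra.
  by lra.
have kk : k%:R <= k%:R ^+ 2 :> R by rewrite expr2 ler_peMl //.
have sq : k.+2%:R ^+ 2 <= 9 * k%:R ^+ 2 :> R.
  by rewrite (_ : 9 * _ = (3 * k%:R) ^+ 2); [rewrite lerXn2r ?nnegrE ?mulr_ge0|ring].
have h1 : k.+2%:R ^+ 2 * (1 - u) <= 9 * k%:R ^+ 2 * (1 - u) by rewrite ler_pM2r.
have h2 : 2 * k.+2%:R * u <= 6 * k%:R ^+ 2 * u by rewrite ler_pM2r //; lra.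
have h4 : 0 <= k%:R ^+ 2 * u :> R by rewrite mulr_ge0 ?sqr_ge0 ?ltW.
nra.
Qed.

End GeometricTail.

Section MatrixNorm.
Context {R : realType} (d : nat).
Local Notation C := R[i].

Lemma vnorm_le_sum (v : 'cV[C]_d) : vnorm v <= \sum_s normc (v s 0).
Proof.
rewrite -{1}[v]delta_sum.
have H (r : seq 'I_d) : vnorm (\sum_(s <- r) v s 0 *: (delta_mx s 0 : 'cV[C]_d)) <=
    \sum_(s <- r) normc (v s 0).
  elim: r => [|s r IH]; first by rewrite !big_nil vnorm0.
  by rewrite !big_cons (le_trans (vnormD _ _)) // lerD // vnormZ vnorm_delta mulr1.
exact: H.
Qed.

Lemma mnorm_bound (M : 'M[C]_d) (v : 'cV[C]_d) : vnorm (M *m v) <= mnorm M * vnorm v.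
Proof.
pose E := [set vnorm (M *m w) | w in [set w : 'cV[C]_d | vnorm w <= 1]].
have hE : has_ubound E.
  exists (\sum_s \sum_r normc (M s r)) => _ [w w1 <-].
  rewrite (le_trans (vnorm_le_sum _)) //; apply: ler_sum => s _.
  rewrite mxE (le_trans (normc_sum _ _ _)) //; apply: ler_sum => r _.
  rewrite normcM ler_piMr ?normc_ge0 // (le_trans (normc_le_vnorm _ _)) //.
have [v0|v0] := eqVneq (vnorm v) 0.
  by rewrite v0 mulr0 (vnorm_eq0 v0) mulmx0 vnorm0.
have vp : 0 < vnorm v by rewrite lt_neqAle eq_sym v0 vnorm_ge0.
rewrite -ler_pdivrMr //; apply: (ub_le_sup hE).
exists ((vnorm v)^-1%:C *: v); first by rewrite /= vnormZ normcR ger0_norm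
    ?invr_ge0 ?(ltW vp) // mulVf.
by rewrite -scalemxAr vnormZ normcR ger0_norm ?invr_ge0 ?(ltW vp) // mulrC.
Qed.

Lemma mnorm1_ge1 : (0 < d)%N -> 1 <= mnorm (1%:M : 'M[C]_d).
Proof.
move=> d0; have := mnorm_bound 1%:M (delta_mx (Ordinal d0) 0 : 'cV[C]_d).
by rewrite mul1mx vnorm_delta mulr1.
Qed.

End MatrixNorm.

Section EigenfunctionTail.
Context {R : realType} (d : nat).
Local Notation C := R[i].
Implicit Types x : R -> 'cV[C]_d.

Let reparts x (s : 'I_d) (b : bool) (t : R) : R :=
  if b then complex.Re (x t s 0) else complex.Im (x t s 0).

Let part_sum x j : \sum_(p : 'I_d * bool) j.+1%:R ^+ 2 * rcoef j (reparts x p.1 p.2) ^+ 2 =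
   vnorm (hcoef x j) ^+ 2.
Proof.
rewrite sqr_vnorm -(pair_bigA _ (fun (s : 'I_d) (b : bool) =>
    j.+1%:R ^+ 2 * rcoef j (reparts x s b) ^+ 2)) /=.
apply: eq_bigr => s _; rewrite big_bool /= mxE normcM normcR ger0_norm ?ler0n // [RHS]exprMn.
by rewrite -mulrDr sqr_ccoef.
Qed.

Lemma endpoint_bound_partial (g : R -> R) (e B : R) : rcont g -> 0 < e ->
  (forall n, \sum_(j < n) j.+1%:R ^+ 2 * rcoef j g ^+ 2 <= B) ->
  exists n0, forall n, (n0 <= n)%N ->
    g (-1) ^+ 2 <= 3 / pi * (\sum_(j < n) j.+1%:R ^+ 2 * rcoef j g ^+ 2 + e).
Proof.
move=> cg e0 hB.
pose S n := \sum_(j < n) j.+1%:R ^+ 2 * rcoef j g ^+ 2.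
have hS : has_sup (range S).
  by split; [exists (S 0%N); exists 0%N|exists B => _ [n _ <-]; exact: hB].
have hsup n : S n <= sup (range S) by apply: ub_le_sup; [exact: hS.2|exists n].
have [_ [n0 _ <-] hn0] := sup_adherent e0 hS.
exists n0 => n n0n; apply: (le_trans (endpoint_bound cg hsup)).
rewrite ler_wpM2l ?divr_ge0 ?pi_ge0 // -lerBlDr; apply: (le_trans (ltW hn0)).
rewrite /S (big_ord_widen _ (fun j => j.+1%:R ^+ 2 * rcoef j g ^+ 2) n0n).
rewrite [leRHS](bigID (fun j : 'I_n => (j < n0)%N)) /= lerDl sumr_ge0 // => j _.
by rewrite mulr_ge0 ?sqr_ge0.
Qed.

(** The components share a single bound on the sum of their series.  To keep the
    constant independent of d, each series is cut where it is almost complete, and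
    the finitely many components admit a common index. *)
Lemma vector_endpoint_bound x c : vcont x -> l2le (hcoef x) c ->
  vnorm (x (-1)) ^+ 2 <= 3 / pi * c ^+ 2.
Proof.
move=> cx [c0 hc].
have cr (p : 'I_d * bool) : rcont (reparts x p.1 p.2).
  by have /wcontP[h1 h2] := cx p.1; rewrite /reparts; case: p.2.
have hp (p : 'I_d * bool) n : \sum_(j < n) j.+1%:R ^+ 2 * rcoef j (reparts x p.1 p.2) ^+ 2 <=
    c ^+ 2.
  apply: le_trans (hc n); apply: ler_sum => j _; rewrite -part_sum.
  by rewrite (bigD1 p) //= lerDl sumr_ge0 // => q _; rewrite mulr_ge0 ?sqr_ge0.
have pi0 : 0 <= 3 / pi :> R by rewrite divr_ge0 // pi_ge0.
apply/ler_addgt0Pr => e e0.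
pose K : R := 3 / pi * (d * 2)%:R + 1.
have K0 : 0 < K by rewrite ltr_wpDl // mulr_ge0.
have q0 : 0 < e / K by rewrite divr_gt0.
have [n0 hn0] := choice (fun p => endpoint_bound_partial (cr p) q0 (hp p)).
pose n := \max_p n0 p.
have -> : vnorm (x (-1)) ^+ 2 = \sum_(p : 'I_d * bool) reparts x p.1 p.2 (-1) ^+ 2.
  rewrite sqr_vnorm -(pair_bigA _ (fun (s : 'I_d) (b : bool) => reparts x s b (-1) ^+ 2)) /=.
  by apply: eq_bigr => s _; rewrite big_bool /= sqr_normcE.
apply: (@le_trans _ _ (\sum_(p : 'I_d * bool) 3 / pi * (\sum_(j < n)
    j.+1%:R ^+ 2 * rcoef j (reparts x p.1 p.2) ^+ 2 + e / K))).
  by apply: ler_sum => p _; apply: hn0; exact: leq_bigmax.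
rewrite -mulr_sumr big_split /= exchange_big /=.
rewrite (eq_bigr _ (fun (j : 'I_n) _ => part_sum x j)) sumr_const card_prod card_ord card_bool.
rewrite mulrDr lerD //; first by apply: ler_wpM2l; [exact: pi0|exact: hc].
rewrite -[e / K *+ _]mulr_natl (_ : 3 / pi * _ = e * (3 / pi * (d * 2)%:R / K)); last by ring.
rewrite ler_piMr ?(ltW e0) //.
by rewrite ler_pdivrMr // mul1r /K lerDl.
Qed.

(** The components of Phi v are analytic on the ellipse and bounded there by
    Cmu |v|, where |v| ^ 2 <= 3 / pi for v = x (-1).  Hence each coefficient of a
    component is at most 4 pi Cmu ^ 2 (3 / pi) u ^ j in square, which accounts for
    the constant 12. *)
Lemma eigenfunction_tail (S s eta Cmu : R) (Phi : C -> 'M[C]_d) x (k : nat) :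
  (0 < d)%N -> ellipse_axes S s -> expR eta = S + s -> 0 < eta -> (0 < k)%N ->
  (forall z, ellipse S s z -> forall i j, holo_at (fun w => Phi w i j) z) ->
  (forall z, ellipse S s z -> mnorm (Phi z) <= Cmu) -> 1 <= Cmu ->
  vcont x -> (forall t, I11 t -> x t = Phi t%:C *m x (-1)) -> l2le (hcoef x) 1 ->
  let eps := 8 * Num.sqrt d%:R * Cmu * (sinh eta)^-1 * k%:R * expR (- (k%:R * eta)) in
  eps < 1 -> l2le (fun j => if (j <= k)%N then 0 else hcoef x j) eps.
Proof.
move=> d0 hE heta eta0 k0 hPhi hC C1 cx xE x1 eps eps1.
have C0 : 0 <= Cmu by lra.
pose v := x (-1).
have v2 : vnorm v ^+ 2 <= 3 / pi by have := vector_endpoint_bound cx x1; rewrite expr1n mulr1.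
have p0 := @pi_gt0 R.
have sh0 : 0 < sinh eta.
  by rewrite /sinh divr_gt0 // subr_gt0 ltr_expR; lra.
have dR : 1 <= Num.sqrt d%:R :> R by rewrite -{1}[1]sqrtr1 ler_wsqrtr // ler1n.
have eps0 : 0 <= eps by rewrite !mulr_ge0 ?expR_ge0 ?sqrtr_ge0 ?invr_ge0 // ltW.
have small : 8 * k%:R * expR (- (k%:R * eta)) < sinh eta.
  have : 8 * k%:R * expR (- (k%:R * eta)) / sinh eta <= eps.
    have -> : eps = (Num.sqrt d%:R * Cmu) * (8 * k%:R * expR (- (k%:R * eta)) / sinh eta).
      by rewrite /eps; ring.
    apply: ler_peMl; last by nra.
    by rewrite divr_ge0 ?(ltW sh0) // !mulr_ge0 ?expR_ge0.
  move=> /le_lt_trans /(_ eps1); rewrite ltr_pdivrMr // mul1r //.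
have hf (r : 'I_d) z : ellipse S s z -> holo_at (fun w => (Phi w *m v) r 0) z.
  move=> ez; rewrite (_ : (fun w => _) = (fun w => \sum_i v i 0 * Phi w r i)); last first.
    by apply/funext => w; rewrite mxE; apply: eq_bigr => i _; rewrite mulrC.
  elim: (index_enum _) => [|i q IH].
    under eq_fun do rewrite big_nil; have := holo_at_lin 0 z.
    by under eq_fun do rewrite mul0r.
  under eq_fun do rewrite big_cons.
  by apply: holo_at_add => //; apply: holo_at_mull; exact: hPhi.
have fM (r : 'I_d) z : ellipse S s z -> normc ((Phi z *m v) r 0) <= Cmu * vnorm v.
  move=> ez; rewrite (le_trans (normc_le_vnorm _ _)) // (le_trans (mnorm_bound _ _)) //.
  by rewrite ler_wpM2r ?vnorm_ge0 // hC.
pose u := expR (- eta) ^+ 2.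
have uj (j : nat) : expR (- (j%:R * eta)) ^+ 2 = u ^+ j.
  by rewrite -mulrN expRM_natl /u -!exprM mulnC.
have u0 : 0 <= u by exact: sqr_ge0.
have u1 : u < 1 by rewrite /u expr_lt1 // ?expR_ge0 // expR_lt1 oppr_lt0.
have hj j : vnorm (hcoef x j) ^+ 2 <= 12 * d%:R * Cmu ^+ 2 * (j.+1%:R ^+ 2 * u ^+ j).
  rewrite sqr_vnorm.
  apply: (@le_trans _ _ (\sum_(r < d) 12 * Cmu ^+ 2 * (j.+1%:R ^+ 2 * u ^+ j))); last first.
    by rewrite sumr_const card_ord -[_ *+ d]mulr_natl le_eqVlt; apply/orP; left; apply/eqP; ring.
  apply: ler_sum => r _; rewrite mxE normcM normcR ger0_norm ?ler0n // [leLHS]exprMn.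
  have -> : ccoef j (component x r) = ccoef j (fun t => (Phi t%:C *m v) r 0).
    by apply: eq_ccoef => t It; rewrite /component xE.
  have := ccoef_decay j hE heta (ltW eta0) (hf r) (fM r); rewrite uj => h.
  rewrite [leRHS]mulrCA ler_wpM2l ?sqr_ge0 //; apply: (le_trans h).
  rewrite ler_wpM2r ?exprn_ge0 // exprMn.
  apply: (@le_trans _ _ (4 * pi * (Cmu ^+ 2 * (3 / pi)))).
    by rewrite ler_wpM2l ?mulr_ge0 ?(ltW p0) // ler_wpM2l ?sqr_ge0.
  rewrite le_eqVlt; apply/orP; left; apply/eqP.
  have E (p c : R) : 0 < p -> 4 * p * (c * (3 / p)) = 12 * c by move=> q; field; exact: lt0r_neq0.
  exact: E.
split=> // n.
apply: (@le_trans _ _ (d%:R * Cmu ^+ 2 * (12 *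
    \sum_(j < n) (if (j <= k)%N then 0 else j.+1%:R ^+ 2 * u ^+ j)))).
  rewrite !mulr_sumr; apply: ler_sum => j _; case: ifP => _.
    by rewrite vnorm0 expr0n !mulr0.
  by apply: (le_trans (hj j)); rewrite le_eqVlt; apply/orP; left; apply/eqP; ring.
have dC : 0 <= d%:R * Cmu ^+ 2 by rewrite mulr_ge0 ?sqr_ge0.
apply: (le_trans (ler_wpM2l dC (ler_wpM2l _ (geometric_tail k n u0 u1)))) => //.
apply: (le_trans (ler_wpM2l dC (tail_constant (erefl u) eta0 k0 small))).
rewrite -/u -uj /eps !exprMn sqr_sqrtr // le_eqVlt; apply/orP; left; apply/eqP; ring.
Qed.

End EigenfunctionTail.

(** * The eigenvalue bound for finite norms *)

Section EigenvalueBound.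
Context {R : realType} (d N : nat).
Local Notation C := R[i].
Local Notation l := (colloc_size d N).

Variables (A B : C -> 'M[C]_d) (PhiA : R -> 'M[C]_d).
Hypothesis cA : mcont (fun t : R => A t%:C).
Hypothesis cB : mcont (fun t : R => B t%:C).
Hypothesis hPhiA : fundamental_solution (fun t => A t%:C) PhiA.
Let U := monodromy B PhiA.
Let cU f (cf : vcont f) : vcont (U f) := monodromy_vcont cA cB hPhiA cf.

Lemma monodromy_bound (u0 c : R) f :
  opnorm (@H1v R d) (@H1norm R d) (@H1norm R d) U = u0%:E ->
  vcont f -> l2le (hcoef f) c -> l2le (hcoef (U f)) (u0 * c).
Proof.
move=> hu cf hc.
pose rel a b := exists f, [/\ vcont f, a = hcoef f & b = hcoef (U f)].
apply: (@homogeneous_bound R d rel u0 _ _ (hcoef f)) => //; last by exists f.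
- move=> _ _ z z0 [g [cg -> ->]]; exists (fun t => z%:C *: g t).
  split; first exact: (@vcontZ _ _ g z%:C cg).
    by apply/funext => j; rewrite (hcoefZ _ _ cg).
  apply/funext => j; rewrite -(hcoefZ _ _ (cU cg)).
  by apply: eq_hcoef => t It; rewrite /U (monodromyZ cA cB hPhiA _ cg It).
- move=> _ _ [g [cg -> ->]] h1; have hg := H1vP cg h1.
  have g1 : (H1norm g <= 1)%E by rewrite (H1normE cg); apply/l2leP.
  have := opnorm_ge hu hg g1; rewrite (H1normE (cU cg)) => hM.
  by apply/l2leP => //; apply: le_opnorm0 hM; exact: l2norm_ge0.
Qed.

Variables (PiN : (R -> 'cV[C]_d) -> 'cV[{poly C}]_d) (hPiN : orth_proj N PiN).
Variables (V : 'M[C]_l) (lam : 'rV[C]_l) (hV : V \in unitmx).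
Hypothesis hUN : monodromy_mx N A B = V *m diag_mx lam *m invmx V.
Variables (Vh : (nat -> 'cV[C]_d) -> (R -> 'cV[C]_d)) (hVh : is_Vhat V Vh).
Variables (Vi : (R -> 'cV[C]_d) -> (nat -> 'cV[C]_d)) (hVi : is_inverse Vh Vi).
Variable nu : nat -> 'I_d -> R.
Hypothesis hnu : forall j, (j <= N)%N -> forall r : 'I_d,
  (H1norm (fun t => monodromy B PhiA (chebH1v j r) t
                     - monodromyN N A B PiN (chebH1v j r) t)%R <= (nu j r)%:E)%E.
Variables (mu lam1 : C) (x : R -> 'cV[C]_d).
Hypothesis hx : H1v x.
Hypothesis x_le1 : l2le (hcoef x) 1.
Hypothesis x1 : forall c, l2le (hcoef x) c -> 1 <= c.
Hypothesis hmux : forall t, I11 t -> U x t = mu *: x t.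
Hypothesis lam1_max : forall i, normc (lam 0 i) <= normc lam1.

Let cx : vcont x := H1v_vcont hx.
Let cT k r : vcont (chebH1v k r) := @vcont_chebH1v R d k r.

Let head k (t : R) : 'cV[C]_d :=
  \sum_(i < k.+1) \sum_(r < d) hcoef x i r 0 *: chebH1v i r t.

Let chead1 k (i : 'I_k.+1) : vcont (fun t => \sum_(r < d) hcoef x i r 0 *: chebH1v i r t) :=
  @vcont_sum R d _ _ (fun r t => hcoef x i r 0 *: chebH1v i r t) (fun r =>
      @vcontZ R d (chebH1v i r) (hcoef x i r 0) (@cT i r)).

Let chead k : vcont (head k) := @vcont_sum R d _ _ _ (fun i : 'I_k.+1 => @chead1 k i).

Let ctail k : vcont (fun t => x t - head k t) := @vcontB R d _ _ cx (@chead k).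

Let hcoef_head k j : hcoef (head k) j = if (j <= k)%N then hcoef x j else 0.
Proof.
rewrite /head (hcoef_sum _ _ (fun i : 'I_k.+1 => @chead1 k i)).
rewrite -[RHS](_ : \sum_(i < k.+1 | i == j :> nat) hcoef x i = _); last first.
  by rewrite (big_ord1_eq _ (hcoef x)) ltnS.
rewrite [RHS]big_mkcond; apply: eq_bigr => i _.
rewrite (hcoef_sum _ _ (fun r => @vcontZ R d (chebH1v i r) (hcoef x i r 0) (@cT i r))).
under eq_bigr => r _ do rewrite (hcoefZ _ _ (@cT i r)) hcoef_chebH1v eq_sym.
case: eqP => _; first exact: delta_sum.
by rewrite big1 // => r _; rewrite scaler0.
Qed.

Let hcoef_tail k j : hcoef (fun t => x t - head k t) j = if (j <= k)%N then 0 else hcoef x j.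
Proof. by rewrite (hcoefB _ cx (@chead k)) hcoef_head; case: ifP; rewrite ?subrr ?subr0. Qed.

Let eigen_split k j : mu *: hcoef x j =
  \sum_(i < k.+1) \sum_(r < d) hcoef x i r 0 *: hcoef (U (chebH1v i r)) j +
  hcoef (U (fun t => x t - head k t)) j.
Proof.
rewrite -(hcoefZ _ _ cx).
rewrite (@eq_hcoef _ _ _ (fun t => U (head k) t + U (fun t => x t - head k t) t)); last first.
  move=> t It; rewrite -hmux // /U -(monodromyD cA cB hPhiA (@chead k) (@ctail k) It).
  by congr monodromy; apply/funext => u; rewrite addrC subrK.
rewrite (hcoefD _ (cU (@chead k)) (cU (@ctail k))); congr (_ + _).
rewrite (@eq_hcoef _ _ _ (fun t => \sum_(i < k.+1) \sum_(r < d)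
    hcoef x i r 0 *: U (chebH1v i r) t)); last first.
  move=> t It; rewrite /U /head (monodromy_sum cA cB hPhiA _ (fun i : 'I_k.+1 => @chead1 k i) It).
  apply: eq_bigr => i _.
  rewrite (monodromy_sum cA cB hPhiA _ (fun r => @vcontZ R d (chebH1v i r) (hcoef x i r 0)
      (@cT i r)) It).
  by apply: eq_bigr => r _; rewrite (monodromyZ cA cB hPhiA _ (@cT i r) It).
have c1 (i : 'I_k.+1) (r : 'I_d) : vcont (fun t => hcoef x i r 0 *: U (chebH1v i r) t).
  exact: (@vcontZ R d _ _ (cU (@cT i r))).
rewrite (hcoef_sum _ _ (fun i : 'I_k.+1 => @vcont_sum R d _ _ _ (c1 i))).
apply: eq_bigr => i _; rewrite (hcoef_sum _ _ (c1 i)).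
by apply: eq_bigr => r _; rewrite (hcoefZ _ _ (cU (@cT i r))).
Qed.

Variables (p0 q0 u0 : R).
Hypothesis hp : opnorm (@l2 R d) (@l2norm R d) (@H1norm R d) Vh = p0%:E.
Hypothesis hq : opnorm (@H1v R d) (@H1norm R d) (@l2norm R d) Vi = q0%:E.
Hypothesis hu : opnorm (@H1v R d) (@H1norm R d) (@H1norm R d) U = u0%:E.
Variable m : R.
Hypothesis m_min : forall i, m <= normc (mu - lam 0 i).
Hypothesis m_min1 : m <= normc (mu - lam1).

(** Composing the operator with its inverse fixes x, which has norm 1. *)
Lemma cond_ge1 : 1 <= p0 * q0.
Proof.
have [al _] := (proj1 hVi) x hx.
have ax j : synth V (Vi x) j = hcoef x j by exact: (synth_inverse hVh hVi j hx).
apply: x1; apply: (eq_l2le ax).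
rewrite -[q0]mulr1; apply: (synth_bound hVh hp); apply: (inverse_bound hVh hVi hq al).
by apply: eq_l2le x_le1 => j; rewrite ax.
Qed.

Lemma eigenvalue_le_norm : normc mu <= u0.
Proof.
have h : l2le (hcoef (U x)) u0 by have := monodromy_bound hu cx x_le1; rewrite mulr1.
have {}h : l2le (fun j => mu *: hcoef x j) u0.
  apply: eq_l2le h => j; rewrite -(hcoefZ _ _ cx).
  by apply: eq_hcoef => t It; exact: hmux.
have [mu0|mu0] := eqVneq (normc mu) 0; first by rewrite mu0; case: h.
have mup : 0 < normc mu by rewrite lt_neqAle eq_sym mu0 normc_ge0.
have : 1 <= (normc mu)^-1 * u0.
  apply: x1; apply: l2le_scale h => [|j]; first by rewrite invr_ge0 ltW.
  by rewrite vnormZ mulrA mulVf // mul1r.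
by rewrite mulrC ler_pdivlMr // mul1r.
Qed.

Lemma eigenvalue_bound k (rho : R) : (k <= N)%N ->
  l2le (fun j => if (j <= k)%N then 0 else hcoef x j) rho ->
  m <= p0 * q0 *
  (Num.sqrt (\sum_(i < k.+1) \sum_(r < d) nu i r ^+ 2) + rho * (u0 + normc lam1 * (p0 * q0))).
Proof.
move=> kN tail; have [al _] := (proj1 hVi) x hx.
pose UN (i : nat) (r : 'I_d) j := hcoef (monodromyN N A B PiN (chebH1v i r)) j.
(* The coordinates of a basis function with respect to the eigenvectors. *)
pose beta (i : nat) (r : 'I_d) := invmx V *m evalN N (PiN (chebH1v i r)).
apply: (@bauer_fike R d N V lam lam1 mu p0 q0 u0 rho m _ _ lam1_max m_min m_min1
  (hcoef x) (Vi x) (hcoef (U (fun t => x t - head k t))) k kN x1 x_le1 al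
  (fun j => synth_inverse hVh hVi j hx) tail (fun i r j => hcoef (U (chebH1v i r)) j) UN nu beta).
- by move=> a c; exact: (synth_bound hVh hp).
- by move=> a c; exact: (inverse_bound hVh hVi hq).
- apply: (monodromy_bound hu (@ctail k)).
  by apply: eq_l2le tail => j; rewrite hcoef_tail.
- by move=> j; exact: eigen_split.
- move=> i r j iN; have [pP pE] := hcoef_orth_proj r j hPiN iN.
  by rewrite /beta mulKVmx // (interp_coef_eval _ pP) pE hcoef_chebH1v.
- move=> i r j iN; rewrite /UN /beta !mulmxA -hUN.
  by [].
- move=> i r iN; have := hnu iN r.
  have cN : vcont (monodromyN N A B PiN (chebH1v i r)) by exact: (@vcont_poly_fun R d _).
  rewrite (H1normE (@vcontB R d _ _ (cU (@cT i r)) cN)) => h.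
  have n0 : 0 <= nu i r by apply: le_opnorm0 h; exact: l2norm_ge0.
  apply: eq_l2le (proj1 (l2leP _ n0) h) => j.
  by rewrite (hcoefB _ (cU (@cT i r)) cN).
Qed.

End EigenvalueBound.

(** * Extended norms and the theorem *)

Section ExtendedNorms.
Context {R : realType}.
Local Open Scope ereal_scope.

Lemma le_opnorm (U W : Type) (X : set U) (nX : U -> \bar R) (nY : W -> \bar R) (T : U -> W) f :
  X f -> nX f <= 1 -> nY (T f) <= opnorm X nX nY T.
Proof. by move=> Xf f1; apply: ereal_sup_ubound; exists f. Qed.

Lemma le_bigmine_mul (m c : \bar R) (F : nat -> \bar R) (a b : nat) : 0 < c ->
  (forall k, (a <= k < b)%N -> m <= F k * c) ->
  m <= \big[mine/+oo]_(a <= k < b) F k * c.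
Proof.
move=> c0 h; rewrite big_nat_cond.
apply: (big_ind (fun y => m <= y * c)).
- by rewrite gt0_mulye // leey.
- by move=> y z hy hz; rewrite /mine; case: ifP.
- by move=> k /andP[kab _]; exact: h.
Qed.

(** The norms being positive, the bound is infinite as soon as one of them is. *)
Lemma finite_norms_suffice (p q u : \bar R) (m e x L : R) :
  0 < p -> 0 < q -> 0 < u -> (0 < e)%R -> (0 <= x)%R -> (0 <= L)%R ->
  (forall p0 q0 u0 : R, p = p0%:E -> q = q0%:E -> u = u0%:E ->
     (m <= (e * (u0 + L * (p0 * q0)) + x) * (p0 * q0))%R) ->
  m%:E <= (e%:E * (u + L%:E * (p * q)) + x%:E) * (p * q).
Proof.
move=> p0 q0 u0 e0 x0 L0 h.
have pq : 0 < p * q by exact: mule_gt0.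
have u1 : 0 < u + L%:E * (p * q).
  by rewrite (lt_le_trans u0) // leeDl // mule_ge0 ?lee_fin // ltW.
have w0 : 0 < e%:E * (u + L%:E * (p * q)) + x%:E.
  have e1 : 0 < e%:E * (u + L%:E * (p * q)) by rewrite mule_gt0 ?lte_fin.
  by rewrite (lt_le_trans e1) // leeDl // lee_fin.
have [pqy|pqy] := eqVneq (p * q) +oo; first by rewrite pqy gt0_muley ?leey // -pqy.
have [pr [qr [pE qE]]] : exists pr qr : R, p = pr%:E /\ q = qr%:E.
  case: (p) p0 pq pqy => [pr| |] // p0 pq; case: (q) q0 pq => [qr| |] // q0 pq.
  - by exists pr, qr.
  - by rewrite gt0_muley // eqxx.
  - by rewrite gt0_mulye // eqxx.
move: h; rewrite pE qE -EFinM; move: pq; rewrite pE qE -EFinM lte_fin => pq h.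
case: u u0 h {u1 w0} => [ur| |] // u0 h.
  exact: (h pr qr ur).
by rewrite addye // gt0_muley ?lte_fin // addye // gt0_mulye ?lte_fin // leey.
Qed.

End ExtendedNorms.

Theorem theorem23 (R : realType) (d N : nat) (hd : (0 < d)%N) (hN : (0 < N)%N)
  (* coefficients, regularity ellipse *)
  (A B : R[i] -> 'M[R[i]]_d) (S s eta : R)
  (hE : ellipse_axes S s) (hSs : 1 < S + s) (heta : expR eta = S + s)
  (hAB : exists O : set R[i], [/\ @open R[i]^o O, ellipse S s `<=` O,
     analytic_mx_on O A & analytic_mx_on O B])
  (* the monodromy operator *)
  (PhiA : R -> 'M[R[i]]_d)
  (hPhiA : fundamental_solution (fun t => A t%:C) PhiA)
  (delta : R) (hdelta : 0 < delta)
  (mu : R[i]) (x : R -> 'cV[R[i]]_d)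
  (hx : H1v x) (hx1 : H1norm x = 1%E)
  (hmux : forall t, I11 t -> monodromy B PhiA x t = mu *: x t)
  (hmu : delta <= normc mu)
  (* the fundamental solution attached to mu, continued to the ellipse *)
  (Phimu : R[i] -> 'M[R[i]]_d)
  (hPhimu : fundamental_solution (fun t => A t%:C + mu^-1 *: B t%:C)
     (fun t => Phimu t%:C))
  (hPhimuE : exists O : set R[i], [/\ @open R[i]^o O, ellipse S s `<=` O &
     analytic_mx_on O Phimu])
  (Cmu : R) (hCmu : forall z, ellipse S s z -> mnorm (Phimu z) <= Cmu)
  (* the collocation approximation and its eigendecomposition *)
  (hinv : diffmx_hatI d N - mxA N A \in unitmx)
  (PiN : (R -> 'cV[R[i]]_d) -> 'cV[{poly R[i]}]_d) (hPiN : orth_proj N PiN)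
  (V : 'M[R[i]]_(colloc_size d N)) (lam : 'rV[R[i]]_(colloc_size d N))
  (hV : V \in unitmx)
  (hUN : monodromy_mx N A B = V *m diag_mx lam *m invmx V)
  (hlam : forall i j : 'I_(colloc_size d N), (i <= j)%N ->
     normc (lam 0 j) <= normc (lam 0 i))
  (Vh : (nat -> 'cV[R[i]]_d) -> (R -> 'cV[R[i]]_d)) (hVh : is_Vhat V Vh)
  (Vi : (R -> 'cV[R[i]]_d) -> (nat -> 'cV[R[i]]_d)) (hVi : is_inverse Vh Vi)
  (nu : nat -> 'I_d -> R)
  (hnu : forall j, (j <= N)%N -> forall r : 'I_d,
     (H1norm (fun t => monodromy B PhiA (chebH1v j r) t
                     - monodromyN N A B PiN (chebH1v j r) t)%R
       <= (nu j r)%:E)%E) :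
  let eps (k : nat) : R := 8 * Num.sqrt d%:R * Cmu * (sinh eta)^-1
                             * k%:R * expR (- (k%:R * eta)) in
  let xi (k : nat) : R :=
    Num.sqrt (\sum_(0 <= j < k.+1) \sum_(r < d) nu j r ^+ 2) in
  let normU : \bar R :=
    opnorm (@H1v R d) (@H1norm R d) (@H1norm R d) (monodromy B PhiA) in
  let condV : \bar R :=
    (opnorm (@l2 R d) (@l2norm R d) (@H1norm R d) Vh *
     opnorm (@H1v R d) (@H1norm R d) (@l2norm R d) Vi)%E in
  let lam1 : R[i] := lam 0 (tagnat.Rank ord0 (Ordinal hd)) in
  let omega (k : nat) : \bar R :=
    ((eps k)%:E * (normU + (normc lam1)%:E * condV)
      + ((1 + eps k) * xi k)%:E)%E in
  (\big[mine/+oo]_(i < colloc_size d N) (normc (mu - lam 0 i)%R)%:E <=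
   (\big[mine/+oo]_(1 <= k < N.+1) omega k) * condV)%E.
Proof.
cbv zeta.
pose eps (k : nat) : R := 8 * Num.sqrt d%:R * Cmu * (sinh eta)^-1 * k%:R * expR (- (k%:R * eta)).
pose xi (k : nat) : R := Num.sqrt (\sum_(0 <= j < k.+1) \sum_(r < d) nu j r ^+ 2).
pose lam1 : R[i] := lam 0 (tagnat.Rank ord0 (Ordinal hd)).
set p := opnorm (@l2 R d) _ _ Vh; set q := opnorm (@H1v R d) _ _ Vi.
set u := opnorm _ _ _ (monodromy B PhiA).
have [S1 s0] : 1 <= S /\ 0 < s.
  by case: hE => s0 sS; move=> h; split=> //; nra.
have I_ellipse (t : R) : I11 t -> ellipse S s t%:C.
  rewrite /I11 /= in_itv /= => /andP[t1 t2].
  rewrite /ellipse /= mul0r expr0n addr0 expr_div_n ler_pdivrMr ?exprn_gt0 ?(lt_le_trans ltr01) //.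
  by rewrite mul1r; nra.
have eta0 : 0 < eta by rewrite -expR_gt1 heta.
have mu0 : mu != 0.
  by apply/eqP => mu0; move: hmu; rewrite mu0 normc0 leNgt hdelta.
have normc_mu : 0 < normc mu by exact: lt_le_trans hmu.
have [D [_ OE OA OB]] := hAB.
have cA : mcont (fun t : R => A t%:C).
  by move=> i j; apply: (@holo_wcont R (fun z => A z i j)) => t It; apply: analytic_holo;
      apply: OA; apply: OE; exact: I_ellipse.
have cB : mcont (fun t : R => B t%:C).
  by move=> i j; apply: (@holo_wcont R (fun z => B z i j)) => t It; apply: analytic_holo;
      apply: OB; apply: OE; exact: I_ellipse.
have hPhi z : ellipse S s z -> forall i j, holo_at (fun w => Phimu w i j) z.
  by have [D' [_ OE' OP]] := hPhimuE; move=> ez i j; apply: analytic_holo; apply: OP; exact: OE'.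
have C1 : 1 <= Cmu.
  (* The fundamental matrix is the identity at -1. *)
  have := hCmu _ (I_ellipse _ I11_N1); case: hPhimu => -> _.
  by apply: le_trans; exact: mnorm1_ge1.
have cx : vcont x := H1v_vcont hx.
have nx : l2norm (hcoef x) = 1%E by rewrite -(H1normE cx).
have x_le1 : l2le (hcoef x) 1 by exact: l2le_norm.
have x1 c : l2le (hcoef x) c -> 1 <= c.
  by move=> h; have c0 := proj1 h; move/(l2leP _ c0): h; rewrite nx lee_fin.
have xE := eigenfunction_ode cA cB hPhiA mu0 cx hmux hPhimu.
have l0 : (0 < colloc_size d N)%N by rewrite sizeE muln_gt0 hd.
have lam1_max i : normc (lam 0 i) <= normc lam1.
  by apply: hlam; rewrite RankE /= mul0n.
have [i0 m_min] : exists i0, forall i, normc (mu - lam 0 i0) <= normc (mu - lam 0 i).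
  pose i1 := Ordinal l0.
  case: (@arg_minP _ _ _ i1 xpredT (fun i => normc (mu - lam 0 i)) isT) => i0 _ h.
  by exists i0 => i; exact: h.
pose m := normc (mu - lam 0 i0).
apply: (@le_trans _ _ m%:E).
  exact: bigmin_le_cond.
have H1norm_x1 : (H1norm x <= 1)%E by rewrite hx1.
have p_ge0 : (0 <= p)%E.
  apply: le_trans (@le_opnorm _ _ _ _ _ _ Vh (fun=> 0) _ _); first exact: sqrte_ge0.
    exact: l2le_l2 (l2le0 d).
  apply/l2leP => //; exact: l2le_weaken (l2le0 d).
have q_ge0 : (0 <= q)%E.
  by apply: le_trans (@le_opnorm _ _ _ _ _ _ Vi x hx H1norm_x1); exact: sqrte_ge0.
have u_ge : (H1norm (monodromy B PhiA x) <= u)%E by exact: le_opnorm hx H1norm_x1.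
have [al _] := (proj1 hVi) x hx.
have [ca [na _]] := l2_fin al.
have ax j : synth V (Vi x) j = hcoef x j by exact: (synth_inverse hVh hVi j hx).
have p_gt0 : (0 < p)%E.
  rewrite lt_neqAle p_ge0 andbT; apply/eqP => p0.
  have : l2le (hcoef x) 0.
    rewrite -(mul0r ca); apply: (eq_l2le ax).
    by apply: (synth_bound hVh) (l2le_norm na); rewrite -/p -p0.
  by move/x1; rewrite ler10.
have q_gt0 : (0 < q)%E.
  rewrite lt_neqAle q_ge0 andbT; apply/eqP => q0.
  have a0 : l2le (Vi x) 0.
    rewrite -(mul0r 1); apply: (inverse_bound hVh hVi _ al).
      by rewrite -/q -q0.
    by apply: eq_l2le x_le1 => j; rewrite ax.
  have : l2le (hcoef x) 0.
    apply: eq_l2le (l2le0 d) => j; rewrite -ax -[Vi x](_ : (fun i => 0 *: Vi x i) = _).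
      by rewrite synthZ scale0r.
    by apply/funext => i; rewrite scale0r (l2le_eq0 a0).
  by move/x1; rewrite ler10.
have u_gt0 : (0 < u)%E.
  have u_ge0 : (0 <= u)%E by apply: le_trans u_ge; exact: sqrte_ge0.
  rewrite lt_neqAle u_ge0 andbT; apply/eqP => u0.
  by have := eigenvalue_le_norm cA cB hPhiA hx x_le1 x1 hmux (esym u0); rewrite leNgt normc_mu.
have sh0 : 0 < sinh eta by rewrite /sinh divr_gt0 // subr_gt0 ltr_expR; lra.
apply: le_bigmine_mul => [|k /andP[k0]]; first exact: mule_gt0.
rewrite ltnS => kN.
have eps_gt0 : 0 < eps k.
  rewrite /eps !mulr_gt0 ?expR_gt0 ?invr_gt0 ?sqrtr_gt0 ?ltr0n //.
  exact: lt_le_trans C1.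
have xi_ge0 : 0 <= xi k by exact: sqrtr_ge0.
apply: (@finite_norms_suffice R p q u m (eps k) ((1 + eps k) * xi k) (normc lam1)) => //.
- by rewrite mulr_ge0 // addr_ge0 // ltW.
- exact: normc_ge0.
move=> p0 q0 u0 pE qE uE.
have pq1 : 1 <= p0 * q0 by exact: (cond_ge1 hVh hVi hx x_le1 x1 pE qE).
have mu_u0 : normc mu <= u0 by exact: (eigenvalue_le_norm cA cB hPhiA hx x_le1 x1 hmux uE).
have w0 : 0 <= normc lam1 * (p0 * q0) by rewrite mulr_ge0 ?normc_ge0 // (le_trans ler01).
have pq0 : 0 <= p0 * q0 by lra.
have u00 : 0 <= u0 by rewrite (le_trans _ mu_u0) ?normc_ge0.
have [eps1|eps1] := leP 1 (eps k).
  (* No decay is left to exploit: |mu - lam1| <= |mu| + |lam1| is enough. *)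
  have m_le : m <= u0 + normc lam1 * (p0 * q0).
    apply: (le_trans (m_min (tagnat.Rank ord0 (Ordinal hd)))).
    rewrite -/lam1 (le_trans (ler_normcB _ _)) // lerD // ler_peMr ?normc_ge0 //.
  apply: (le_trans m_le).
  have X0 : 0 <= u0 + normc lam1 * (p0 * q0) by rewrite addr_ge0.
  have Y0 : 0 <= (1 + eps k) * xi k by rewrite mulr_ge0 // addr_ge0 // ltW.
  apply: (@le_trans _ _ (eps k * (u0 + normc lam1 * (p0 * q0)) + (1 + eps k) * xi k)).
    by rewrite -[leLHS]addr0 lerD // ler_peMl.
  by rewrite ler_peMr // addr_ge0 // mulr_ge0 // ltW.
have tail := eigenfunction_tail hd hE heta eta0 k0 hPhi hCmu C1 cx xE x_le1 eps1.
have := eigenvalue_bound cA cB hPhiA hPiN hV hUN hVh hVi hnu hx x_le1 x1 hmux lam1_max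
  pE qE uE m_min (m_min _) kN tail.
move=> /le_trans; apply; rewrite mulrC ler_wpM2r // addrC lerD2l.
rewrite -[X in X <= _](_ : xi k = _); last by rewrite /xi big_mkord.
by rewrite ler_peMl // lerDl ltW.
Qed.
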